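(* Let $(X,Y)$, $(X^{(n)},Y^{(n)})_{n\ge1}$, $(p_n)$, $(q_n)$, $S_n$, $T_n$ be as in the standing setting described in the context, and let $(a_n)$ be a decreasing sequence of positive reals with $a_n\to0$. Let $p,q\in\mathbb{N}^*$ be such that $p/q\in R_X$, $p_n/q_n\in R_{X^{(n)}}$ for all $n$, and $p_n/q_n\to p/q$. Let $\tau$ (resp. $\tau_n$) be the unique real such that $\psi_X'(\tau)=p/q$ (resp. $\psi_{X^{(n)}}'(\tau_n)=p_n/q_n$). Assume that 1. there exists $r_0>0$ such that $B_0:=\,]-r_0,r_0[\ \subset(\mathrm{dom}\,\psi_Y)\cap\bigl(\bigcap_{n\ge1}\mathrm{dom}\,\psi_{Y^{(n)}}\bigr)$; 2. there exists $r>0$ such that $I_\tau:=[\tau-r,\tau+r]\subset(\mathrm{dom}\,\psi_X)\cap\bigl(\bigcap_{n\ge1}\mathrm{dom}\,\psi_{X^{(n)}}\bigr)$ and $$\forall s\in I_\tau,\quad \sup_{t\in\mathbb{R}}\left|\mathbb{E}\left[e^{(it+s)X^{(n)}}-e^{(it+s)X}\right]\right|\xrightarrow[n\to\infty]{}0,$$ $$\sup_n\ \sup_{(s,v)\in I_\tau\times B_0}\mathbb{E}\left(e^{sX^{(n)}+v\left(Y^{(n)}-\mathbb{E}(\check Y^{(n)}_{\tau_n})\right)}\right)<\infty;$$ 3. $na_nq_n\to+\infty$. Then the distribution of $\sqrt{\frac{a_n}{nq_n}}\,\bigl(T_n-nq_n\,\mathbb{E}(\check Y^{(n)}_{\tau_n})\bigr)$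 conditioned by the event $\{S_n=np_n\}$ satisfies a large deviation principle (on $\mathbb{R}$) with good rate function $J(y)=\dfrac{y^2}{2\alpha_\tau^2}$ and speed $a_n$.
   Context: Standing setting. $\mathbb{N}=\{0,1,2,\dots\}$, $\mathbb{N}^*=\{1,2,\dots\}$. The span of an $\mathbb{N}$-valued random variable $Z$ is $m_Z:=\sup\{m\in\mathbb{N}:\exists b\in\mathbb{N},\ \mathrm{Supp}(Z)\subset m\mathbb{N}+b\}$. For each $n\in\mathbb{N}^*$, $(X^{(n)},Y^{(n)})$ is a random vector with $X^{(n)}$ valued in $\mathbb{N}$ of span $1$ and $Y^{(n)}$ real valued; $(X^{(n)},Y^{(n)})$ converges in law to $(X,Y)$, where $X$ is a non-constant $\mathbb{N}$-valued random variable of span $1$ and $Y$ is real valued. $(p_n),(q_n)$ are sequences in $\mathbb{N}^*$. For each $n$, $(X_i^{(n)},Y_i^{(n)})_{1\le i\le nq_n}$ are i.i.d. with the law of $(X^{(n)},Y^{(n)})$, $S_n=\sum_{i=1}^{nq_n}X_i^{(n)}$, $T_n=\sum_{i=1}^{nq_n}Y_i^{(n)}$, and $\mathbb{P}(S_n=np_n)>0$. Transforms. For a real random variable $Z$, $\mathrm{dom}\,\psi_Z:=\{\tau\in\mathbb{R}:\mathbb{E}[e^{\tau Z}]<+\infty\}$ and $\psi_Z(\tau):=\log\mathbb{E}[e^{\tau Z}]$. $R_Z$ is the interior of the range of $\psi_Z'$. Tilted vectors. For $\xi$ in the interior of $\mathrm{dom}\,\psi_X$, $(\check X_\xi,\check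 Y_\xi)$ is a random vector with law $$\mathbb{P}(\check X_\xi=k,\check Y_\xi\in A)=\exp[-\psi_X(\xi)+k\xi]\,\mathbb{P}(X=k,Y\in A),\quad k\in\mathbb{N},\ A\subset\mathbb{R}\text{ Borel}.$$ $(\check X^{(n)}_\xi,\check Y^{(n)}_\xi)$ is defined in the same way from $(X^{(n)},Y^{(n)})$. $\alpha_\xi^2$ is the variance of the residual of the linear regression of $\check Y_\xi$ on $\check X_\xi$: $$\check\varepsilon_\xi:=\bigl(\check Y_\xi-\mathbb{E}(\check Y_\xi)\bigr)-\frac{\mathrm{cov}(\check X_\xi,\check Y_\xi)}{\mathrm{var}(\check X_\xi)}\bigl(\check X_\xi-\mathbb{E}(\check X_\xi)\bigr).$$ Large deviation principle (LDP). Let $(v_n)$ be a positive sequence with $v_n\to0$. A sequence $(R_n)$ of probability measures on a Hausdorff space $U$ with its Borel $\sigma$-field satisfies an LDP with rate function $I$ and speed $(v_n)$ if $I:U\to[0,+\infty]$ is lower semicontinuous and for every measurable $A\subset U$, $$-\inf_{\mathrm{int} A}I\le\liminf_n v_n\log R_n(A)\le\limsup_n v_n\log R_n(A)\le-\inf_{\mathrm{clo} A}I .$$ The rate function is good if $\{x\in U:I(x)\le a\}$ is compact for every $a\ge0$. *)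

(* Defs.v *)
From HB Require Import structures.
From mathcomp Require Import all_boot all_order all_algebra.
From mathcomp Require Import complex.
From mathcomp Require Import all_classical all_reals all_analysis.
Set Implicit Arguments.
Unset Strict Implicit.
Unset Printing Implicit Defensive.
Import Order.TTheory GRing.Theory Num.Theory.
Import numFieldNormedType.Exports.
Local Open Scope classical_set_scope.
Local Open Scope ring_scope.

Section RandomVectors.
Context {R : realType}.

Definition toR {T : Type} (X : T -> nat) : T -> R := fun w => (X w)%:R.

Definition pair_rv {T U V : Type} (X : T -> U) (Y : T -> V) : T -> U * V :=
  fun w => (X w, Y w).

Definition supp_nat {d} {T : measurableType d} (P : probability T R)
    (Z : T -> nat) : set nat :=
  [set k | (0 < P (Z @^-1` [set k]))%E].

(* The supremum is taken in \bar R: it is +oo when Z is almost surely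
   constant. *)
Definition rv_span {d} {T : measurableType d} (P : probability T R)
    (Z : T -> nat) : \bar R :=
  ereal_sup [set (m%:R)%:E | m in
    [set m : nat | exists b : nat,
      supp_nat P Z `<=` [set (m * j + b)%N | j in [set: nat]]]].

Definition same_law {d d' e} {T : measurableType d} {T' : measurableType d'}
    {U : measurableType e} (P : probability T R) (V : T -> U)
    (P' : probability T' R) (V' : T' -> U) : Prop :=
  forall A : set U, measurable A -> P (V @^-1` A) = P' (V' @^-1` A).

Definition mutually_independent {d e} {T : measurableType d}
    {U : measurableType e} (P : probability T R) {I : finType}
    (V : I -> T -> U) : Prop :=
  forall (J : {set I}) (B : I -> set U), (forall i, measurable (B i)) ->
    P (\bigcap_(i in [set` J]) (V i @^-1` B i)) =
    (\prod_(i in J) P (V i @^-1` B i))%E.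

Definition cvg_in_law {dn : nat -> measure_display}
    {Tn : forall n, measurableType (dn n)} {d} {T : measurableType d}
    {U : topologicalType} (Pn : forall n, probability (Tn n) R)
    (Vn : forall n, Tn n -> U) (P : probability T R) (V : T -> U) : Prop :=
  forall f : U -> R, continuous f -> (exists M : R, forall u, `|f u| <= M) ->
    'E_(Pn n)[f \o Vn n]%E @[n --> \oo] --> 'E_P[f \o V]%E.

End RandomVectors.

Section Transforms.
Context {R : realType} {d} {T : measurableType d}.
Implicit Types (P : probability T R) (Z : T -> R).

Definition psi_dom P Z : set R := [set t | ('M_P Z t < +oo)%E].

(* Only meaningful on psi_dom; outside, fine +oo = 0 and ln 0 = 0, which is
   why the derivative is only considered on the interior of psi_dom. *)
Definition psi P Z (t : R) : R := ln (fine ('M_P Z t)%E).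

Definition psi'_range_int P Z : set R :=
  interior [set derive1 (psi P Z) t | t in interior (psi_dom P Z)].

Definition cexp (z : R[i]) : R[i] :=
  Complex (expR (complex.Re z) * cos (complex.Im z))
          (expR (complex.Re z) * sin (complex.Im z)).

Definition cexpectation P (f : T -> R[i]) : R[i] :=
  Complex (fine 'E_P[fun w => complex.Re (f w)]%E)
          (fine 'E_P[fun w => complex.Im (f w)]%E).

(* E[e^{zZ}] for a complex number z *)
Definition cmgf P Z (z : R[i]) : R[i] :=
  cexpectation P (fun w => cexp (z * Complex (Z w) 0)).

End Transforms.

Section Tilting.
Context {R : realType}.

(* (X', Y'), on its own probability space, has the law of (X, Y) tilted by xi
   in the first coordinate. *)
Definition tilted_vector {d d'} {T : measurableType d} {T' : measurableType d'}
    (P : probability T R) (X : T -> nat) (Y : T -> R) (xi : R)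
    (P' : probability T' R) (X' : T' -> nat) (Y' : T' -> R) : Prop :=
  forall (k : nat) (A : set R), measurable A ->
    P' (X' @^-1` [set k] `&` Y' @^-1` A) =
    ((expR (- psi P (toR X) xi + k%:R * xi))%:E *
     P (X @^-1` [set k] `&` Y @^-1` A))%E.

Definition regression_residual {d} {T : measurableType d}
    (P : probability T R) (X Y : T -> R) : T -> R :=
  fun w => (Y w - fine 'E_P[Y]%E)
    - fine (covariance P X Y) / fine 'V_P[X]%E * (X w - fine 'E_P[X]%E).

Definition residual_variance {d} {T : measurableType d}
    (P : probability T R) (X Y : T -> R) : R :=
  fine 'V_P[regression_residual P X Y]%E.

End Tilting.

Section LargeDeviations.
Context {R : realType}.
Local Open Scope ereal_scope.

Definition cond_law {d} {T : measurableType d} (P : probability T R)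
    (D : set T) (Z : T -> R) : set R -> \bar R :=
  fun A => P (Z @^-1` A `&` D) / P D.

(* LDP on the real line for the laws mu n, with speed v n. *)
Definition LDP (mu : nat -> set R -> \bar R) (I : R -> \bar R)
    (v : nat -> R) : Prop :=
  [/\ forall x, 0 <= I x,
      lower_semicontinuous I &
      forall A : set R, measurable A ->
        [/\ - ereal_inf (I @` interior A)
              <= limn_einf (fun n => (v n)%:E * lne (mu n A)),
            limn_einf (fun n => (v n)%:E * lne (mu n A))
              <= limn_esup (fun n => (v n)%:E * lne (mu n A)) &
            limn_esup (fun n => (v n)%:E * lne (mu n A))
              <= - ereal_inf (I @` closure A)]].

Definition good_rate (I : R -> \bar R) : Prop :=
  forall a : R, (0 <= a)%R -> compact [set x | I x <= a%:E].

(* y^2 / (2 alpha2); for alpha2 = 0 the division in \bar R gives 0 at y = 0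
   and +oo elsewhere. *)
Definition quadratic_rate (alpha2 : R) (y : R) : \bar R :=
  (y ^+ 2)%:E / (2 * alpha2)%:E.

End LargeDeviations.

(* Main.v *)
Require Import Defs.
From HB Require Import structures.
From mathcomp Require Import all_boot all_order all_algebra.
From mathcomp Require Import complex.
From mathcomp Require Import all_classical all_reals all_analysis.
From mathcomp Require Import measurable_realfun.
From mathcomp Require Import ring lra zify.
Set Implicit Arguments.
Unset Strict Implicit.
Unset Printing Implicit Defensive.
Import Order.TTheory GRing.Theory Num.Theory.
Import numFieldNormedType.Exports.
Local Open Scope classical_set_scope.
Local Open Scope ring_scope.

(* Under the tilted law X has mean x = p_n / q_n, and the density of the change of
   measure is constant on {S_n = n p_n}.  Put N = n q_n and u = l / sqrt (a_n N).
   By independence E[e^{u (T_n - N m)}; S_n = N x] is, up to that constant, the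
   coefficient of degree N x in the N-th power of the generating function of the
   weights w k = E[e^{u (Y - m)}; X = k] of the tilted vector.  Discrete Fourier
   inversion and the aperiodicity of X bound it above and below by constant
   multiples of N^{-1/2} f(h)^N, where f(h) = \sum_k w k e^{h (k - x)}: the upper
   bound holds for every small h, the lower one at the saddle point of f.  A Taylor
   expansion gives ln f(h) = u^2 alpha^2 / 2 + O(|u|^3) at the best h, alpha^2
   being the residual variance of the regression.  Hence the logarithm of the
   conditional Laplace transform, times a_n, tends to l^2 alpha^2 / 2, and a
   Gaertner-Ellis argument on the line concludes.  The uniform exponential moments
   make the tilted moments at stage n converge to those of the limit. *)

(** * Elementary estimates *)

(** Low precision suffices locally: after multiplication by a_n a bounded factor disappears, and
    N^{-1/2} cancels against the same factor at l = 0. With rho = (a_n N)^{-1/2} the cubic remainder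
    contributes a_n N rho^3 = rho, which assumption 3 sends to 0. Two obstacles shape the rest.
    First, every constant must be uniform in n. The decay of the characteristic functions is
    therefore read off from finitely many atoms, whose differences have gcd 1 and whose masses stay
    above some delta; this survives small tilts and the passage along the sequence. Second, the
    exponential moments are centred at the tilted mean m of Y^(n), which is not bounded by
    assumption; convergence in law is first used to bound it. The saddle point comes from the
    intermediate value theorem and is not located exactly: the quadratic part of f, minimised over
    h, already equals u^2 alpha^2 / 2, and this bounds f below at every small h. Finally, truncating
    the weights at a level above N x does not change the coefficient, so f may be a finite sum and
    Fourier inversion a finite identity. *)

Section Elementary.
Context {R : realType}.
Implicit Types x y z t : R.

(** The mean value bound iterated below: each Taylor remainder of [sin], [cos] and [expR] has an
    earlier one as derivative, so every application gains a power of [z]. Constants are not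
    optimised. *)
Lemma norm_le_of_derive_le (f df : R -> R) (B z : R) :
  (forall x, is_derive x 1 f (df x)) -> f 0 = 0 ->
  (forall x, `|x| <= `|z| -> `|df x| <= B) -> `|f z| <= B * `|z|.
Proof.
move=> fdf f0 hB.
have cf a b : {within `[a, b], continuous f}.
  by apply: derivable_within_continuous => x _; apply: (@ex_derive _ _ _ _ _ _ _ (fdf x)).
have [z0|z0|->] := ltgtP z 0; last by rewrite f0 normr0 mulr0.
- have [c + E] := @MVT R f df z 0 z0 (fun x _ => fdf x) (cf _ _).
  rewrite in_itv /= => /andP[zc c0].
  have -> : `|f z| = `|df c| * `|z|.
    by rewrite -normrM; move: E; rewrite f0 !sub0r mulrN => /oppr_inj ->.
  by apply: ler_wpM2r => //; apply: hB; rewrite !ler0_norm //; lra.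
- have [c + E] := @MVT R f df 0 z z0 (fun x _ => fdf x) (cf _ _).
  rewrite in_itv /= => /andP[zc c0].
  have -> : `|f z| = `|df c| * `|z|.
    by rewrite -normrM; move: E; rewrite f0 !subr0 => ->.
  by apply: ler_wpM2r => //; apply: hB; rewrite !ger0_norm //; lra.
Qed.

Lemma norm_sin_le z : `|sin z| <= `|z|.
Proof.
rewrite -[leRHS]mul1r; apply: (@norm_le_of_derive_le sin cos); rewrite ?sin0 //.
by move=> x _; exact: cos_max.
Qed.

Lemma cos_half_sin z : 1 - cos z = 2 * sin (z / 2) ^+ 2.
Proof.
have -> : cos z = cos (z / 2 + z / 2) by congr cos; lra.
rewrite cosD; have := cos2Dsin2 (z / 2); nra.
Qed.

Lemma one_sub_cos_le_sqr z : 1 - cos z <= z ^+ 2 / 2.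
Proof.
rewrite cos_half_sin; have := norm_sin_le (z / 2).
rewrite -ler_sqr ?nnegrE // !real_normK ?num_real //; lra.
Qed.

Lemma norm_one_sub_cos_le z : `|1 - cos z| <= `|z|.
Proof.
rewrite ger0_norm ?subr_ge0 ?cos_le1 //.
have := one_sub_cos_le_sqr z; have := cos_geN1 z.
rewrite -[z ^+ 2]real_normK ?num_real // => h1 h2.
have := normr_ge0 z; have [|] := leP `|z| 2; nra.
Qed.

Lemma norm_sub_sin_le_sqr z : `|z - sin z| <= `|z| ^+ 2.
Proof.
rewrite expr2; apply: (@norm_le_of_derive_le (fun z => z - sin z) (fun z => 1 - cos z)).
- by rewrite /= sin0 subr0.
- by move=> x xz; apply: le_trans (norm_one_sub_cos_le x) xz.
Qed.

Lemma norm_sub_sin_le z : `|z - sin z| <= `|z| ^+ 3 / 2.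
Proof.
rewrite [in leRHS]exprSr [leRHS]mulrAC.
apply: (@norm_le_of_derive_le (fun z => z - sin z) (fun z => 1 - cos z)).
- by rewrite /= sin0 subr0.
move=> x xz; rewrite ger0_norm ?subr_ge0 ?cos_le1 //.
apply: le_trans (one_sub_cos_le_sqr x) _.
by rewrite ler_pM2r // -[x ^+ 2]real_normK ?num_real // ler_sqr ?nnegrE.
Qed.

Lemma norm_cos_sub_taylor_le z : `|cos z - 1 + z ^+ 2 / 2| <= `|z| ^+ 3.
Proof.
rewrite [leRHS]exprSr.
have D x : is_derive x 1 (fun z => cos z - 1 + z ^+ 2 / 2) ((fun z => z - sin z) x).
  by apply: is_derive_eq; rewrite /GRing.scale /=; field.
apply (@norm_le_of_derive_le _ _ (`|z| ^+ 2) z D).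
- by rewrite cos0; lra.
move=> x xz; apply: le_trans (norm_sub_sin_le_sqr x) _.
by rewrite ler_sqr ?nnegrE.
Qed.

(** Since [pi < 4], [u = t / 4] is at most 1, where [sin u >= u / 2] and [cos u >= 1 / 2]; then
    [sin (t / 2) = 2 sin u cos u]. *)
Lemma sin_lower t : 0 <= t <= pi -> t / 8 <= sin (t / 2).
Proof.
move=> /andP[t0 tpi]; have p2 := @pihalf_lt2 R.
have -> : t / 2 = t / 4 + t / 4 by lra.
have a0 : 0 <= t / 4 by lra.
have a1 : t / 4 <= 1 by lra.
have h1 := norm_sub_sin_le (t / 4); rewrite (ger0_norm a0) in h1.
have h2 := one_sub_cos_le_sqr (t / 4).
rewrite sinD; set u := t / 4 in a0 a1 h1 h2 *.
have s : u / 2 <= sin u by move: (le_trans (ler_norm _) h1); nra.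
have c : 1 / 2 <= cos u by nra.
have -> : t / 8 = u / 2 by rewrite /u; lra.
nra.
Qed.

Lemma norm_expR_sub1_le z : `|expR z - 1| <= `|z| * expR `|z|.
Proof.
rewrite mulrC; have D x : is_derive x 1 (fun z => expR z - 1) (expR x).
  by apply: is_derive_eq; rewrite subr0.
apply (@norm_le_of_derive_le _ _ (expR `|z|) z D).
- by rewrite /= expR0 subrr.
- by move=> x xz; rewrite ger0_norm ?expR_ge0 // ler_expR (le_trans (ler_norm _)).
Qed.

Lemma norm_expR_taylor1_le z : `|expR z - 1 - z| <= `|z| ^+ 2 * expR `|z|.
Proof.
rewrite [in leRHS]expr2 [leRHS]mulrAC.
have D x : is_derive x 1 (fun z => expR z - 1 - z) ((fun z => expR z - 1) x).
  by apply: is_derive_eq; rewrite subr0.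
apply (@norm_le_of_derive_le _ _ (`|z| * expR `|z|) z D).
- by rewrite expR0; lra.
move=> x xz; apply: le_trans (norm_expR_sub1_le x) _.
by apply: ler_pM => //; rewrite ?expR_ge0 ?ler_expR.
Qed.

Lemma norm_expR_taylor2_le z :
  `|expR z - 1 - z - z ^+ 2 / 2| <= `|z| ^+ 3 * expR `|z|.
Proof.
rewrite [in leRHS]exprSr [leRHS]mulrAC.
have D x : is_derive x 1 (fun z => expR z - 1 - z - z ^+ 2 / 2) ((fun z => expR z - 1 - z) x).
  by apply: is_derive_eq; rewrite /GRing.scale /=; field.
apply (@norm_le_of_derive_le _ _ (`|z| ^+ 2 * expR `|z|) z D).
- by rewrite expR0; lra.
move=> x xz; apply: le_trans (norm_expR_taylor1_le x) _.
by apply: ler_pM => //; rewrite ?expR_ge0 ?ler_expR ?exprn_ge0 // ler_sqr ?nnegrE.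
Qed.

(** The bound [ln (1 + z) <= z] at [z = (1 + y)^-1 - 1] gives [ln (1 + y) >= y / (1 + y)], and
    [1 + y >= 1 / 2] concludes. *)
Lemma ln_ge_sub_sqr y : `|y| <= 1 / 2 -> y - 2 * y ^+ 2 <= ln (1 + y).
Proof.
rewrite ler_norml => /andP[yl yu].
have y1 : 0 < 1 + y by lra.
have /le_ln1Dx : -1 < (1 + y)^-1 - 1 by rewrite ltrBrDr addNr invr_gt0.
rewrite addrC subrK lnV ?posrE // => h.
suff : y - 2 * y ^+ 2 <= 1 - (1 + y)^-1 by lra.
have -> : 1 - (1 + y)^-1 = y / (1 + y) by field; lra.
by rewrite ler_pdivlMr //; nra.
Qed.

Lemma bernoulli_le (N : nat) y : 0 <= y <= 1 -> 1 - N%:R * y <= (1 - y) ^+ N.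
Proof.
move=> /andP[y0 y1]; elim: N => [|N IH]; first by rewrite mul0r subr0 expr0.
have p1 : (1 - y) ^+ N <= 1 by apply: exprn_ile1; lra.
rewrite exprSr; have -> : N.+1%:R = N%:R + 1 :> R by rewrite -natr1.
nra.
Qed.

(** Exponential decay weakened to an inverse square through [expR v >= 1 + v]. It is applied to a
    squared modulus, so the modulus itself decays like [1 / (N y)] with [y] of order [t^2], which is
    summable over the frequencies. *)
Lemma pow_one_sub_le (N : nat) y : 0 <= y <= 1 ->
  (1 - y) ^+ N <= ((1 + N%:R * y / 2)^-1) ^+ 2.
Proof.
move=> /andP[y0 y1].
have N0 : 0 <= N%:R :> R by [].
have p : 0 <= N%:R * y / 2 by apply: divr_ge0 => //; apply: mulr_ge0.
apply: (@le_trans _ _ (expR (- y) ^+ N)).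
  by apply: lerXn2r; rewrite ?nnegrE ?expR_ge0 ?subr_ge0 //; exact: expR_ge1Dx.
have -> : expR (- y) ^+ N = (expR (- (N%:R * y / 2))) ^+ 2.
  by rewrite -expRM_natl -expRM_natl; congr expR; field.
apply: lerXn2r; rewrite ?nnegrE ?expR_ge0 ?invr_ge0 //; first lra.
by rewrite expRN lef_pV2 ?posrE ?expR_gt0 // ?expR_ge1Dx //; lra.
Qed.

End Elementary.

(** * Local limit bounds for nonnegative weights *)

Section LocalLimit.
Context {R : realType}.
Implicit Types (w : nat -> R) (t x : R) (L N K M : nat).

Definition cis t : R[i] := Complex (cos t) (sin t).

Lemma cisD s t : cis (s + t) = cis s * cis t.
Proof.
by apply/eqP; rewrite eq_complex /= cosD sinD !eqxx /= [X in _ == X]addrC eqxx.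
Qed.

Lemma prod_cis (I : finType) (F : I -> R) : \prod_i cis (F i) = cis (\sum_i F i).
Proof.
elim/big_rec2: _ => [|i y z _ ->]; last by rewrite cisD.
by apply/eqP; rewrite eq_complex /= cos0 sin0 !eqxx.
Qed.

Lemma Re_sum (I : Type) (s : seq I) (Q : pred I) (F : I -> R[i]) :
  complex.Re (\sum_(i <- s | Q i) F i) = \sum_(i <- s | Q i) complex.Re (F i).
Proof. by apply: (big_morph (@complex.Re R)) => // -[a b] [c d]. Qed.

Lemma Im_sum (I : Type) (s : seq I) (Q : pred I) (F : I -> R[i]) :
  complex.Im (\sum_(i <- s | Q i) F i) = \sum_(i <- s | Q i) complex.Im (F i).
Proof. by apply: (big_morph (@complex.Im R)) => // -[a b] [c d]. Qed.

Lemma Re_realM (a : R) (z : R[i]) : complex.Re (a%:C%C * z) = a * complex.Re z.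
Proof. by case: z => b c /=; rewrite mul0r subr0. Qed.

Lemma Im_realM (a : R) (z : R[i]) : complex.Im (a%:C%C * z) = a * complex.Im z.
Proof. by case: z => b c /=; rewrite mul0r addr0. Qed.

Lemma normcX (z : R[i]) N : Normc.normc (z ^+ N) = Normc.normc z ^+ N.
Proof.
by elim: N => [|N IH]; rewrite ?expr0 ?Normc.normc1 // !exprS Normc.normcM IH.
Qed.

Lemma normc_ge0 (z : R[i]) : 0 <= Normc.normc z.
Proof. by case: z => a b; exact: sqrtr_ge0. Qed.

Lemma normc_sqr (z : R[i]) :
  Normc.normc z ^+ 2 = complex.Re z ^+ 2 + complex.Im z ^+ 2.
Proof. by case: z => a b /=; rewrite sqr_sqrtr // addr_ge0 ?sqr_ge0. Qed.

Lemma norm_Re_le (z : R[i]) : `|complex.Re z| <= Normc.normc z.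
Proof.
rewrite -ler_sqr ?nnegrE ?normc_ge0 // normc_sqr real_normK ?num_real //.
by rewrite lerDl sqr_ge0.
Qed.

Lemma normc_le_add (z : R[i]) :
  Normc.normc z <= `|complex.Re z| + `|complex.Im z|.
Proof.
rewrite -ler_sqr ?nnegrE ?normc_ge0 ?addr_ge0 // normc_sqr.
rewrite -[complex.Re z ^+ 2]real_normK ?num_real //.
rewrite -[complex.Im z ^+ 2]real_normK ?num_real //.
have := normr_ge0 (complex.Re z); have := normr_ge0 (complex.Im z); nra.
Qed.

Lemma normc_subX_le (z v : R[i]) N : Normc.normc z <= 1 -> Normc.normc v <= 1 ->
  Normc.normc (z ^+ N - v ^+ N) <= N%:R * Normc.normc (z - v).
Proof.
move=> z1 v1; elim: N => [|N IH].
  by rewrite !expr0 subrr Normc.normc0 mul0r.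
have -> : z ^+ N.+1 - v ^+ N.+1 = z * (z ^+ N - v ^+ N) + (z - v) * v ^+ N.
  by rewrite !exprS; ring.
apply: le_trans (le_normcD _ _) _; rewrite !Normc.normcM normcX.
rewrite -natr1 mulrDl mul1r; apply: lerD.
  by apply: le_trans IH; rewrite ler_piMl ?normc_ge0.
by rewrite ler_piMr ?normc_ge0 // exprn_ile1 ?normc_ge0.
Qed.

(* Coefficient of [z^K] in the [N]-th power of [\sum_(k < L) w k z^k]. *)
Definition conv_coef L w N K : R :=
  \sum_(f : {ffun 'I_N -> 'I_L} | (\sum_i f i == K)%N) \prod_i w (f i).

(** Centring the phases at [x] absorbs the factor e^{-itK} of Fourier inversion as soon as
    [N x = K]. *)
Definition char_fun L w x t : R[i] :=
  \sum_(k < L) (w k)%:C%C * cis (t * (k%:R - x)).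

Lemma Re_char_funX L w x t N : complex.Re (char_fun L w x t ^+ N) =
  \sum_(f : {ffun 'I_N -> 'I_L})
    (\prod_i w (f i)) * cos (t * ((\sum_i f i)%N%:R - N%:R * x)).
Proof.
have -> : char_fun L w x t ^+ N = \prod_(i < N) char_fun L w x t.
  by rewrite prodr_const card_ord.
rewrite bigA_distr_bigA /= Re_sum.
apply: eq_bigr => f _; rewrite big_split /= prod_cis -rmorph_prod Re_realM /=.
congr (_ * cos _); rewrite -mulr_sumr sumrB natr_sum sumr_const card_ord.
by rewrite mulr_natl.
Qed.

Lemma dirichlet_kernel (m : nat) t :
  sin (t / 2) * (1 + 2 * \sum_(1 <= j < m.+1) cos (j%:R * t)) =
  sin ((m%:R + 1 / 2) * t).
Proof.
elim: m => [|m IH].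
  by rewrite big_geq // mulr0 addr0 mulr1; congr sin; lra.
rewrite big_nat_recr //= [2 * (_ + _)]mulrDr addrA mulrDr IH.
have -> : (m.+1%:R + 1 / 2) * t = m.+1%:R * t + t / 2 by field.
have -> : (m%:R + 1 / 2) * t = m.+1%:R * t - t / 2 by rewrite -[m.+1%:R]natr1; lra.
by rewrite sinB sinD; ring.
Qed.

Lemma sin_natpi (n : nat) : sin (n%:R * pi) = 0 :> R.
Proof.
elim: n => [|n IH]; first by rewrite mul0r sin0.
by rewrite -[n.+1%:R]natr1 mulrDl mul1r sinDpi IH oppr0.
Qed.

(** Orthogonality of the roots of unity of odd order [2 m + 1], the frequencies [j] and [- j] being
    merged into one cosine. For [d > 0] the closed form has numerator [sin (d pi) = 0], while
    [sin (t / 2) > 0]. *)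
Lemma dirichlet_kernel_root (m d : nat) : (d < m.*2.+1)%N ->
  1 + 2 * \sum_(1 <= j < m.+1) cos (j%:R * (2 * pi * d%:R / m.*2.+1%:R)) =
  (if d == 0%N then m.*2.+1%:R else 0) :> R.
Proof.
have ME : m.*2.+1%:R = 2 * m%:R + 1 :> R by rewrite -[m.*2.+1%:R]natr1 -mul2n natrM.
case: d => [_|d dM] /=.
  under eq_bigr do rewrite mulr0 mul0r mulr0 cos0.
  by rewrite sumr_const_nat subn1 /= ME addrC.
have M0 : 0 < m.*2.+1%:R :> R by rewrite ltr0n.
set t := 2 * pi * _ / _.
have := dirichlet_kernel m t.
have -> : (m%:R + 1 / 2) * t = d.+1%:R * pi.
  by rewrite /t ME; field; rewrite -ME gt_eqF.
rewrite sin_natpi => /eqP; rewrite mulf_eq0 => /orP[|/eqP //].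
have : 0 < sin (t / 2).
  apply: sin_gt0_pi; have -> : t / 2 = pi * (d.+1%:R / m.*2.+1%:R).
    by rewrite /t -!mulrA [2 * _]mulrC -!mulrA mulVf ?mulr1 ?pnatr_eq0.
  apply/andP; split; first by rewrite mulr_gt0 ?pi_gt0 ?divr_gt0 ?ltr0n.
  by rewrite gtr_pMr ?pi_gt0 // ltr_pdivrMr // mul1r ltr_nat.
by move=> /gt_eqF ->.
Qed.

(** The two size conditions keep [K] and all exponents, which are at most [N L], in [[0, 2 m]]. Two
    of them then never differ by a nonzero multiple of [2 m + 1], so averaging over the roots of
    unity isolates the exponent [K] without aliasing. *)
Lemma conv_coef_fourier L w N K x m :
  N%:R * x = K%:R -> (K <= m.*2)%N -> (N * L <= m.*2)%N ->
  m.*2.+1%:R * conv_coef L w N K =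
  (\sum_(k < L) w k) ^+ N +
  2 * \sum_(1 <= j < m.+1)
        complex.Re (char_fun L w x (j%:R * (2 * pi / m.*2.+1%:R)) ^+ N).
Proof.
move=> NxK Km NLm.
under [in X in _ = _ + X]eq_bigr do rewrite Re_char_funX NxK.
rewrite exchange_big /=.
have -> : (\sum_(k < L) w k) ^+ N =
    \sum_(f : {ffun 'I_N -> 'I_L}) \prod_i w (f i).
  by rewrite -(bigA_distr_bigA (fun (_ : 'I_N) (k : 'I_L) => w k)) prodr_const card_ord.
rewrite /conv_coef mulr_sumr big_mkcond /= mulr_sumr -big_split /=.
apply: eq_bigr => f _; rewrite -mulr_sumr.
set s := (\sum_i f i)%N; set W := \prod_i _.
have sNL : (s <= N * L)%N.
  rewrite /s -[N in (_ <= N * _)%N]card_ord -sum_nat_const.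
  by apply: leq_sum => i _; rewrite ltnW.
(* This is [|s - K|]: one of the two truncated differences is zero. *)
pose d := ((s - K) + (K - s))%N.
have dm : (d < m.*2.+1)%N by rewrite /d; lia.
have := dirichlet_kernel_root dm.
have E j : cos (j%:R * (2 * pi / m.*2.+1%:R) * (s%:R - K%:R)) =
    cos (j%:R * (2 * pi * d%:R / m.*2.+1%:R)) :> R.
  have [sK|Ks] := leqP s K.
    have -> : d = (K - s)%N by rewrite /d; lia.
    by rewrite natrB // -cosN; congr cos; ring.
  have -> : d = (s - K)%N by rewrite /d; lia.
  by rewrite natrB ?(ltnW Ks) //; congr cos; ring.
under [in X in _ -> _ = _ + X]eq_bigr do rewrite E.
have -> : (d == 0%N) = (s == K) by rewrite /d; lia.
set D := \sum_(1 <= j < m.+1) _ => HD.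
have -> : W + 2 * (W * D) = W * (1 + 2 * D) by ring.
rewrite HD.
by case: ifP => _; rewrite ?mulr0 // mulrC.
Qed.

End LocalLimit.

(** * Decay of the characteristic function and upper bound on the coefficient *)

Section LocalLimitBounds.
Context {R : realType}.
Implicit Types (w : nat -> R) (t x c kappa : R) (L N K M m A B g : nat).

Lemma sum_inv_sqr_le J m : (0 < J)%N -> (J <= m)%N ->
  \sum_(J.+1 <= j < m.+1) ((j%:R : R) ^+ 2)^-1 <= J%:R^-1.
Proof.
move=> J0 Jm; suff : \sum_(J.+1 <= j < m.+1) ((j%:R : R) ^+ 2)^-1 <=
    J%:R^-1 - m%:R^-1.
  by move=> /le_trans; apply; rewrite gerDl oppr_le0 invr_ge0.
elim: m Jm => [|m IH]; first by rewrite leqNgt J0.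
rewrite leq_eqVlt => /orP[/eqP<-|]; first by rewrite big_geq // subrr.
rewrite ltnS => Jm; rewrite big_nat_recr //=.
apply: le_trans (lerD (IH Jm) (lexx _)) _.
have m0 : 0 < m%:R :> R by rewrite ltr0n; apply: leq_trans Jm.
rewrite -addrA lerD2l -[m.+1%:R]natr1.
have -> : - m%:R^-1 + ((m%:R + 1) ^+ 2)^-1 =
  - (m%:R + 1)^-1 - (m%:R * (m%:R + 1) ^+ 2)^-1 :> R by field; lra.
rewrite gerDl oppr_le0 invr_ge0 mulr_ge0 ?sqr_ge0 //; exact: ltW.
Qed.

(** Symmetrisation: the squared modulus is the mean of [cos (t (X - X'))] for two independent
    copies, so the centring [x] drops out. *)
Lemma normc_char_fun_sqr L w x t : \sum_(k < L) w k = 1 ->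
  Normc.normc (char_fun L w x t) ^+ 2 =
  1 - \sum_(k < L) \sum_(l < L) w k * w l * (1 - cos (t * (k%:R - l%:R))).
Proof.
move=> w1; rewrite normc_sqr /char_fun Re_sum Im_sum.
under eq_bigr do rewrite Re_realM /=.
under [X in _ + X ^+ 2]eq_bigr do rewrite Im_realM /=.
rewrite !expr2 !mulr_suml -big_split /=.
have E1 : 1 = \sum_(k < L) \sum_(l < L) w k * w l.
  have : (\sum_(k < L) w k) * (\sum_(k < L) w k) = 1 by rewrite w1 mulr1.
  by rewrite mulr_suml => <-; apply: eq_bigr => k _; rewrite mulr_sumr.
rewrite [X in _ = X - _]E1 -[RHS]sumrB; apply: eq_bigr => k _.
rewrite !mulr_sumr -big_split -sumrB /=; apply: eq_bigr => l _.
have -> : t * (k%:R - l%:R) = t * (k%:R - x) - t * (l%:R - x) by ring.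
by rewrite cosB; ring.
Qed.

Lemma normc_char_funX_le L w x t c N : \sum_(k < L) w k = 1 -> (0 < N)%N ->
  0 < c -> 0 < t ->
  c * t ^+ 2 <=
    \sum_(k < L) \sum_(l < L) w k * w l * (1 - cos (t * (k%:R - l%:R))) ->
  Normc.normc (char_fun L w x t ^+ N) <= 2 / (N%:R * c * t ^+ 2).
Proof.
move=> w1 N0 c0 t0 H.
have E := normc_char_fun_sqr x t w1; set z := char_fun L w x t in E *.
have y0 : 0 <= c * t ^+ 2 by rewrite mulr_ge0 ?sqr_ge0 // ltW.
have zs : Normc.normc z ^+ 2 <= 1 - c * t ^+ 2 by rewrite E; lra.
have y1 : c * t ^+ 2 <= 1 by have := sqr_ge0 (Normc.normc z); lra.
have N0' : 0 < N%:R :> R by rewrite ltr0n.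
have y0' : 0 < c * t ^+ 2 by rewrite mulr_gt0 ?exprn_gt0.
have p : 0 < N%:R * (c * t ^+ 2) by rewrite mulr_gt0.
apply: (@le_trans _ _ ((1 + N%:R * (c * t ^+ 2) / 2)^-1)).
  rewrite -ler_sqr ?nnegrE ?normc_ge0 ?invr_ge0 //; last by lra.
  apply: le_trans (pow_one_sub_le N _); last by rewrite y0 y1.
  rewrite normcX -exprM mulnC exprM.
  by apply: lerXn2r => //; rewrite nnegrE ?sqr_ge0 // subr_ge0.
rewrite -mulrA -[leRHS]invf_div lef_pV2 ?posrE; lra.
Qed.

(** Real and imaginary parts are expanded separately. The mean zero condition removes the linear
    term of the imaginary part; each remainder is at most [kappa |t|^3], whence the factor 2. *)
Lemma normc_char_fun_taylor_le L w x t kappa : \sum_(k < L) w k = 1 ->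
  (forall k, 0 <= w k) ->
  \sum_(k < L) w k * (k%:R - x) = 0 ->
  \sum_(k < L) w k * `|k%:R - x| ^+ 3 <= kappa ->
  Normc.normc (char_fun L w x t -
    (1 - (\sum_(k < L) w k * (k%:R - x) ^+ 2) * t ^+ 2 / 2)%:C%C) <=
  2 * kappa * `|t| ^+ 3.
Proof.
move=> w1 w0 m0 k3; set s2 := \sum_(k < L) w k * (_ ^+ 2).
apply: le_trans (normc_le_add _) _.
have -> : complex.Re (char_fun L w x t - (1 - s2 * t ^+ 2 / 2)%:C%C) =
    \sum_(k < L) w k * (cos (t * (k%:R - x)) - 1 + (t * (k%:R - x)) ^+ 2 / 2).
  have -> (z : R[i]) (y : R) : complex.Re (z - y%:C%C) = complex.Re z - y.
    by case: z.
  rewrite Re_sum; under eq_bigr do rewrite Re_realM /=.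
  rewrite [RHS](eq_bigr (fun k : 'I_L => w k * cos (t * (k%:R - x)) - w k +
    w k * (k%:R - x) ^+ 2 * (t ^+ 2 / 2))); last by move=> k _; field.
  by rewrite big_split sumrB /= -mulr_suml w1 -/s2; ring.
have -> : complex.Im (char_fun L w x t - (1 - s2 * t ^+ 2 / 2)%:C%C) =
    \sum_(k < L) w k * (sin (t * (k%:R - x)) - t * (k%:R - x)).
  have -> (z : R[i]) (y : R) : complex.Im (z - y%:C%C) = complex.Im z.
    by case: z => a b /=; rewrite subr0.
  rewrite Im_sum; under eq_bigr do rewrite Im_realM /=.
  rewrite [RHS](eq_bigr (fun k : 'I_L => w k * sin (t * (k%:R - x)) -
    t * (w k * (k%:R - x)))); last by move=> k _; ring.
  by rewrite sumrB -mulr_sumr m0 mulr0 subr0.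
have -> : 2 * kappa * `|t| ^+ 3 = kappa * `|t| ^+ 3 + kappa * `|t| ^+ 3 by ring.
have t3 : 0 <= `|t| ^+ 3 by rewrite exprn_ge0.
have H (F : R -> R) : (forall y, `|F y| <= `|y| ^+ 3) ->
    `|\sum_(k < L) w k * F (t * (k%:R - x))| <= kappa * `|t| ^+ 3.
  move=> hF; apply: le_trans (ler_norm_sum _ _ _) _.
  apply: le_trans (ler_wpM2r t3 k3); rewrite mulr_suml; apply: ler_sum => k _.
  rewrite normrM ger0_norm // -mulrA; apply: ler_wpM2l => //.
  by apply: le_trans (hF _) _; rewrite normrM exprMn mulrC.
apply: lerD; [apply: (H (fun y => cos y - 1 + y ^+ 2 / 2))|
              apply: (H (fun y => sin y - y))] => y.
  exact: norm_cos_sub_taylor_le.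
rewrite distrC; apply: le_trans (norm_sub_sin_le y) _.
by have := exprn_ge0 3 (normr_ge0 y); lra.
Qed.

(** [m] is the integer part of [B sqrt N]. A large [B] will place the lowest frequencies well inside
    the scale N^{-1/2}, where the N-th power of the characteristic function is bounded below. *)
Lemma odd_sqrt_approx N B : (0 < N)%N -> (0 < B)%N -> exists m,
  [/\ B%:R * Num.sqrt N%:R <= (m.*2.+1)%:R :> R,
      (m.*2.+1)%:R <= 3 * B%:R * Num.sqrt N%:R :> R &
      B%:R * Num.sqrt N%:R < m.+1%:R :> R].
Proof.
move=> N0 B0; set y : R := B%:R * Num.sqrt N%:R.
have y1 : 1 <= y.
  rewrite -[1]mulr1; apply: ler_pM => //; first by rewrite ler1n.
  by rewrite -[leLHS]sqrtr1; apply: ler_wsqrtr; rewrite ler1n.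
have /andP[l u] := truncn_itv (le_trans ler01 y1).
exists (Num.truncn y); set m := Num.truncn y in l u *.
have E : m.*2.+1%:R = 2 * m%:R + 1 :> R by rewrite -[m.*2.+1%:R]natr1 -mul2n natrM.
have u' : y < m%:R + 1 by rewrite natr1.
have m0 : 0 <= m%:R :> R by [].
split => //; rewrite E; first lra.
by rewrite -mulrA -/y; lra.
Qed.

Section Fixed.
Variables (L N K : nat) (w : nat -> R) (x c : R).
Hypotheses (N0 : (0 < N)%N) (c0 : 0 < c) (w0 : forall k, 0 <= w k).
Hypotheses (w1 : \sum_(k < L) w k = 1) (NxK : N%:R * x = K%:R).
Hypothesis (Hc : forall t, 0 <= t <= pi -> c * t ^+ 2 <=
  \sum_(k < L) \sum_(l < L) w k * w l * (1 - cos (t * (k%:R - l%:R)))).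

(* The frequencies are the multiples of 2 pi / (g * n0): the factor g, larger than
   every exponent that occurs, makes the discrete Fourier inversion exact, and
   n0, later taken of order sqrt N, refines the grid. *)
Let g := ((N * L + K).*2.+1)%N.
Let n0 m := m.*2.+1.
Let M' m := ((g * n0 m)./2)%N.
Let fr m (j : nat) : R := j%:R * (2 * pi / (g * n0 m)%:R).
Let F m j := complex.Re (char_fun L w x (fr m j) ^+ N).

Let M'E m : ((M' m).*2.+1 = g * n0 m)%N.
Proof.
have := odd_double_half (g * n0 m); rewrite -/(M' m) => <-.
by rewrite oddM /g /n0 /= !odd_double.
Qed.

Lemma conv_coef_grid m : (g * n0 m)%:R * conv_coef L w N K =
  1 + 2 * \sum_(1 <= j < (M' m).+1) F m j.
Proof.
rewrite -M'E (conv_coef_fourier _ NxK) ?w1 ?expr1n.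
- by rewrite M'E.
- by have := M'E m; rewrite /g /n0; nia.
- by have := M'E m; rewrite /g /n0; nia.
Qed.

Let g0 : 0 < g%:R :> R. Proof. by rewrite ltr0n. Qed.

Lemma fr_bounds m j : (0 < j <= M' m)%N ->
  [/\ 0 < fr m j, fr m j <= pi & j%:R / (g * n0 m)%:R <= fr m j].
Proof.
move=> /andP[j0 jM]; have j0' : 0 < j%:R :> R by rewrite ltr0n.
have p := @pi_ge2 R; have pp := @pi_gt0 R; split.
- by rewrite mulr_gt0 // divr_gt0 // mulr_gt0.
- rewrite /fr mulrA ler_pdivrMr // mulrA [leRHS]mulrC.
  rewrite ler_pM2r // -natrM ler_nat; have := M'E m; lia.
- rewrite /fr mulrA ler_pM2r ?invr_gt0 //.
  by rewrite -[leLHS]mulr1 ler_pM2l //; lra.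
Qed.

Lemma F_tail_le m j : (0 < j <= M' m)%N ->
  `|F m j| <= 2 * (g * n0 m)%:R ^+ 2 / (N%:R * c) * (j%:R ^+ 2)^-1.
Proof.
move=> jM; have [f0 fpi fl] := fr_bounds jM.
apply: le_trans (norm_Re_le _) _.
apply: le_trans (normc_char_funX_le _ w1 N0 c0 f0 _) _.
  by apply: Hc; rewrite ltW.
have Nc : 0 < N%:R * c by rewrite mulr_gt0 ?ltr0n.
move: jM => /andP[j0 _]; have j0' : 0 < j%:R :> R by rewrite ltr0n.
have -> : 2 * (g * n0 m)%:R ^+ 2 / (N%:R * c) * (j%:R ^+ 2)^-1 =
    2 / (N%:R * c * (j%:R / (g * n0 m)%:R) ^+ 2).
  by field; rewrite !gt_eqF //= ltr0n.
have jm : 0 < j%:R / (g * n0 m)%:R :> R by rewrite divr_gt0.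
have P1 : 0 < N%:R * c * (j%:R / (g * n0 m)%:R) ^+ 2 by rewrite mulr_gt0 ?exprn_gt0.
have P2 : 0 < N%:R * c * fr m j ^+ 2 by rewrite mulr_gt0 ?exprn_gt0.
by rewrite ler_pM2l // lef_pV2 // ler_pM2l // ler_sqr // nnegrE ltW.
Qed.

(** Each modulus is at most [2 / (N c t^2)]; summing [1 / j^2] leaves [1 / (A g)], and
    [n0^2 <= 9 B^2 N] cancels [N], hence 18. The result is proportional to [g], like the
    contribution of the first [g] frequencies to which it is compared. *)
Lemma sum_tail_le m A B : (0 < A)%N -> (A <= m)%N ->
  (n0 m)%:R <= 3 * B%:R * Num.sqrt N%:R :> R ->
  `|\sum_((A * g).+1 <= j < (M' m).+1) F m j| <=
  g%:R * (18 * B%:R ^+ 2 / c / A%:R).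
Proof.
move=> A0 Am n0B; have Ag0 : (0 < A * g)%N by rewrite muln_gt0 A0.
have AgM : (A * g <= M' m)%N by have := M'E m; rewrite /n0; nia.
apply: le_trans (ler_norm_sum _ _ _) _.
have Nc : 0 < N%:R * c by rewrite mulr_gt0 ?ltr0n.
have C0 : 0 <= 2 * (g * n0 m)%:R ^+ 2 / (N%:R * c) by rewrite divr_ge0 ?mulr_ge0 ?sqr_ge0 // ltW.
apply: (@le_trans _ _ (2 * (g * n0 m)%:R ^+ 2 / (N%:R * c) * (A * g)%:R^-1)).
  apply: le_trans (ler_wpM2l C0 (sum_inv_sqr_le Ag0 AgM)).
  rewrite mulr_sumr big_nat [leRHS]big_nat.
  by apply: ler_sum => j /andP[j1 jM]; apply: F_tail_le; lia.
have A0' : 0 < A%:R :> R by rewrite ltr0n.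
have N0' : 0 < N%:R :> R by rewrite ltr0n.
have n0s : (n0 m)%:R ^+ 2 <= 9 * B%:R ^+ 2 * N%:R :> R.
  have -> : 9 * B%:R ^+ 2 * N%:R = (3 * B%:R * Num.sqrt N%:R) ^+ 2 :> R.
    by rewrite 2!exprMn sqr_sqrtr ?ler0n //; ring.
  by rewrite ler_sqr ?nnegrE ?mulr_ge0 ?sqrtr_ge0.
have -> : 2 * (g * n0 m)%:R ^+ 2 / (N%:R * c) * (A * g)%:R^-1 =
   (2 * g%:R / (N%:R * c * A%:R)) * (n0 m)%:R ^+ 2.
  by rewrite !natrM; field; rewrite !gt_eqF.
have -> : g%:R * (18 * B%:R ^+ 2 / c / A%:R) =
   (2 * g%:R / (N%:R * c * A%:R)) * (9 * B%:R ^+ 2 * N%:R).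
  by field; rewrite !gt_eqF.
by apply: ler_wpM2l => //; rewrite divr_ge0 ?mulr_ge0 // ltW.
Qed.

Lemma normc_char_fun_le1 t : Normc.normc (char_fun L w x t) <= 1.
Proof.
rewrite -ler_sqr ?nnegrE ?normc_ge0 // normc_char_fun_sqr // expr1n gerBl.
apply: sumr_ge0 => k _; apply: sumr_ge0 => l _.
by rewrite mulr_ge0 ?mulr_ge0 // subr_ge0 cos_le1.
Qed.

(** The first [g] frequencies are bounded by 1 each, the others by [sum_tail_le] with [A = B = 1].
    Since [1 <= g], the total [1 + 2 (g + 18 g / c)] is at most [g (3 + 36 / c)]. *)
Lemma conv_coef_upper :
  conv_coef L w N K <= (3 + 36 / c) / Num.sqrt N%:R.
Proof.
have [m [l u v]] := @odd_sqrt_approx N 1 N0 isT.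
have sN : 1 <= Num.sqrt N%:R :> R.
  by rewrite -[leLHS]sqrtr1; apply: ler_wsqrtr; rewrite ler1n.
rewrite mul1r in l v; rewrite mulr1 in u.
have m1 : (1 <= m)%N by rewrite -ltnS -(ltr_nat R); apply: le_lt_trans v.
have gM : (g <= M' m)%N by have := M'E m; rewrite /n0; nia.
have E := conv_coef_grid m.
have T : `|\sum_(g.+1 <= j < (M' m).+1) F m j| <= g%:R * (18 / c).
  have := @sum_tail_le m 1 1 isT m1; rewrite mul1n => /(_ _)/le_trans; apply.
    by rewrite mulr1.
  by rewrite expr1n mulr1 invr1 mulr1.
have S1 : \sum_(1 <= j < g.+1) F m j <= g%:R.
  apply: le_trans (_ : \sum_(1 <= j < g.+1) 1 <= _); last first.
    by rewrite sumr_const_nat subn1 /=.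
  apply: ler_sum => j _; apply: le_trans (ler_norm _) _.
  apply: le_trans (norm_Re_le _) _; rewrite normcX exprn_ile1 ?normc_ge0 //.
  exact: normc_char_fun_le1.
have g1 : 1 <= g%:R :> R by rewrite ler1n.
rewrite (big_cat_nat (n := g.+1)) //= in E.
have H : (g * n0 m)%:R * conv_coef L w N K <= g%:R * (3 + 36 / c).
  have T' := le_trans (ler_norm _) T.
  have -> : g%:R * (3 + 36 / c) = g%:R + 2 * (g%:R + g%:R * (18 / c)) :> R by field; rewrite gt_eqF.
  rewrite E; apply: lerD => //; rewrite ler_pM2l //; exact: lerD.
rewrite natrM -mulrA ler_pM2l // in H.
rewrite ler_pdivlMr; last by apply: lt_le_trans sN.
apply: le_trans H; rewrite mulrC; apply: ler_wpM2r => //.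
by apply: sumr_ge0 => f _; apply: prodr_ge0.
Qed.

End Fixed.
End LocalLimitBounds.

(** * Lower bound on the coefficient, for centred weights *)

Section LocalLimitLower.
Context {R : realType}.
Implicit Types (w : nat -> R) (t x c kappa : R) (L N K M m A B g : nat).

Lemma normc_real x : Normc.normc x%:C%C = `|x|.
Proof. by rewrite /= expr0n /= addr0 sqrtr_sqr. Qed.

Lemma leq_mul_of_odd_mul (g m A M : nat) :
  (M.*2.+1 = g * m.*2.+1)%N -> (A <= m)%N -> (A * g <= M)%N.
Proof. nia. Qed.

Lemma tail_const_le (b c a : R) : 0 < a -> 144 * b / c <= a ->
  18 * b / c / a <= 8^-1.
Proof. by move=> a0 h; rewrite ler_pdivrMr //; lra. Qed.

Section Fixed.
Variables (L N K : nat) (w : nat -> R) (x c kappa : R).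
Hypotheses (N0 : (0 < N)%N) (c0 : 0 < c) (w0 : forall k, 0 <= w k).
Hypotheses (w1 : \sum_(k < L) w k = 1) (NxK : N%:R * x = K%:R).
Hypothesis (Hc : forall t, 0 <= t <= pi -> c * t ^+ 2 <=
  \sum_(k < L) \sum_(l < L) w k * w l * (1 - cos (t * (k%:R - l%:R)))).
Hypothesis mean0 : \sum_(k < L) w k * (k%:R - x) = 0.
Hypothesis k2 : \sum_(k < L) w k * (k%:R - x) ^+ 2 <= kappa.
Hypothesis k3 : \sum_(k < L) w k * `|k%:R - x| ^+ 3 <= kappa.

Let s2 := \sum_(k < L) w k * (k%:R - x) ^+ 2.

Let s20 : 0 <= s2.
Proof. by apply: sumr_ge0 => k _; rewrite mulr_ge0 ?sqr_ge0. Qed.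

(** The real number [v = 1 - s2 t^2 / 2] replaces the characteristic function. Both have modulus at
    most 1, so their N-th powers differ by at most [N] times their difference, and [N t^3] is small
    when [t] is of order N^{-1/2}. *)
Lemma Re_char_funX_ge t : 0 <= t -> s2 * t ^+ 2 / 2 <= 1 ->
  (1 - s2 * t ^+ 2 / 2) ^+ N - N%:R * (2 * kappa * t ^+ 3) <=
  complex.Re (char_fun L w x t ^+ N).
Proof.
move=> t0 st; set z := char_fun L w x t; set v := 1 - s2 * t ^+ 2 / 2.
have s2t : 0 <= s2 * t ^+ 2 by rewrite mulr_ge0 ?sqr_ge0.
have v01 : 0 <= v <= 1 by rewrite /v; lra.
have vn : Normc.normc (v%:C%C) <= 1.
  by rewrite normc_real ger0_norm; case/andP: v01.
have := normc_subX_le N (normc_char_fun_le1 x w0 w1 t) vn.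
have := normc_char_fun_taylor_le (x := x) t w1 w0 mean0 k3.
rewrite -/s2 -/v -/z ger0_norm // => h1 h2.
have h3 : Normc.normc (z ^+ N - v%:C%C ^+ N) <= N%:R * (2 * kappa * t ^+ 3).
  by apply: le_trans h2 _; apply: ler_wpM2l.
have := le_trans (norm_Re_le _) h3; rewrite -rmorphXn /=.
have -> : complex.Re (z ^+ N - (v ^+ N)%:C%C) = complex.Re (z ^+ N) - v ^+ N.
  by case: (z ^+ N).
by rewrite ler_norml => /andP[h _]; lra.
Qed.

(** Three blocks of frequencies. Up to index [g] a term is at least [1/2 - 1/(8 A)]. From [g] to
    [A g] it is at least [- 1/(8 A)], the approximating power of [1 - s2 t^2 / 2] being nonnegative.
    Beyond [A g] the sum is at most [g / 8] in absolute value, by the choice of [A]. All the losses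
    [1/(8 A)] together cost [g / 8], so the grid sum exceeds [g / 4], and [n0 <= 3 B sqrt N] gives
    the constant 12. *)
Lemma conv_coef_lower A B : (0 < A)%N -> (0 < B)%N ->
  144 * B%:R ^+ 2 / c <= A%:R :> R -> 64 * kappa <= B%:R ->
  (A.+1)%:R <= Num.sqrt N%:R :> R ->
  16 * kappa * (8 * A%:R) ^+ 3 * A%:R <= Num.sqrt N%:R ->
  (12 * B%:R)^-1 / Num.sqrt N%:R <= conv_coef L w N K.
Proof.
move=> A0 B0 hA hB hN1 hN2.
have [m [l u v]] := @odd_sqrt_approx R N B N0 B0.
pose g := ((N * L + K).*2.+1)%N; pose n0 := m.*2.+1.
pose M' := ((g * n0)./2)%N.
pose fr (j : nat) : R := j%:R * (2 * pi / (g * n0)%:R).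
pose F j := complex.Re (char_fun L w x (fr j) ^+ N).
have M'E : (M'.*2.+1 = g * n0)%N.
  have := odd_double_half (g * n0); rewrite -/M' => <-.
  by rewrite oddM /g /n0 /= !odd_double.
have B1 : 1 <= B%:R :> R by rewrite ler1n.
have A1 : 1 <= A%:R :> R by rewrite ler1n.
have g1 : 1 <= g%:R :> R by rewrite ler1n.
set sN := Num.sqrt N%:R in hN1 hN2 l u v *.
have sN2 : sN ^+ 2 = N%:R by rewrite sqr_sqrtr.
have AS : A.+1%:R = A%:R + 1 :> R by rewrite natr1.
have sN0 : 2 <= sN by apply: le_trans hN1; rewrite AS [leLHS](_ : 2 = 1 + 1) // lerD2r.
have BsN : sN <= B%:R * sN by rewrite ler_peMl // (le_trans _ sN0).
have Am : (A <= m)%N.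
  rewrite -ltnS -(ltr_nat R); apply: le_lt_trans v; apply: le_trans BsN.
  by apply: le_trans hN1; rewrite AS lerDl.
have AgM : (A * g <= M')%N := leq_mul_of_odd_mul M'E Am.
have E : (g * n0)%:R * conv_coef L w N K = 1 + 2 * \sum_(1 <= j < M'.+1) F j.
  exact: (conv_coef_grid N0 c0 w1 NxK m).
have gp : 0 < g%:R :> R by apply: lt_le_trans g1.
have Ap : 0 < A%:R :> R by apply: lt_le_trans A1.
have T : `|\sum_((A * g).+1 <= j < M'.+1) F j| <= g%:R / 8.
  apply: le_trans (sum_tail_le K x N0 c0 w1 Hc A0 Am u) _.
  by rewrite ler_pM2l //; apply: tail_const_le.
have kap0 : 0 <= kappa by apply: le_trans k2.
have n00 : 0 < n0%:R :> R by rewrite ltr0n.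
have n0l : sN <= n0%:R by apply: le_trans l.
have sNp : 0 < sN by apply: lt_le_trans sN0.
have n0l2 : B%:R ^+ 2 * N%:R <= n0%:R ^+ 2 :> R.
  by rewrite -sN2 -exprMn ler_sqr ?nnegrE ?mulr_ge0 // ltW.
have pi0 := @pi_gt0 R.
have pi4 : 2 * pi <= 8 :> R.
  have h : pi / 2 <= 2 :> R := ltW (@pihalf_lt2 R).
  rewrite ler_pdivrMr // -(ler_pM2l (x := 2)) // in h.
  by apply: le_trans h _; rewrite -!natrM.
have frle j a : (j <= a * g)%N -> 0 <= fr j <= 8 * a%:R / n0%:R.
  move=> ja.
  have gn : 0 < (g * n0)%:R :> R by rewrite ltr0n.
  have p2 : 0 <= 2 * pi :> R by rewrite mulr_ge0 // ltW.
  rewrite /fr mulr_ge0 ?divr_ge0 //=.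
  rewrite mulrA ler_pdivrMr // natrM.
  have -> : 8 * a%:R / n0%:R * (g%:R * n0%:R) = (a * g)%:R * 8 :> R.
    rewrite natrM; move: n00 => /gt_eqF; move: (n0%:R : R) (g%:R : R) => n' g' n'0.
    by field; rewrite n'0.
  by apply: ler_pM => //; rewrite ler_nat.
have FE j : F j = complex.Re (char_fun L w x (fr j) ^+ N) by [].
have n0u : n0%:R <= 3 * B%:R * sN by [].
clearbody F fr M' g n0 sN; clear l u v.
(* With [fr j <= 8 A / n0] and [n0 >= sqrt N], the cubic error is at most
   [2 kappa (8 A)^3 / sqrt N]; the last size hypothesis on [N] says exactly that this is at most
   [1/(8 A)]. *)
have Floss j : (j <= A * g)%N -> N%:R * (2 * kappa * fr j ^+ 3) <= (8 * A%:R)^-1.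
  move=> jA; have /andP[f0 f1] := frle _ _ jA.
  have N0' : 0 < N%:R :> R by rewrite ltr0n.
  have NsN : 0 < N%:R * sN by rewrite mulr_gt0.
  have q0 : 0 <= (8 * A%:R) ^+ 3 :> R by rewrite exprn_ge0 // mulr_ge0.
  have f3 : fr j ^+ 3 <= (8 * A%:R) ^+ 3 / (N%:R * sN).
    apply: (@le_trans _ _ ((8 * A%:R / n0%:R) ^+ 3)).
      by apply: lerXn2r => //; rewrite nnegrE (le_trans f0).
    rewrite expr_div_n; apply: ler_wpM2l => //.
    have n03 : 0 < n0%:R ^+ 3 :> R by rewrite exprn_gt0.
    rewrite lef_pV2 // -sN2 -exprSr.
    by apply: lerXn2r; rewrite ?nnegrE // ltW.
  apply: (@le_trans _ _ (N%:R * (2 * kappa * ((8 * A%:R) ^+ 3 / (N%:R * sN))))).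
    by apply: ler_wpM2l => //; apply: ler_wpM2l => //; rewrite mulr_ge0.
  move: q0 hN2; set q := (8 * A%:R) ^+ 3 => q0 hN2.
  have -> : N%:R * (2 * kappa * (q / (N%:R * sN))) =
     16 * kappa * q * A%:R * (8 * A%:R)^-1 / sN.
    by field; rewrite !gt_eqF.
  rewrite ler_pdivrMr // [leLHS]mulrC; exact: ler_wpM2l.
have s2k : s2 <= kappa by [].
have Fsmall j : (j <= A * g)%N -> s2 * fr j ^+ 2 / 2 <= 1.
  move=> jA; have /andP[f0 f1] := frle _ _ jA.
  have f2 : fr j ^+ 2 <= (8 * A%:R / n0%:R) ^+ 2.
    by rewrite ler_sqr ?nnegrE //; apply: le_trans f1.
  have h : (8 * A%:R / n0%:R) ^+ 2 * B%:R <= 64 :> R.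
    rewrite expr_div_n mulrAC ler_pdivrMr ?exprn_gt0 //.
    apply: (@le_trans _ _ (64 * (B%:R ^+ 2 * N%:R))); last by rewrite ler_pM2l.
    have -> : (8 * A%:R) ^+ 2 * B%:R = 64 * (A%:R ^+ 2 * B%:R) :> R by ring.
    rewrite ler_pM2l // [leRHS]mulrC; apply: ler_pM => //; rewrite ?exprn_ge0 //.
      by rewrite -sN2 ler_sqr ?nnegrE ?(ltW sNp) //; apply: le_trans hN1; rewrite AS lerDl.
    by rewrite expr2 ler_peMl.
  have f20 := sqr_ge0 (fr j).
  have : s2 * fr j ^+ 2 <= kappa * (8 * A%:R / n0%:R) ^+ 2 by apply: ler_pM.
  set q := (8 * A%:R / n0%:R) ^+ 2 in h *.
  have q0 : 0 <= q by exact: sqr_ge0.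
  nra.
have Flow j : (j <= A * g)%N -> - (8 * A%:R)^-1 <= F j.
  move=> jA; have /andP[f0 _] := frle _ _ jA; rewrite FE.
  apply: le_trans (Re_char_funX_ge f0 (Fsmall _ jA)).
  have h1 := Floss _ jA.
  have h2 : 0 <= (1 - s2 * fr j ^+ 2 / 2) ^+ N by apply: exprn_ge0; have := Fsmall _ jA; lra.
  lra.
have Fmain j : (j <= g)%N -> 1 / 2 - (8 * A%:R)^-1 <= F j.
  move=> jg; have jA : (j <= A * g)%N by apply: leq_trans jg _; rewrite leq_pmull.
  have /andP[f0 f1] : 0 <= fr j <= 8 * 1%:R / n0%:R by apply: frle; rewrite mul1n.
  rewrite FE; apply: le_trans (Re_char_funX_ge f0 (Fsmall _ jA)).
  have h1 := Floss _ jA.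
  suff : 1 / 2 <= (1 - s2 * fr j ^+ 2 / 2) ^+ N by lra.
  have s2f : 0 <= s2 * fr j ^+ 2 by rewrite mulr_ge0 ?sqr_ge0.
  apply: le_trans (bernoulli_le N _); last by have := Fsmall _ jA; lra.
  have f2 : fr j ^+ 2 <= (8 * 1%:R / n0%:R) ^+ 2.
    by rewrite ler_sqr ?nnegrE //; apply: le_trans f1.
  have h : N%:R * (8 * 1%:R / n0%:R) ^+ 2 * B%:R <= 64 :> R.
    rewrite mulr1 expr_div_n mulrA mulrAC ler_pdivrMr ?exprn_gt0 //.
    apply: (@le_trans _ _ (64 * (B%:R ^+ 2 * N%:R))); last by rewrite ler_pM2l.
    have -> : N%:R * 8 ^+ 2 * B%:R = 64 * (B%:R * N%:R) :> R by ring.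
    by rewrite ler_pM2l // ler_pM2r ?ltr0n // expr2 ler_peMl.
  have f20 := sqr_ge0 (fr j).
  have : N%:R * (s2 * fr j ^+ 2) <= N%:R * (kappa * (8 * 1%:R / n0%:R) ^+ 2).
    by apply: ler_wpM2l => //; apply: ler_pM.
  have N0' : 0 <= N%:R :> R by [].
  set q := (8 * 1%:R / n0%:R) ^+ 2 in h *.
  have q0 : 0 <= q by exact: sqr_ge0.
  have Nq0 : 0 <= N%:R * q by rewrite mulr_ge0.
  have : 64 * kappa * (N%:R * q) <= B%:R * (N%:R * q) by apply: ler_wpM2r.
  lra.
have S1 : g%:R * (1 / 2 - (8 * A%:R)^-1) <= \sum_(1 <= j < g.+1) F j.
  have -> : g%:R * (1 / 2 - (8 * A%:R)^-1) =
      \sum_(1 <= j < g.+1) (1 / 2 - (8 * A%:R)^-1) :> R.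
    by rewrite sumr_const_nat subn1 /= mulr_natl.
  rewrite big_nat [leRHS]big_nat; apply: ler_sum => j /andP[_ jg]; exact: Fmain.
have gA : (g <= A * g)%N by rewrite leq_pmull.
have S2 : - ((A * g - g)%:R * (8 * A%:R)^-1) <= \sum_(g.+1 <= j < (A * g).+1) F j.
  have -> : - ((A * g - g)%:R * (8 * A%:R)^-1) =
      \sum_(g.+1 <= j < (A * g).+1) - (8 * A%:R)^-1 :> R.
    by rewrite sumr_const_nat subSS mulNrn mulr_natl.
  rewrite big_nat [leRHS]big_nat; apply: ler_sum => j /andP[_ jg]; exact: Flow.
have {}E : g%:R / 4 <= (g * n0)%:R * conv_coef L w N K.
  rewrite E (big_cat_nat (n := g.+1)) //=; last by rewrite ltnS (leq_trans gA).
  rewrite (big_cat_nat (n := (A * g).+1) (m := g.+1)) //=.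
  move: T; rewrite ler_norml => /andP[T _].
  rewrite natrB // natrM in S2.
  have Ai : A%:R * (8 * A%:R)^-1 = 1 / 8 :> R by field; lra.
  have : g%:R * (1 / 2) - g%:R * (A%:R * (8 * A%:R)^-1) <= 
    \sum_(1 <= j < g.+1) F j + \sum_(g.+1 <= j < (A * g).+1) F j.
    apply: le_trans (lerD S1 S2); rewrite le_eqVlt; apply/orP; left; apply/eqP; ring.
  rewrite Ai; lra.
rewrite natrM -mulrA ler_pM2l in E; last by lra.
have cc : 0 <= conv_coef L w N K by apply: sumr_ge0 => f _; apply: prodr_ge0.
have : 1 / 4 <= 3 * B%:R * sN * conv_coef L w N K.
  by apply: le_trans (_ : n0%:R * conv_coef L w N K <= _); [lra | apply: ler_wpM2r].
have -> : (12 * B%:R)^-1 / sN = (12 * B%:R * sN)^-1 by field; rewrite !gt_eqF //; lra.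
move=> h; rewrite -div1r ler_pdivrMr; last by rewrite !mulr_gt0 //; lra.
lra.
Qed.

End Fixed.
End LocalLimitLower.

(** * Aperiodicity *)

Section Span.
Context {R : realType}.
Implicit Types (S : set nat) (t : R).

Lemma norm_sin_sub_le (a b : R) : `|sin (a - b)| <= `|sin a| + `|sin b|.
Proof.
rewrite sinB; apply: le_trans (ler_normB _ _) _; rewrite !normrM.
by apply: lerD; [apply: ler_piMr|apply: ler_piMl]; rewrite ?cos_max.
Qed.

Lemma norm_sin_natmul_le (j : nat) t : `|sin (j%:R * t)| <= j%:R * `|sin t|.
Proof.
elim: j => [|j IH]; first by rewrite !mul0r sin0 normr0.
have -> : j.+1%:R * t = j%:R * t - (- t) by rewrite -[j.+1%:R]natr1; ring.
apply: le_trans (norm_sin_sub_le _ _) _; rewrite sinN normrN.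
by rewrite -[j.+1%:R]natr1 mulrDl mul1r lerD2r.
Qed.

(** By Bezout the gcd is an integer combination, and [|sin|] is subadditive. With a common [B] and
    an unspecified [C], the bound becomes a property of [d] stable under gcd, which can be carried
    through an iterated gcd. *)
Lemma sin_gcd_le (d1 d2 : nat) (B : R -> R) :
  (exists2 C : R, 0 <= C & forall t, `|sin (d1%:R * t)| <= C * B t) ->
  (exists2 C : R, 0 <= C & forall t, `|sin (d2%:R * t)| <= C * B t) ->
  exists2 C : R, 0 <= C & forall t, `|sin ((gcdn d1 d2)%:R * t)| <= C * B t.
Proof.
move=> [C1 C10 h1] [C2 C20 h2].
have [->|d10] := posnP d1; first by rewrite gcd0n; exists C2.
have [km kn E _] := egcdnP d2 d10.
exists (km%:R * C1 + kn%:R * C2); first by rewrite addr_ge0 ?mulr_ge0.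
move=> t.
have -> : (gcdn d1 d2)%:R * t = km%:R * (d1%:R * t) - kn%:R * (d2%:R * t).
  by rewrite !mulrA -!natrM E natrD; ring.
apply: le_trans (norm_sin_sub_le _ _) _; rewrite mulrDl -!mulrA.
by apply: lerD; apply: le_trans (norm_sin_natmul_le _ _) _; apply: ler_wpM2l.
Qed.

(** Take [k0] minimal in [S]. The gcds [G n] decrease for divisibility; their least positive value
    divides every difference [k - k0], so [S] lies in a progression of that step, and the hypothesis
    forces the step to be 1. *)
Lemma aperiodic_prefix S :
  (forall m b, S `<=` [set (m * j + b)%N | j in [set: nat]] -> (m <= 1)%N) ->
  exists k0 n, S k0 /\ (k0 < n)%N /\
    \big[gcdn/0%N]_(k < n | `[< S k /\ (k0 <= k)%N >]) (k - k0)%N = 1%N.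
Proof.
move=> aper.
have [k1 Sk1] : exists k, S k.
  apply: contrapT => nS; suff : (2 <= 1)%N by [].
  by apply: (aper 2 0)%N => k Sk; exfalso; apply: nS; exists k.
have exS : exists k, `[< S k >] by exists k1; apply/asboolP.
pose k0 := ex_minn exS.
have [Sk0 k0min] : S k0 /\ forall k, S k -> (k0 <= k)%N.
  rewrite /k0; case: ex_minnP => k /asboolP Sk h.
  by split => // l Sl; apply: h; apply/asboolP.
pose G n := \big[gcdn/0%N]_(k < n | `[< S k /\ (k0 <= k)%N >]) (k - k0)%N.
have GD n k : S k -> (k < n)%N -> (G n %| k - k0)%N.
  move=> Sk kn; have := dvdnn (G n); move/dvdn_biggcdP => /(_ (Ordinal kn)).
  by apply; apply/asboolP; split => //; apply: k0min.
have Gmono n1 n2 : (n1 <= n2)%N -> (G n2 %| G n1)%N.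
  move=> n12; apply/dvdn_biggcdP => k /asboolP[Sk _].
  by apply: GD => //; apply: leq_trans n12.
(* If every gcd were 0, [S] would reduce to [k0] and lie in a progression of step 2. *)
have [n1 Gn1] : exists n, (0 < G n)%N.
  apply: contrapT => nG; suff : (2 <= 1)%N by [].
  apply: (aper 2 k0)%N => k Sk; exists 0%N => //.
  have := GD k.+1 k Sk (ltnSn k).
  have -> : G k.+1 = 0%N by apply/eqP; rewrite -leqn0 leqNgt; apply/negP => h; apply: nG; exists k.+1.
  by rewrite dvd0n => /eqP h; have := k0min _ Sk; lia.
have exv : exists v, `[< (0 < v)%N /\ exists n, G n = v >].
  by exists (G n1); apply/asboolP; split => //; exists n1.
have [v /asboolP[v0 [n2 Gn2]] vmin] := ex_minnP exv.
have vS k : S k -> (v %| k - k0)%N.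
  move=> Sk; pose n := maxn n2 k.+1.
  have h1 : (G n %| v)%N by rewrite -Gn2; apply: Gmono; apply: leq_maxl.
  have Gn0 : (0 < G n)%N by apply: dvdn_gt0 h1.
  have h2 : (v <= G n)%N by apply: vmin; apply/asboolP; split => //; exists n.
  have -> : v = G n by apply/eqP; rewrite eqn_leq h2 dvdn_leq.
  by apply: GD => //; apply: leq_maxr.
have v1 : v = 1%N.
  apply/eqP; rewrite eqn_leq v0 andbT; apply: (aper v k0) => k Sk.
  have /dvdnP[j E] := vS k Sk; exists j => //.
  by have := k0min _ Sk; lia.
exists k0, (maxn n2 k0.+1); split=> //; split; first exact: leq_maxr.
apply/eqP; rewrite -dvdn1 -v1 -Gn2; apply: Gmono; exact: leq_maxl.
Qed.

(** The quadratic lower bound on [1 - |phi|^2] that feeds the local estimates. Finitely many atoms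
    with gcd of differences 1 already give [sin t ^ 2 <= D * sum of sin (d t) ^ 2] over these
    differences. As [n] and [c] depend on [S] alone, one pair of constants serves all the weights
    met along the sequence. *)
Lemma aperiodic_quadratic_bound S :
  (forall m b, S `<=` [set (m * j + b)%N | j in [set: nat]] -> (m <= 1)%N) ->
  exists (n : nat) (c : R), 0 < c /\ forall (L : nat) (W : nat -> R) (delta : R),
    (n <= L)%N -> (forall k, 0 <= W k) -> 0 <= delta ->
    (forall k, (k < n)%N -> S k -> delta <= W k) ->
    forall t, 0 <= t <= pi -> c * delta ^+ 2 * t ^+ 2 <=
      \sum_(k < L) \sum_(l < L) W k * W l * (1 - cos (t * (k%:R - l%:R))).
Proof.
move=> /aperiodic_prefix[k0 [n [Sk0 [k0n G1]]]].
pose Q := fun k : 'I_n => `[< S k /\ (k0 <= k)%N >].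
pose B t := \sum_(k < n | Q k) `|sin ((k - k0)%:R * t)|.
have [C C0 hC] : exists2 C : R, 0 <= C & forall t, `|sin (1%:R * t)| <= C * B t.
  have : exists2 C : R, 0 <= C & forall t,
     `|sin ((\big[gcdn/0%N]_(k < n | Q k) (k - k0)%N)%:R * t)| <= C * B t.
    apply: (big_ind (fun d : nat => exists2 C : R, 0 <= C &
        forall t, `|sin (d%:R * t)| <= C * B t)).
    - exists 0 => // t; by rewrite !mul0r sin0 normr0.
    - by move=> d1 d2; apply: sin_gcd_le.
    - move=> k Qk; exists 1 => // t; rewrite mul1r /B (bigD1 k) //= lerDl.
      by apply: sumr_ge0.
  by rewrite G1.
pose D : R := C ^+ 2 * n%:R + 1.
have D0 : 0 < D by rewrite ltr_wpDl // mulr_ge0 ?sqr_ge0.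
have hC2 t : sin t ^+ 2 <= D * \sum_(k < n | Q k) sin ((k - k0)%:R * t) ^+ 2.
  set B2 := \sum_(k < n | Q k) _ ^+ 2.
  have B20 : 0 <= B2 by apply: sumr_ge0 => k _; apply: sqr_ge0.
  have BB : B t ^+ 2 <= n%:R * B2.
    have -> : B t = \sum_(k < n | Q k) 1 * `|sin ((k - k0)%:R * t)|.
      by apply: eq_bigr => k _; rewrite mul1r.
    (* Cauchy-Schwarz, by expanding the double sum of [(u k - u l)^2]. *)
    have CS (u : 'I_n -> R) : (\sum_(k < n | Q k) u k) ^+ 2 <=
        n%:R * \sum_(k < n | Q k) u k ^+ 2.
      have h : 0 <= \sum_(k < n | Q k) \sum_(l < n | Q l) (u k - u l) ^+ 2.
        by apply: sumr_ge0 => k _; apply: sumr_ge0 => l _; apply: sqr_ge0.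
      set q : R := (\sum_(k < n | Q k) 1%R).
      have qn : q <= n%:R.
        rewrite /q sumr_const ler_nat -[leqRHS]card_ord; exact: max_card.
      have E : \sum_(k < n | Q k) \sum_(l < n | Q l) (u k - u l) ^+ 2 =
        2 * (q * \sum_(k < n | Q k) u k ^+ 2) - 2 * (\sum_(k < n | Q k) u k) ^+ 2.
        set U2 := \sum_(k < n | Q k) u k ^+ 2; set U1 := \sum_(k < n | Q k) u k.
        have inner (k : 'I_n) : \sum_(l < n | Q l) (u k - u l) ^+ 2 =
            u k ^+ 2 * q + 1 * U2 - u k * (2 * U1).
          rewrite (eq_bigr (fun l : 'I_n => u k ^+ 2 * 1 + u l ^+ 2 - 2 * u k * u l));
            last by move=> l _; ring.
          by rewrite sumrB big_split /= -!mulr_sumr -/q -/U1 -/U2; ring.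
        under eq_bigr do rewrite inner.
        by rewrite sumrB big_split /= -!mulr_suml -/q -/U1 -/U2; ring.
      have : 0 <= \sum_(k < n | Q k) u k ^+ 2 by apply: sumr_ge0 => k _; apply: sqr_ge0.
      rewrite E in h; nra.
    apply: le_trans (CS _) _; apply: ler_wpM2l => //.
    by apply: ler_sum => k _; rewrite mul1r real_normK ?num_real.
  have := hC t; rewrite mul1r => h.
  have B0 : 0 <= B t by apply: sumr_ge0.
  apply: (@le_trans _ _ ((C * B t) ^+ 2)).
    by rewrite -[leLHS]real_normK ?num_real // ler_sqr ?nnegrE ?mulr_ge0.
  rewrite exprMn /D mulrDl mul1r; apply: (@le_trans _ _ (C ^+ 2 * n%:R * B2)).
    by rewrite -mulrA; apply: ler_wpM2l => //; apply: sqr_ge0.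
  by rewrite lerDl.
(* The 2 comes from [1 - cos z = 2 sin (z / 2) ^ 2], the 64 from [t / 8 <= sin (t / 2)]. *)
exists n, (2 / (64 * D)); split; first by rewrite divr_gt0 ?mulr_gt0.
move=> L W delta nL W0 del0 hW t tpi.
have st : t ^+ 2 / 64 <= sin (t / 2) ^+ 2.
  have := sin_lower tpi; case/andP: tpi => t0 _ h.
  have -> : t ^+ 2 / 64 = (t / 8) ^+ 2 by field.
  by rewrite ler_sqr ?nnegrE //; [lra|apply: le_trans h; lra].
have h2 := hC2 (t / 2).
apply: (@le_trans _ _ (2 * delta ^+ 2 *
    \sum_(k < n | Q k) sin ((k - k0)%:R * (t / 2)) ^+ 2)).
  have d2 := sqr_ge0 delta.
  have -> : 2 / (64 * D) * delta ^+ 2 * t ^+ 2 = 2 * delta ^+ 2 * (t ^+ 2 / 64 / D).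
    by field; rewrite gt_eqF.
  apply: ler_wpM2l; first by rewrite mulr_ge0.
  rewrite ler_pdivrMr // [leRHS]mulrC; exact: le_trans h2.
have pos (k l : 'I_L) : 0 <= W k * W l * (1 - cos (t * (k%:R - l%:R))).
  by rewrite !mulr_ge0 // subr_ge0 cos_le1.
have k0L : (k0 < L)%N by apply: leq_trans nL.
(* Of the nonnegative double sum only the pairs [(k, k0)] are kept. *)
apply: (@le_trans _ _ (\sum_(k < L) W k * W k0 * (1 - cos (t * (k%:R - k0%:R))))); last first.
  apply: ler_sum => k _; rewrite (bigD1 (Ordinal k0L)) //= lerDl.
  by apply: sumr_ge0 => l _; apply: pos.
rewrite (big_ord_widen_cond _ (fun k => `[< S k /\ (k0 <= k)%N >])
  (fun k => sin ((k - k0)%:R * (t / 2)) ^+ 2) nL).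
rewrite mulr_sumr big_mkcond /=; apply: ler_sum => k _.
case: ifP => [/andP[/asboolP[Sk k0k] kn]|_]; last exact: (pos k (Ordinal k0L)).
rewrite cos_half_sin natrB //.
have -> : t * (k%:R - k0%:R) / 2 = (k%:R - k0%:R) * (t / 2) by ring.
have wk := hW _ kn Sk; have wk0 := hW _ k0n Sk0.
have : delta ^+ 2 <= W k * W k0 by rewrite expr2; apply: ler_pM.
set s := sin _ ^+ 2; have : 0 <= s by apply: sqr_ge0.
nra.
Qed.

End Span.

(** * Local bounds after an exponential tilt of the weights *)

Section TiltedLocalLimit.
Context {R : realType}.
Implicit Types (w : nat -> R) (x c kappa h Z : R) (L N K : nat).

(** On every configuration counted by the coefficient, the product of the tilting factors is e^{h (K
    - N x)} = 1. The lemma serves twice: to choose [h] freely in the local bounds, and to undo the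
    tilt of the probability law. *)
Lemma conv_coef_tilt L N K w x h Z : N%:R * x = K%:R ->
  conv_coef L (fun k => w k * expR (h * (k%:R - x)) / Z) N K =
  conv_coef L w N K / Z ^+ N.
Proof.
move=> NxK; rewrite /conv_coef mulr_suml; apply: eq_bigr => f /eqP fK.
rewrite !big_split /= prodr_const card_ord exprVn -expR_sum -mulr_sumr sumrB.
rewrite -natr_sum fK sumr_const card_ord -[x *+ N]mulr_natl NxK subrr mulr0.
by rewrite expR0 mulr1.
Qed.

Lemma exists_natr_ge (y : R) : exists n : nat, (0 < n)%N /\ y <= n%:R.
Proof.
exists (Num.bound `|y|).+1; split=> //; apply: le_trans (ler_norm y) _.
apply: ltW; apply: lt_le_trans (archi_boundP (normr_ge0 y)) _.
by rewrite ler_nat.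
Qed.

Lemma le_sqrt_natr (y : R) : exists n0 : nat, forall n : nat, (n0 <= n)%N ->
  y <= Num.sqrt n%:R.
Proof.
have [n0 [_ h]] := exists_natr_ge (y ^+ 2); exists n0 => n n0n.
apply: le_trans (ler_norm y) _; rewrite -sqrtr_sqr; apply: ler_wsqrtr.
by apply: le_trans h _; rewrite ler_nat.
Qed.

Section Fixed.
Variables (L N K : nat) (w : nat -> R) (x h c : R).
Let W k := w k * expR (h * (k%:R - x)).
Let Z := \sum_(k < L) W k.
Hypotheses (N0 : (0 < N)%N) (c0 : 0 < c) (w0 : forall k, 0 <= w k).
Hypotheses (Z0 : 0 < Z) (NxK : N%:R * x = K%:R).
Hypothesis (Hc : forall t, 0 <= t <= pi -> c * Z ^+ 2 * t ^+ 2 <=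
  \sum_(k < L) \sum_(l < L) W k * W l * (1 - cos (t * (k%:R - l%:R)))).

Let V k := W k / Z.
Let V0 k : 0 <= V k. Proof. by rewrite divr_ge0 ?mulr_ge0 ?expR_ge0 // ltW. Qed.
Let V1 : \sum_(k < L) V k = 1. Proof. by rewrite -mulr_suml divff // gt_eqF. Qed.
Let HV t : 0 <= t <= pi -> c * t ^+ 2 <=
  \sum_(k < L) \sum_(l < L) V k * V l * (1 - cos (t * (k%:R - l%:R))).
Proof.
move=> /Hc H; rewrite mulrAC -ler_pdivlMr ?exprn_gt0 // in H.
apply: le_trans H _; rewrite mulr_suml le_eqVlt; apply/orP; left; apply/eqP.
apply: eq_bigr => k _; rewrite mulr_suml; apply: eq_bigr => l _.
by rewrite /V; field; rewrite gt_eqF.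
Qed.
Let convV : conv_coef L V N K = conv_coef L w N K / Z ^+ N.
Proof. exact: conv_coef_tilt. Qed.

Lemma conv_coef_tilt_upper :
  conv_coef L w N K <= (3 + 36 / c) / Num.sqrt N%:R * Z ^+ N.
Proof.
by rewrite -ler_pdivrMr ?exprn_gt0 // -convV; exact: (conv_coef_upper N0 c0 V0 V1 NxK HV).
Qed.

Lemma conv_coef_tilt_lower (A B : nat) kappa :
  \sum_(k < L) W k * (k%:R - x) = 0 ->
  \sum_(k < L) W k * (k%:R - x) ^+ 2 <= kappa * Z ->
  \sum_(k < L) W k * `|k%:R - x| ^+ 3 <= kappa * Z ->
  (0 < A)%N -> (0 < B)%N ->
  144 * B%:R ^+ 2 / c <= A%:R :> R -> 64 * kappa <= B%:R ->
  (A.+1)%:R <= Num.sqrt N%:R :> R ->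
  16 * kappa * (8 * A%:R) ^+ 3 * A%:R <= Num.sqrt N%:R ->
  (12 * B%:R)^-1 / Num.sqrt N%:R * Z ^+ N <= conv_coef L w N K.
Proof.
move=> m0 k2 k3 A0 B0 h1 h2 h3 h4.
have VE (F : nat -> R) : \sum_(k < L) V k * F k = (\sum_(k < L) W k * F k) / Z.
  by rewrite mulr_suml; apply: eq_bigr => k _; rewrite mulrAC.
rewrite -ler_pdivlMr ?exprn_gt0 // -convV.
apply: (conv_coef_lower N0 c0 V0 V1 NxK HV _ _ _ A0 B0 h1 h2 h3 h4).
- by rewrite (VE (fun k => k%:R - x)) m0 mul0r.
- by rewrite (VE (fun k => (k%:R - x) ^+ 2)) ler_pdivrMr.
- by rewrite (VE (fun k => `|k%:R - x| ^+ 3)) ler_pdivrMr.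
Qed.

End Fixed.

(** What matters is the order of choices: [B] from [kappa], then [A] from [B] and [c], then [N1],
    all before the weights, the level [L] and the tilt [h] are known. *)
Lemma conv_coef_two_sided c kappa : 0 < c -> 0 < kappa ->
  exists (C c1 : R) (N1 : nat), [/\ 0 < C, 0 < c1 & forall L N K w x h,
  let W k := w k * expR (h * (k%:R - x)) in
  let Z := \sum_(k < L) W k in
  (0 < N)%N -> (forall k, 0 <= w k) -> 0 < Z -> N%:R * x = K%:R ->
  (forall t, 0 <= t <= pi -> c * Z ^+ 2 * t ^+ 2 <=
    \sum_(k < L) \sum_(l < L) W k * W l * (1 - cos (t * (k%:R - l%:R)))) ->
  conv_coef L w N K <= C / Num.sqrt N%:R * Z ^+ N /\
  ((N1 <= N)%N -> \sum_(k < L) W k * (k%:R - x) = 0 ->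
  \sum_(k < L) W k * (k%:R - x) ^+ 2 <= kappa * Z ->
  \sum_(k < L) W k * `|k%:R - x| ^+ 3 <= kappa * Z ->
  c1 / Num.sqrt N%:R * Z ^+ N <= conv_coef L w N K)].
Proof.
move=> c0 kap0.
have [B [B0 hB]] := exists_natr_ge (64 * kappa).
have [A [A0 hA]] := exists_natr_ge (144 * B%:R ^+ 2 / c).
have [N1 hN1] := le_sqrt_natr (A.+1)%:R.
have [N2 hN2] := le_sqrt_natr (16 * kappa * (8 * A%:R) ^+ 3 * A%:R).
exists (3 + 36 / c), (12 * B%:R)^-1, (maxn N1 N2); split.
- by rewrite addr_gt0 // divr_gt0.
- by rewrite invr_gt0 mulr_gt0 // ltr0n.
move=> L N K w x h W Z N0 w0 Z0 NxK Hc; split.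
  exact: (conv_coef_tilt_upper N0 c0 w0 Z0 NxK Hc).
rewrite geq_max => /andP[N1N N2N] m0 k2 k3.
by apply: (conv_coef_tilt_lower N0 c0 w0 Z0 NxK Hc m0 k2 k3 A0 B0 hA hB); auto.
Qed.

End TiltedLocalLimit.

(** * Independence and change of measure *)

Section Transfer.
Import HBNNSimple.
Context {R : realType}.
Local Open Scope ereal_scope.

Section Weighted.
Context d e (T : measurableType d) (U : measurableType e).
Variables (mu : {measure set T -> \bar R}) (W : T -> R) (V : T -> U).
Hypotheses (mW : measurable_fun setT W) (W0 : forall w, (0 <= W w)%R).
Hypothesis mV : measurable_fun setT V.

Let mWV (g : U -> R) : measurable_fun setT g ->
  measurable_fun setT (fun w => W w * g (V w))%R.
Proof.
by move=> mg; apply: measurable_funM => //; exact: measurableT_comp.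
Qed.

Lemma integral_weighted_nnsfun (s : {nnsfun U >-> R}) :
  \int[mu]_w (W w * s (V w))%:E =
  \sum_(y \in range s) y%:E * \int[mu]_w (W w * \1_(s @^-1` [set y]) (V w))%:E.
Proof.
have E w : (W w * s (V w))%:E =
    \sum_(y \in range s) (y%:E * (W w * \1_(s @^-1` [set y]) (V w))%:E).
  rewrite {1}(fimfunE s) fsumEFin // -fsumEFin //.
  rewrite EFinM -fsumEFin // ge0_mule_fsumr; last first.
    by move=> y; rewrite lee_fin; exact: (nnfun_muleindic_ge0 s y (V w)).
  by apply: eq_fsbigr => y _; rewrite -!EFinM mulrCA.
under eq_integral do rewrite E.
rewrite ge0_integral_fsum //.
- apply: eq_fsbigr => y; rewrite inE => -[t _ <-].
  rewrite ge0_integralZl_EFin //; last exact/measurable_EFinP/mWV.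
  by move=> w _; rewrite lee_fin mulr_ge0.
- by move=> y; apply: emeasurable_funM => //; exact/measurable_EFinP/mWV.
- move=> y w _; have [y0|y0] := leP 0%R y.
    by rewrite mule_ge0 ?lee_fin // mulr_ge0.
  by rewrite preimage_nnfun0 // indicE in_set0 mulr0 mule0.
Qed.

Lemma integral_weighted_lim (g : U -> R) (mg : measurable_fun setT g) :
  (forall u, (0 <= g u)%R) ->
  \int[mu]_w (W w * g (V w))%:E =
  limn (fun n => \int[mu]_w (W w * nnsfun_approx measurableT
     (proj2 (measurable_EFinP setT g) mg) n (V w))%:E).
Proof.
move=> g0; set s := nnsfun_approx _ _.
rewrite -monotone_convergence //.
- apply: eq_integral => w _; apply/esym/cvg_lim => //.
  under eq_fun do rewrite EFinM.
  rewrite EFinM; apply: cvgeZl => //.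
  by apply: cvg_nnsfun_approx => // u _; rewrite lee_fin.
- by move=> n; exact/measurable_EFinP/mWV.
- by move=> n w _; rewrite lee_fin mulr_ge0.
- move=> w _ m n mn; rewrite lee_fin; apply: ler_wpM2l => //.
  exact/lefP/nd_nnsfun_approx.
Qed.

End Weighted.

(** Extension from indicators to nonnegative functions, by simple functions and monotone
    convergence. Two spaces and two weights are allowed so that one lemma covers independence (the
    weight is the product of the other factors), equality in law (weight 1) and tilting (the weight
    is the density). *)
Lemma integral_transfer d1 d2 e (T1 : measurableType d1) (T2 : measurableType d2)
    (U : measurableType e) (mu1 : {measure set T1 -> \bar R})
    (mu2 : {measure set T2 -> \bar R}) (W1 : T1 -> R) (W2 : T2 -> R)
    (V1 : T1 -> U) (V2 : T2 -> U) :
  measurable_fun setT W1 -> measurable_fun setT W2 ->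
  (forall w, (0 <= W1 w)%R) -> (forall w, (0 <= W2 w)%R) ->
  measurable_fun setT V1 -> measurable_fun setT V2 ->
  (forall C, measurable C -> \int[mu1]_w (W1 w * \1_C (V1 w))%:E =
                             \int[mu2]_w (W2 w * \1_C (V2 w))%:E) ->
  forall g : U -> R, measurable_fun setT g -> (forall u, (0 <= g u)%R) ->
  \int[mu1]_w (W1 w * g (V1 w))%:E = \int[mu2]_w (W2 w * g (V2 w))%:E.
Proof.
move=> mW1 mW2 W10 W20 mV1 mV2 H g mg g0.
rewrite (integral_weighted_lim mu1 mW1 W10 mV1 mg g0).
rewrite (integral_weighted_lim mu2 mW2 W20 mV2 mg g0).
apply: congr_lim; apply/funext => n.
by rewrite !integral_weighted_nnsfun //; apply: eq_fsbigr => y _; rewrite H.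
Qed.

Section Independence.
Context d e (T : measurableType d) (U : measurableType e) (P : probability T R).

(** Induction on the set [A] of indices that carry [g i], the others carrying indicators of
    arbitrary measurable sets. The case of empty [A] is independence itself, and full [A] is the
    claim. *)
Lemma independent_integral_prod (I : finType) (V : I -> T -> U) (g : I -> U -> R) :
  mutually_independent P V -> (forall i, measurable_fun setT (V i)) ->
  (forall i, measurable_fun setT (g i)) -> (forall i u, (0 <= g i u)%R) ->
  (forall i, \int[P]_w (g i (V i w))%:E < +oo) ->
  \int[P]_w (\prod_i g i (V i w))%:E = (\prod_i fine (\int[P]_w (g i (V i w))%:E))%:E.
Proof.
move=> ind mV mg g0 gfin.
pose phi (A : {set I}) (B : I -> set U) i : U -> R :=
  if i \in A then g i else \1_(B i).
pose E (f : T -> R) : R := fine (\int[P]_w (f w)%:E).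
have phi0 A B i u : (0 <= phi A B i u)%R by rewrite /phi; case: ifP.
have mphi A B i : (forall j, measurable (B j)) -> measurable_fun setT (phi A B i).
  by move=> mB; rewrite /phi; case: ifP => _ //; apply: measurable_indic.
have fphi A B i : (forall j, measurable (B j)) ->
    \int[P]_w (phi A B i (V i w))%:E \is a fin_num.
  move=> mB; rewrite ge0_fin_numE; last by apply: integral_ge0 => w _; rewrite lee_fin.
  rewrite /phi; case: ifP => _ //.
  rewrite (_ : (fun w => _) = EFin \o \1_(V i @^-1` B i)); last by [].
  rewrite integral_indic // ?setIT; last by rewrite -[X in measurable X]setTI; apply: mV.
  by rewrite (le_lt_trans (probability_le1 _ _)) ?ltry //; rewrite -[X in measurable X]setTI; apply: mV.
suff H (A : {set I}) B : (forall j, measurable (B j)) ->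
    \int[P]_w (\prod_i phi A B i (V i w))%:E =
    (\prod_i E (fun w => phi A B i (V i w)))%:E.
  have := H (finset.finset (fun=> true)) (fun=> setT) (fun=> measurableT).
  by rewrite /phi; under [in X in X -> _]eq_integral do under eq_bigr do rewrite inE;
    under [in X in X -> _]eq_bigr do rewrite inE.
have [n] := ubnP #|A|; elim: n A B => // n IH A B; rewrite ltnS => An mB.
have [->|[j jA]] := set_0Vmem A.
  pose D := \bigcap_(i in [set` (finset.finset (fun=> true) : {set I})]) (V i @^-1` B i).
  have mVB i : measurable (V i @^-1` B i).
    by rewrite -[X in measurable X]setTI; apply: mV.
  have -> : \int[P]_w (\prod_i phi finset.set0 B i (V i w))%:E = P D.
    rewrite -[in RHS](setIT D) -integral_indic //; last first.
      by apply: fin_bigcap_measurable.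
    apply: eq_integral => w _; congr EFin; rewrite /phi.
    under eq_bigr do rewrite inE indicE.
    have [wD|wD] := boolP (w \in D).
      rewrite indicE wD big1 // => i _; rewrite mem_set //.
      by move/set_mem : wD; apply; rewrite /= inE.
    rewrite indicE (negbTE wD).
    have [i iB] : exists i, ~ B i (V i w).
      apply: contrapT => h; move/negP: wD; apply; apply/mem_set => i _.
      by apply: contrapT => h'; apply: h; exists i.
    by rewrite (bigD1 i) //= memNset // mul0r.
  rewrite /D ind // -prodEFin; apply: eq_big => i; first by rewrite inE.
  move=> _; rewrite fineK; last exact: fphi.
  rewrite /phi inE /=.
  by rewrite -[in LHS](setIT (V i @^-1` B i)) -integral_indic.
pose A' := (A :\ j)%SET.
have A'n : (#|A'| < n)%N by rewrite (leq_trans _ An) // [in leqRHS](cardsD1 j) jA.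
pose W w : R := (\prod_(i | i != j) phi A B i (V i w))%R.
pose c : R := (\prod_(i | i != j) E (fun w => phi A B i (V i w)))%R.
have W0 w : (0 <= W w)%R by apply: prodr_ge0.
have c0 : (0 <= c)%R.
  by apply: prodr_ge0 => i _; apply: fine_ge0; apply: integral_ge0 => w _; rewrite lee_fin.
have mW : measurable_fun setT W.
  rewrite /W; under eq_fun do rewrite -big_filter.
  by apply: measurable_prod => i _; apply: measurableT_comp => //; exact: mphi.
(* The factors other than [j] are replaced by their mean [c]. For an indicator in place of [g j]
   this is the induction hypothesis, since [j] has then left [A]. *)
have tr := @integral_transfer _ _ _ T T U P P W (cst c) (V j) (V j) mW
  (@measurable_cst _ _ T R setT c) W0 (fun=> c0) (mV j) (mV j) _ (g j) (mg j) (g0 j).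
have -> : \int[P]_w (\prod_i phi A B i (V i w))%:E = \int[P]_w (W w * g j (V j w))%:E.
  by apply: eq_integral => w _; rewrite (bigD1 j) //= mulrC {2}/phi jA.
have mgV : measurable_fun setT (fun w => g j (V j w)) by apply: measurableT_comp.
rewrite tr; last first.
  move=> C mC; pose B' i := if i == j then C else B i.
  have mB' i : measurable (B' i) by rewrite /B'; case: ifP.
  have E' i : i != j -> phi A' B' i = phi A B i.
    by move=> ij; rewrite /phi /B' !inE ij /= (negbTE ij).
  have Ej : phi A' B' j = \1_C by rewrite /phi /B' !inE eqxx.
  transitivity (\int[P]_w (\prod_i phi A' B' i (V i w))%:E).
    apply: eq_integral => w _; congr EFin; rewrite [RHS](bigD1 j) //= Ej mulrC.
    by congr (_ * _)%R; apply: eq_bigr => i ij; rewrite E'.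
  rewrite IH //.
  rewrite (bigD1 j) //= Ej (eq_bigr (fun i => E (fun w => phi A B i (V i w)))); last first.
    by move=> i ij; rewrite E'.
  rewrite -/c mulrC EFinM /E fineK; last by rewrite -Ej; apply: fphi.
  under [RHS]eq_integral do rewrite EFinM.
  rewrite ge0_integralZl_EFin //.
  by apply/measurable_EFinP; apply: measurableT_comp => //; apply: measurable_indic.
under eq_integral do rewrite EFinM.
rewrite ge0_integralZl_EFin //; first last.
- exact/measurable_EFinP.
- by move=> w _; rewrite lee_fin.
rewrite (bigD1 j) //= -/c mulrC EFinM /E fineK; last exact: fphi.
by rewrite /phi jA.
Qed.

End Independence.
End Transfer.

(** * The Laplace transform on the conditioning event as a coefficient *)

Section Laplace.
Context {R : realType}.

Lemma measurable_fun_nat d (U : measurableType d) (f : nat -> U) :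
  measurable_fun setT f.
Proof. by move=> _ Y mY. Qed.

Lemma measurable_pair_rv d (T : measurableType d) (X : T -> nat) (Y : T -> R) :
  measurable_fun setT X -> measurable_fun setT Y ->
  measurable_fun setT (pair_rv X Y).
Proof. by move=> mX mY; apply: measurable_fun_pair. Qed.

Definition wgt d (T : measurableType d) (P : probability T R) (X : T -> nat)
    (Y : T -> R) (m u : R) (k : nat) : R :=
  \int[P]_w (expR (u * (Y w - m)) * (X w == k)%:R).

Lemma wgt_ge0 d (T : measurableType d) (P : probability T R) (X : T -> nat)
  (Y : T -> R) (m u : R) (k : nat) : 0 <= wgt P X Y m u k.
Proof. by apply: Rintegral_ge0 => w _; rewrite mulr_ge0 ?expR_ge0. Qed.

Lemma measurable_wgt_integrand (m u : R) (k : nat) : measurable_fun setT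
  (fun v : nat * R => expR (u * (v.2 - m)) * (v.1 == k)%:R).
Proof.
apply: measurable_funM.
  apply: measurableT_comp; first exact: measurable_expR.
  apply: measurable_funM => //; apply: measurable_funB => //.
apply: (measurableT_comp (measurable_fun_nat (fun j => (j == k)%:R : R))).
exact: measurable_fst.
Qed.

Lemma same_law_integral d d' (T : measurableType d) (T' : measurableType d')
    e (U : measurableType e) (P : probability T R) (P' : probability T' R)
    (V : T -> U) (V' : T' -> U) (g : U -> R) :
  same_law P V P' V' -> measurable_fun setT V -> measurable_fun setT V' ->
  measurable_fun setT g -> (forall u, 0 <= g u) ->
  (\int[P]_w (g (V w))%:E = \int[P']_w (g (V' w))%:E)%E.
Proof.
move=> sl mV mV' mg g0.
have one d0 (S : measurableType d0) (Q : probability S R) (f : S -> R) :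
    (\int[Q]_w (f w)%:E = \int[Q]_w ((cst 1 : S -> R) w * f w)%:E)%E.
  by apply: eq_integral => w _; rewrite mul1r.
rewrite (one _ _ P) (one _ _ P').
apply: (@integral_transfer R _ _ _ T T' U P P' (cst 1) (cst 1) V V') => // C mC.
rewrite -(one _ _ P (fun w => \1_C (V w))) -(one _ _ P' (fun w => \1_C (V' w))).
have mVC : measurable (V @^-1` C) by rewrite -[X in measurable X]setTI; apply: mV.
have mV'C : measurable (V' @^-1` C) by rewrite -[X in measurable X]setTI; apply: mV'.
have := sl _ mC.
by rewrite -[in X in X -> _](setIT (V @^-1` C)) -[in X in X -> _](setIT (V' @^-1` C)) -!integral_indic.
Qed.

(** Any [L > K] will do: on the event that the sum equals [K], no summand exceeds [K], so exactly
    one configuration [f] with values below [L] matches the sample. Independence then factorises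
    each configuration. *)
Lemma laplace_conv_coef d d' (T : measurableType d) (T' : measurableType d')
    (P : probability T R) (P' : probability T' R) (N K L : nat)
    (Xs : 'I_N -> T -> nat) (Ys : 'I_N -> T -> R) (X : T' -> nat) (Y : T' -> R)
    (m u : R) :
  (forall i, measurable_fun setT (Xs i)) -> (forall i, measurable_fun setT (Ys i)) ->
  measurable_fun setT X -> measurable_fun setT Y ->
  mutually_independent P (fun i => pair_rv (Xs i) (Ys i)) ->
  (forall i, same_law P (pair_rv (Xs i) (Ys i)) P' (pair_rv X Y)) ->
  (\int[P']_w (expR (u * (Y w - m)))%:E < +oo)%E -> (K < L)%N ->
  (\int[P]_w (expR (u * (\sum_i Ys i w - N%:R * m)) *
              ((\sum_i Xs i w)%N == K)%:R)%:E =
   (conv_coef L (wgt P' X Y m u) N K)%:E)%E.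
Proof.
move=> mXs mYs mX mY ind sl fin KL.
pose g k (v : nat * R) : R := expR (u * (v.2 - m)) * (v.1 == k)%:R.
have mg k : measurable_fun setT (g k) by exact: measurable_wgt_integrand.
have g0 k v : 0 <= g k v by rewrite mulr_ge0 ?expR_ge0.
have mV i := measurable_pair_rv (mXs i) (mYs i).
have mV' := measurable_pair_rv mX mY.
have Eg i k : (\int[P]_w (g k (pair_rv (Xs i) (Ys i) w))%:E =
               \int[P']_w (g k (pair_rv X Y w))%:E)%E.
  exact: same_law_integral (sl i) _ _ (mg k) (g0 k).
have gfin k : (\int[P']_w (g k (pair_rv X Y w))%:E < +oo)%E.
  apply: le_lt_trans fin; apply: ge0_le_integral => //.
  - by move=> w _; rewrite lee_fin g0.
  - by apply/measurable_EFinP; apply: measurableT_comp.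
  - apply/measurable_EFinP; apply: measurableT_comp; first exact: measurable_expR.
    by apply: measurable_funM => //; apply: measurable_funB.
  - by move=> w _; rewrite lee_fin /g /= ler_piMr ?expR_ge0 // lern1 leq_b1.
have E w : expR (u * (\sum_i Ys i w - N%:R * m)) * ((\sum_i Xs i w)%N == K)%:R =
    \sum_(f : {ffun 'I_N -> 'I_L} | (\sum_i f i == K)%N)
      \prod_i g (f i) (pair_rv (Xs i) (Ys i) w).
  have -> : expR (u * (\sum_i Ys i w - N%:R * m)) = \prod_i expR (u * (Ys i w - m)).
    rewrite -expR_sum -mulr_sumr sumrB sumr_const card_ord.
    by rewrite -[m *+ N]mulr_natl.
  rewrite /g; under [RHS]eq_bigr do rewrite big_split /=.
  rewrite -mulr_sumr; congr (_ * _).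
  have pb (f : {ffun 'I_N -> 'I_L}) : \prod_i ((Xs i w == f i)%:R : R) =
      [forall i, Xs i w == f i]%:R.
    have [/forallP h|/forallPn[i hi]] := boolP [forall i, Xs i w == f i].
      by apply: big1 => i _; rewrite h.
    by rewrite (bigD1 i) //= (negbTE hi) mul0r.
  under [RHS]eq_bigr do rewrite pb.
  case: eqP => [sK|sK]; last first.
    rewrite big1 // => f /eqP fK; case: forallP => // h; exfalso; apply: sK.
    by rewrite -fK; apply: eq_bigr => i _; apply/eqP.
  have XL i : (Xs i w < L)%N.
    by apply: leq_ltn_trans KL; rewrite -sK (bigD1 i) //= leq_addr.
  pose f0 : {ffun 'I_N -> 'I_L} := [ffun i => Ordinal (XL i)].
  rewrite (bigD1 f0) /=; last by rewrite -sK; apply/eqP/eq_bigr => i _; rewrite ffunE.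
  rewrite big1 ?addr0 => [|f /andP[_ ff0]].
    by case: forallP => // -[] i; rewrite ffunE.
  case: forallP => // h; exfalso; move/eqP: ff0; apply.
  by apply/ffunP => i; apply: val_inj; rewrite ffunE /= (eqP (h i)).
under eq_integral do rewrite E -sumEFin.
under eq_integral do rewrite -big_filter.
rewrite ge0_integral_sum //.
- rewrite big_filter /conv_coef -sumEFin; apply: eq_bigr => f _.
  rewrite (@independent_integral_prod R _ _ T _ P _ (fun i => pair_rv (Xs i) (Ys i))
     (fun i => g (f i))) //; last by move=> i; rewrite Eg.
  by congr EFin; apply: eq_bigr => i _; rewrite Eg.
- move=> f; apply/measurable_EFinP; apply: measurable_prod => i _.
  exact: measurableT_comp.
- by move=> f w _; rewrite lee_fin; apply: prodr_ge0.
Qed.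

Lemma integral_fibers d (T : measurableType d) (mu : {measure set T -> \bar R})
    (Z : T -> nat) (f : T -> R) :
  measurable_fun setT Z -> measurable_fun setT f -> (forall w, 0 <= f w) ->
  (\int[mu]_w (f w)%:E = \sum_(k <oo) \int[mu]_(w in Z @^-1` [set k]) (f w)%:E)%E.
Proof.
move=> mZ mf f0.
have cover : [set: T] = \bigcup_k (Z @^-1` [set k]).
  by apply/seteqP; split => // w _; exists (Z w).
rewrite [in LHS]cover; apply: ge0_integral_bigcup.
- by move=> k; rewrite -[X in measurable X]setTI; apply: mZ.
- by rewrite -cover; apply/measurable_EFinP.
- by move=> w _; rewrite lee_fin.
- by move=> i j _ _ [w [/= <- <-]].
Qed.

Lemma ge0_integralZl_real d (T : measurableType d) (mu : {measure set T -> \bar R})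
    (c : R) (f : T -> R) : measurable_fun setT f -> (forall w, 0 <= f w) -> 0 <= c ->
  (\int[mu]_w (c * f w)%:E = c%:E * \int[mu]_w (f w)%:E)%E.
Proof.
move=> mf f0 c0; under eq_integral do rewrite EFinM.
apply: ge0_integralZl_EFin => //.
- by move=> w _; rewrite lee_fin.
- exact/measurable_EFinP.
Qed.

Section Tilted.
Context d d' (T : measurableType d) (T' : measurableType d').
Variables (P : probability T R) (X : T -> nat) (Y : T -> R) (xi : R).
Variables (P' : probability T' R) (X' : T' -> nat) (Y' : T' -> R).
Hypotheses (mX : measurable_fun setT X) (mY : measurable_fun setT Y).
Hypotheses (mX' : measurable_fun setT X') (mY' : measurable_fun setT Y').
Hypothesis tilt : tilted_vector P X Y xi P' X' Y'.

(** The definition of tilting only speaks of sets [{k} x A]. A measurable set of pairs is cut along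
    the fibres of the first coordinate, whose sections are such sets, and [integral_transfer] passes
    from sets to functions. *)
Lemma tilted_integral (g : nat * R -> R) :
  measurable_fun setT g -> (forall v, 0 <= g v) ->
  (\int[P']_w (g (X' w, Y' w))%:E =
   \int[P]_w (expR (- psi P (toR X) xi + (X w)%:R * xi) * g (X w, Y w))%:E)%E.
Proof.
move=> mg g0.
pose W w := expR (- psi P (toR X) xi + (X w)%:R * xi).
have mW : measurable_fun setT W.
  exact: (measurableT_comp (measurable_fun_nat
    (fun k => expR (- psi P (toR X) xi + k%:R * xi)))).
transitivity (\int[P']_w ((cst 1 : T' -> R) w * g (pair_rv X' Y' w))%:E)%E.
  by apply: eq_integral => w _; rewrite mul1r.
apply: (@integral_transfer R _ _ _ T' T _ P' P (cst 1) W (pair_rv X' Y') (pair_rv X Y)) => //.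
- by move=> w; exact: expR_ge0.
- exact: measurable_pair_rv.
- exact: measurable_pair_rv.
move=> C mC.
transitivity (\int[P']_w (\1_C (pair_rv X' Y' w))%:E)%E.
  by apply: eq_integral => w _; rewrite mul1r.
have mZ e (U : measurableType e) (Z : U -> nat) : measurable_fun setT Z ->
    forall k, measurable (Z @^-1` [set k]).
  by move=> mZ k; rewrite -[X in measurable X]setTI; apply: mZ.
have mYC e (U : measurableType e) (Z : U -> R) : measurable_fun setT Z ->
    forall k, measurable (Z @^-1` xsection C k).
  by move=> mZ0 k; rewrite -[X in measurable X]setTI; apply: mZ0 => //; exact: measurable_xsection.
have mC1 e (U : measurableType e) (V : U -> nat * R) : measurable_fun setT V ->
    measurable_fun setT (fun w => \1_C (V w) : R).
  by move=> mV; apply: measurableT_comp => //; apply: measurable_indic.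
rewrite (integral_fibers P' mX' (mC1 _ _ _ (measurable_pair_rv mX' mY'))) //.
rewrite (integral_fibers P mX) //; first last.
- by move=> w; rewrite mulr_ge0 ?expR_ge0.
- by apply: measurable_funM => //; exact/mC1/measurable_pair_rv.
apply: eq_eseriesr => k _.
transitivity (P' (X' @^-1` [set k] `&` Y' @^-1` xsection C k)).
  rewrite setIC -integral_indic //; [|exact: mZ|exact: mYC].
  apply: eq_integral => w; rewrite inE /= => Xk; congr EFin.
  by rewrite !indicE /pair_rv Xk; congr (nat_of_bool _)%:R; apply/idP/idP => /set_mem h; apply/mem_set; move: h; rewrite /= /xsection /= inE.
rewrite tilt; last exact: measurable_xsection.
rewrite setIC -integral_indic //; [|exact: mZ|exact: mYC].
rewrite -ge0_integralZl_EFin //; [|exact: mZ|].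
  apply: eq_integral => w; rewrite inE /= => Xk; rewrite -EFinM; congr EFin.
  rewrite /W !indicE /pair_rv Xk; congr (_ * (nat_of_bool _)%:R).
  by apply/idP/idP => /set_mem h; apply/mem_set; move: h; rewrite /= /xsection /= inE.
apply/measurable_EFinP; apply: measurable_funTS; apply: measurable_indic; exact: mYC.
Qed.

Lemma wgt_tilted (m u : R) (k : nat) :
  (\int[P]_w (expR (u * (Y w - m)))%:E < +oo)%E ->
  wgt P' X' Y' m u k =
  expR (- psi P (toR X) xi + k%:R * xi) * wgt P X Y m u k.
Proof.
move=> fin; pose g (v : nat * R) : R := expR (u * (v.2 - m)) * (v.1 == k)%:R.
have mg : measurable_fun setT g by exact: measurable_wgt_integrand.
have g0 v : 0 <= g v by rewrite mulr_ge0 ?expR_ge0.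
have mgV : measurable_fun setT (fun w => g (X w, Y w)).
  by apply: (measurableT_comp mg); exact: measurable_pair_rv.
rewrite /wgt [LHS]/Rintegral.
have -> := @tilted_integral g mg g0.
set c := expR (- psi P (toR X) xi + k%:R * xi).
have -> : (\int[P]_w (expR (- psi P (toR X) xi + (X w)%:R * xi) * g (X w, Y w))%:E =
    c%:E * \int[P]_w (g (X w, Y w))%:E)%E.
  rewrite -(ge0_integralZl_real P mgV (fun w => g0 _) (expR_ge0 _)).
  apply: eq_integral => w _; congr EFin; rewrite /g /c /=.
  by case: eqP => [->|_]; rewrite ?mulr0.
rewrite fineM // ge0_fin_numE; last by apply: integral_ge0 => w _; rewrite lee_fin.
apply: le_lt_trans fin; apply: ge0_le_integral => //.
- by move=> w _; rewrite lee_fin.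
- exact/measurable_EFinP.
- apply/measurable_EFinP; apply: measurableT_comp; first exact: measurable_expR.
  by apply: measurable_funM => //; apply: measurable_funB.
- by move=> w _; rewrite lee_fin /g /= ler_piMr ?expR_ge0 // lern1 leq_b1.
Qed.

End Tilted.
End Laplace.

(** * Estimates under an exponential moment bound *)

Section Domination.
Context {R : realType} d (T : measurableType d) (P : probability T R).
Variables (H : T -> R) (C : R).
Hypotheses (H0 : forall w, 0 <= H w) (mH : measurable_fun setT H).
Hypothesis HC : (\int[P]_w (H w)%:E <= C%:E)%E.
Implicit Types f g : T -> R.

(** Integrability certified by one fixed envelope [H] whose integral is at most [C]. The constant is
    existential because only linearity of the integral needs it; quantitative bounds go through
    [norm_Exp_le] and [norm_ExpB_le]. *)
Definition dominated f :=
  measurable_fun setT f /\ exists c, forall w, `|f w| <= c * H w.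

Lemma dominated_weight_integrable : P.-integrable setT (EFin \o H).
Proof.
apply/integrableP; split; first exact/measurable_EFinP.
apply: le_lt_trans (ltry C); apply: le_trans HC.
by apply: ge0_le_integral => //= [||w _]; rewrite ?ger0_norm //;
  do ?[exact/measurable_EFinP | apply/measurable_EFinP; exact: measurableT_comp].
Qed.

Lemma dominated_integrable f : dominated f -> P.-integrable setT (EFin \o f).
Proof.
move=> [mf [c fc]].
apply: (@le_integrable _ _ _ P setT measurableT (EFin \o f)
  (fun w => (`|c|)%:E * (H w)%:E)%E).
- exact/measurable_EFinP.
- move=> w _ /=; rewrite lee_fin [leRHS]ger0_norm ?mulr_ge0 //.
  by apply: le_trans (fc w) _; apply: ler_wpM2r => //; exact: ler_norm.
- by apply: integrableZl => //; exact: dominated_weight_integrable.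
Qed.

Lemma dominatedD f g : dominated f -> dominated g -> dominated (fun w => f w + g w).
Proof.
move=> [mf [c hc]] [mg [c' hc']]; split; first exact: measurable_funD.
by exists (c + c') => w; rewrite mulrDl; apply: le_trans (ler_normD _ _) (lerD _ _).
Qed.

Lemma dominatedZ (k : R) f : dominated f -> dominated (fun w => k * f w).
Proof.
move=> [mf [c hc]]; split; first exact: measurable_funM.
by exists (`|k| * c) => w; rewrite normrM -mulrA; apply: ler_wpM2l.
Qed.

Lemma dominatedB f g : dominated f -> dominated g -> dominated (fun w => f w - g w).
Proof.
move=> df dg; have := dominatedD df (dominatedZ (-1) dg).
by under [X in dominated X -> _]eq_fun do rewrite mulN1r.
Qed.

Lemma dominated_sum (I : Type) (s : seq I) (F : I -> T -> R) :
  (forall i, dominated (F i)) -> dominated (fun w => \sum_(i <- s) F i w).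
Proof.
move=> dF; elim: s => [|i s IH].
  under eq_fun do rewrite big_nil; split; first exact: measurable_cst.
  by exists 0 => w; rewrite normr0 mul0r.
by under eq_fun do rewrite big_cons; apply: dominatedD.
Qed.

Local Notation E f := (\int[P]_w f w).

Lemma ExpD f g : dominated f -> dominated g -> E (fun w => f w + g w) = E f + E g.
Proof. by move=> df dg; apply: RintegralD => //; apply: dominated_integrable. Qed.

Lemma ExpB f g : dominated f -> dominated g -> E (fun w => f w - g w) = E f - E g.
Proof. by move=> df dg; apply: RintegralB => //; apply: dominated_integrable. Qed.

Lemma ExpZ (k : R) f : dominated f -> E (fun w => k * f w) = k * E f.
Proof. by move=> df; apply: RintegralZl => //; apply: dominated_integrable. Qed.

Lemma Exp_cst (k : R) : E (fun=> k) = k.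
Proof.
have h : fine (P [set: T]) = 1 by rewrite probability_setT.
by rewrite Rintegral_cst // [X in k * X]h mulr1.
Qed.

Lemma Exp_sum (I : Type) (s : seq I) (F : I -> T -> R) :
  (forall i, dominated (F i)) ->
  E (fun w => \sum_(i <- s) F i w) = \sum_(i <- s) E (F i).
Proof.
move=> dF; elim: s => [|i s IH].
  by under eq_Rintegral do rewrite big_nil; rewrite Exp_cst big_nil.
under eq_Rintegral do rewrite big_cons.
by rewrite ExpD ?IH ?big_cons //; apply: dominated_sum.
Qed.

Lemma le_Exp f g : dominated f -> dominated g -> (forall w, f w <= g w) -> E f <= E g.
Proof. by move=> df dg fg; apply: le_Rintegral => // ; apply: dominated_integrable. Qed.

Lemma norm_Exp_le (c : R) f : measurable_fun setT f -> 0 <= c ->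
  (forall w, `|f w| <= c * H w) -> `|E f| <= c * C.
Proof.
move=> mf c0 fc; have df : dominated f by split => //; exists c.
apply: (@le_trans _ _ (E (fun w => `|f w|))).
  by apply: le_normr_Rintegral => //; apply: dominated_integrable.
have dH : dominated H by split => //; exists 1 => w; rewrite mul1r ger0_norm.
apply: (@le_trans _ _ (E (fun w => c * H w))).
  apply: le_Exp => //; last exact: dominatedZ.
  split; first exact: measurableT_comp.
  by exists c => w; rewrite normr_id.
rewrite ExpZ //; apply: ler_wpM2l => //.
rewrite -lee_fin /Rintegral fineK //; apply: integrable_fin_num => //.
exact: dominated_weight_integrable.
Qed.

Lemma norm_ExpB_le (c : R) f g : dominated f -> dominated g -> 0 <= c ->
  (forall w, `|f w - g w| <= c * H w) -> `|E f - E g| <= c * C.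
Proof.
move=> df dg c0 fg; rewrite -ExpB //; apply: norm_Exp_le => //.
by case: df => mf _; case: dg => mg _; apply: measurable_funB.
Qed.

End Domination.

Section PowExp.
Context {R : realType}.
Variable eta : R.
Hypotheses (eta0 : 0 < eta) (eta1 : eta <= 1).

(** [3! (4 / eta)^3], the constant of [s^j <= j! (4 / eta)^j e^{eta s / 4}] at [j = 3]; as
    [eta <= 1] it serves every smaller [j] as well. *)
Definition Kexp : R := 6 * (4 / eta) ^+ 3.

Lemma Kexp_ge1 : 1 <= Kexp.
Proof.
have e1 := eta1; have h : 1 <= 4 / eta by rewrite ler_pdivlMr //; lra.
have : 1 <= (4 / eta) ^+ 3 by rewrite exprn_ege1.
by rewrite /Kexp; lra.
Qed.

Lemma Kexp_ge0 : 0 <= Kexp. Proof. exact: le_trans Kexp_ge1. Qed.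

(** One quarter of the exponent pays for the power of [s], another for the tilt e^{rs}. The
    remaining half is kept in reserve for the truncation at level [L]. *)
Lemma pow_expR_le (j : nat) (r s : R) : (j <= 3)%N -> 0 <= s -> r <= eta / 4 ->
  s ^+ j * expR (r * s) <= Kexp * expR (eta / 2 * s).
Proof.
move=> j3 s0 r1.
have -> : expR (eta / 2 * s) = expR (eta / 4 * s) * expR (eta / 4 * s).
  by rewrite -expRD; congr expR; lra.
rewrite mulrA; apply: ler_pM; rewrite ?exprn_ge0 ?expR_ge0 //; last first.
  by rewrite ler_expR ler_wpM2r.
have y0 : 0 <= eta / 4 * s by rewrite mulr_ge0 // divr_ge0 // ltW.
case: j j3 => [|j] j3.
  rewrite expr0 -[leLHS]mulr1; apply: ler_pM => //; first exact: Kexp_ge1.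
  by rewrite -[leLHS]expR0 ler_expR.
have := expR_ge1Dxn j y0; set e := expR _ => h.
have f0 : 0 < (j.+1)`!%:R :> R by rewrite ltr0n fact_gt0.
have f6 : (j.+1)`!%:R <= 6 :> R.
  by case: j j3 {h f0} => [|[|[|]]] // _; rewrite ler_nat.
have e1 := eta1; have q1 : 1 <= 4 / eta by rewrite ler_pdivlMr //; lra.
have h1 : (eta / 4 * s) ^+ j.+1 <= (j.+1)`!%:R * e.
  by rewrite -ler_pdivrMl // [leLHS]mulrC; apply: le_trans h; rewrite lerDr.
have -> : s ^+ j.+1 = (4 / eta) ^+ j.+1 * (eta / 4 * s) ^+ j.+1.
  by rewrite -exprMn; congr (_ ^+ _); field; rewrite gt_eqF.
have -> : Kexp * e = (4 / eta) ^+ 3 * (6 * e) by rewrite /Kexp; ring.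
apply: ler_pM; rewrite ?exprn_ge0 //.
- by rewrite divr_ge0 // ltW.
- by apply: ler_weXn2l.
- by apply: le_trans h1 _; rewrite ler_wpM2r // expR_ge0.
Qed.

End PowExp.

(** * Taylor expansions of tilted expectations, with truncation *)

Section MomentBounds.
Context {R : realType} d (T : measurableType d) (P : probability T R).
Variables (X : T -> nat) (Y : T -> R) (x m eta C : R).
Hypotheses (mX : measurable_fun setT X) (mY : measurable_fun setT Y).
Hypotheses (eta0 : 0 < eta) (eta1 : eta <= 1).

Let U w : R := (X w)%:R - x.
Let V w : R := Y w - m.
Let S w := `|U w| + `|V w|.
Let H w := expR (eta * S w).
Hypothesis HC : (\int[P]_w (H w)%:E <= C%:E)%E.

Local Notation Kexp := (Kexp eta).
Let Kexp0 : 0 <= Kexp. Proof. exact: Kexp_ge0. Qed.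
Let S0 w : 0 <= S w. Proof. by rewrite addr_ge0. Qed.
Let H0 w : 0 <= H w. Proof. exact: expR_ge0. Qed.

Let mU : measurable_fun setT U.
Proof.
by apply: measurable_funB => //; exact: (measurableT_comp (measurable_fun_nat (fun k => k%:R : R))).
Qed.
Let mV : measurable_fun setT V. Proof. exact: measurable_funB. Qed.
Let mH : measurable_fun setT H.
Proof.
apply: measurableT_comp; first exact: measurable_expR.
apply: measurable_funM => //; apply: measurable_funD; exact: measurableT_comp.
Qed.

Let halfH w : expR (eta / 2 * S w) <= H w.
Proof.
rewrite ler_expR; apply: ler_wpM2r => //.
by rewrite ler_pdivrMr // ler_peMr ?ler1n // ltW.
Qed.

Section Fixed.
Variables (h u r : R).
Hypotheses (hr : `|h| <= r) (ur : `|u| <= r) (r4 : r <= eta / 4).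

Let Z w := h * U w + u * V w.

Let r0 : 0 <= r. Proof. exact: le_trans hr. Qed.

Let normZ w : `|Z w| <= r * S w.
Proof.
apply: le_trans (ler_normD _ _) _; rewrite !normrM mulrDr.
by apply: lerD; apply: ler_wpM2r.
Qed.

Let mZ : measurable_fun setT Z.
Proof. by apply: measurable_funD; exact: measurable_funM. Qed.

Let meZ : measurable_fun setT (fun w => expR (Z w)).
Proof. by apply: measurableT_comp; first exact: measurable_expR. Qed.

Let eZ w : expR (Z w) <= expR (r * S w).
Proof. by rewrite ler_expR (le_trans (ler_norm _)). Qed.

Let normU w : `|U w| <= S w. Proof. by rewrite lerDl. Qed.
Let normV w : `|V w| <= S w. Proof. by rewrite lerDr. Qed.

Let SH (j : nat) (c : R) w : (j <= 3)%N -> 0 <= c ->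
  c * (S w ^+ j * expR (r * S w)) <= c * Kexp * H w.
Proof.
move=> j3 c0; rewrite -mulrA; apply: ler_wpM2l => //.
by apply: le_trans (pow_expR_le eta0 eta1 j3 (S0 w) r4) _; apply: ler_wpM2l.
Qed.

Lemma dominated_poly (f : T -> R) (j : nat) (c : R) : (j <= 3)%N -> 0 <= c ->
  measurable_fun setT f -> (forall w, `|f w| <= c * S w ^+ j) ->
  dominated H (fun w => f w * expR (Z w)) /\
  dominated H f /\ `| \int[P]_w (f w * expR (Z w)) | <= c * Kexp * C.
Proof.
move=> j3 c0 mf fc.
have B w : `|f w * expR (Z w)| <= c * Kexp * H w.
  apply: le_trans (SH w j3 c0); rewrite normrM (ger0_norm (expR_ge0 _)) mulrA.
  by apply: ler_pM => //; rewrite expR_ge0.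
split; [|split].
- by split; [exact: measurable_funM|exists (c * Kexp)].
- split => //; exists (c * Kexp) => w; apply: le_trans (fc w) _.
  apply: le_trans (SH w j3 c0); apply: ler_wpM2l => //.
  by rewrite ler_peMr ?exprn_ge0 // -[leLHS]expR0 ler_expR mulr_ge0.
- by apply: (norm_Exp_le H0 mH HC) => //; [exact: measurable_funM|exact: mulr_ge0].
Qed.

Lemma dominated_expZ : dominated H (fun w => expR (Z w)).
Proof.
have B w : `|(cst 1 : T -> R) w| <= 1 * S w ^+ 0 by rewrite normr1 expr0 mulr1.
have [+ _] := @dominated_poly (cst 1) 0 1 isT ler01 (@measurable_cst _ _ T R setT 1) B.
by under [X in dominated _ X -> _]eq_fun do rewrite mul1r.
Qed.

Hypotheses (EU : \int[P]_w U w = 0) (EV : \int[P]_w V w = 0).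

Let dU : dominated H U.
Proof.
have B w : `|U w| <= 1 * S w ^+ 1 by rewrite mul1r.
by have [_ []] := @dominated_poly U 1 1 isT ler01 mU B.
Qed.
Let dV : dominated H V.
Proof.
have B w : `|V w| <= 1 * S w ^+ 1 by rewrite mul1r.
by have [_ []] := @dominated_poly V 1 1 isT ler01 mV B.
Qed.

Lemma dominated_mul2 (f g : T -> R) : measurable_fun setT f -> measurable_fun setT g ->
  (forall w, `|f w| <= S w) -> (forall w, `|g w| <= S w) ->
  dominated H (fun w => f w * g w).
Proof.
move=> mf mg fS gS.
have [] := @dominated_poly (fun w => f w * g w) 2 1 isT ler01; last by move=> _ [].
- exact: measurable_funM.
- by move=> w; rewrite mul1r normrM expr2; apply: ler_pM.
Qed.

Lemma norm_Exp_mul2_le (f g : T -> R) : measurable_fun setT f -> measurable_fun setT g ->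
  (forall w, `|f w| <= S w) -> (forall w, `|g w| <= S w) ->
  `|\int[P]_w (f w * g w)| <= Kexp * C.
Proof.
move=> mf mg fS gS; apply: (norm_Exp_le H0 mH HC) => //; first exact: measurable_funM.
move=> w; rewrite -[Kexp]mul1r; apply: le_trans (SH w (isT : (2 <= 3)%N) ler01).
rewrite mul1r normrM; apply: (@le_trans _ _ (S w ^+ 2)).
  by rewrite expr2; apply: ler_pM.
by rewrite ler_peMr ?exprn_ge0 // -[leLHS]expR0 ler_expR mulr_ge0.
Qed.

Lemma Exp_sqrZ : \int[P]_w (Z w ^+ 2) = h ^+ 2 * \int[P]_w (U w * U w) +
  2 * h * u * \int[P]_w (U w * V w) + u ^+ 2 * \int[P]_w (V w * V w).
Proof.
have dUU := dominated_mul2 mU mU normU normU.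
have dUV := dominated_mul2 mU mV normU normV.
have dVV := dominated_mul2 mV mV normV normV.
under eq_Rintegral => w _.
  have -> : Z w ^+ 2 = h ^+ 2 * (U w * U w) + 2 * h * u * (U w * V w) +
    u ^+ 2 * (V w * V w) by rewrite /Z; ring.
  over.
have D1 := dominatedZ (h ^+ 2) dUU; have D2 := dominatedZ (2 * h * u) dUV.
have D3 := dominatedZ (u ^+ 2) dVV.
rewrite (ExpD H0 mH HC (dominatedD D1 D2) D3) (ExpD H0 mH HC D1 D2).
by rewrite !(ExpZ H0 mH HC).
Qed.

(** The linear term vanishes since [U] and [V] are centred, and [|Z| <= r S] turns the cubic
    remainder into [r^3 S^3 e^{r S}], which the envelope dominates. *)
Lemma Exp_expZ_taylor :
  `|\int[P]_w expR (Z w) - (1 + (\int[P]_w (Z w ^+ 2)) / 2)| <= r ^+ 3 * Kexp * C.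
Proof.
have dZ : dominated H Z by apply: dominatedD; apply: dominatedZ.
have dZ2 : dominated H (fun w => Z w ^+ 2).
  have [] := @dominated_poly (fun w => Z w ^+ 2) 2 (r ^+ 2) isT (sqr_ge0 _).
  - exact: measurable_funX.
  - by move=> w; rewrite normrX -exprMn lerXn2r // nnegrE mulr_ge0.
  - by move=> _ [].
have d1 : dominated H (fun=> 1).
  split; first exact: measurable_cst.
  by exists 1 => w; rewrite normr1 mul1r -[leLHS]expR0 ler_expR mulr_ge0 // ltW.
have EZ : \int[P]_w Z w = 0.
  by rewrite (ExpD H0 mH HC) ?(ExpZ H0 mH HC) ?EU ?EV ?mulr0 ?addr0 //; apply: dominatedZ.
have -> : 1 + (\int[P]_w (Z w ^+ 2)) / 2 =
    \int[P]_w (1 + Z w + 2^-1 * Z w ^+ 2).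
  have D2 := dominatedZ 2^-1 dZ2.
  rewrite (ExpD H0 mH HC (dominatedD d1 dZ) D2) (ExpD H0 mH HC d1 dZ).
  by rewrite EZ Exp_cst (ExpZ H0 mH HC) // addr0 mulrC.
apply: (norm_ExpB_le H0 mH HC).
- exact: dominated_expZ.
- by apply: dominatedD; [exact: dominatedD|exact: dominatedZ].
- by rewrite mulr_ge0 ?exprn_ge0.
move=> w; apply: (@le_trans _ _ (`|Z w| ^+ 3 * expR `|Z w|)).
  apply: le_trans (norm_expR_taylor2_le _); rewrite le_eqVlt; apply/orP; left.
  by apply/eqP; congr `|_|; field.
apply: le_trans (SH w (isT : (3 <= 3)%N) (exprn_ge0 3 r0)); rewrite mulrA -exprMn.
apply: ler_pM; rewrite ?exprn_ge0 ?expR_ge0 ?ler_expR //.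
by apply: lerXn2r; rewrite ?nnegrE // mulr_ge0.
Qed.

Lemma Exp_U_expZ_taylor :
  `|\int[P]_w (U w * expR (Z w)) -
    (h * \int[P]_w (U w * U w) + u * \int[P]_w (U w * V w))| <= r ^+ 2 * Kexp * C.
Proof.
have dUU := dominated_mul2 mU mU normU normU.
have dUV := dominated_mul2 mU mV normU normV.
have D1 := dominatedZ h dUU; have D2 := dominatedZ u dUV.
have -> : h * \int[P]_w (U w * U w) + u * \int[P]_w (U w * V w) =
    \int[P]_w (U w + (h * (U w * U w) + u * (U w * V w))).
  rewrite (ExpD H0 mH HC dU (dominatedD D1 D2)) EU add0r (ExpD H0 mH HC D1 D2).
  by rewrite !(ExpZ H0 mH HC).
apply: (norm_ExpB_le H0 mH HC).
- have [] // := @dominated_poly U 1 1 isT ler01 mU; by move=> w; rewrite mul1r.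
- by apply: dominatedD => //; exact: dominatedD.
- by rewrite mulr_ge0 ?exprn_ge0.
move=> w; apply: (@le_trans _ _ (`|U w| * (`|Z w| ^+ 2 * expR `|Z w|))).
  have -> : U w * expR (Z w) - (U w + (h * (U w * U w) + u * (U w * V w))) =
    U w * (expR (Z w) - 1 - Z w) by rewrite /Z; ring.
  by rewrite normrM; apply: ler_wpM2l => //; exact: norm_expR_taylor1_le.
apply: le_trans (SH w (isT : (3 <= 3)%N) (exprn_ge0 2 r0)).
have -> : r ^+ 2 * (S w ^+ 3 * expR (r * S w)) =
  S w * ((r * S w) ^+ 2 * expR (r * S w)) by ring.
apply: ler_pM => //.
apply: ler_pM; rewrite ?exprn_ge0 ?expR_ge0 ?ler_expR //.
by apply: lerXn2r; rewrite ?nnegrE // mulr_ge0.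
Qed.

Let meV : measurable_fun setT (fun w => expR (u * V w)).
Proof. by apply: measurableT_comp; [exact: measurable_expR|exact: measurable_funM]. Qed.

Let mXk (k : nat) : measurable_fun setT (fun w => (X w == k)%:R : R).
Proof. exact: (measurableT_comp (measurable_fun_nat (fun j => (j == k)%:R : R))). Qed.

Let dwgt (k : nat) : dominated H (fun w => expR (u * V w) * (X w == k)%:R).
Proof.
split; first exact: measurable_funM.
exists 1 => w; rewrite mul1r ger0_norm ?mulr_ge0 ?expR_ge0 //.
apply: (@le_trans _ _ (expR (u * V w))).
  by rewrite ler_piMr ?expR_ge0 // lern1 leq_b1.
rewrite ler_expR; apply: (@le_trans _ _ (r * S w)).
  by apply: le_trans (ler_norm _) _; rewrite normrM; apply: ler_pM.
apply: ler_wpM2r => //; apply: le_trans r4 _.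
by rewrite ler_pdivrMr // ler_peMr ?ler1n // ltW.
Qed.

Lemma sum_wgt (L : nat) (phi : nat -> R) :
  \sum_(k < L) wgt P X Y m u k * phi k =
  \int[P]_w (expR (u * V w) * (phi (X w) * (X w < L)%:R)).
Proof.
rewrite /wgt; under eq_bigr do rewrite mulrC -(ExpZ H0 mH HC _ (dwgt _)).
rewrite -(@Exp_sum _ _ _ _ _ _ H0 mH HC); last by move=> k; apply: dominatedZ.
apply: eq_Rintegral => w _.
have [XL|XL] := ltnP (X w) L.
  rewrite (bigD1 (Ordinal XL)) //= eqxx big1 => [|k /negbTE kX]; first by rewrite !mulr1 addr0 mulrC.
  suff -> : (X w == k) = false by rewrite !mulr0.
  by apply/negbTE; apply/eqP => E; move/negbT/eqP: kX; apply; apply: val_inj.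
rewrite big1 ?mulr0 // => k _.
by rewrite gtn_eqF ?mulr0 //; apply: leq_trans (ltn_ord k) XL.
Qed.

Let mtrunc (L : nat) : measurable_fun setT (fun w => (X w < L)%:R : R).
Proof. exact: (measurableT_comp (measurable_fun_nat (fun j => (j < L)%:R : R))). Qed.

(** Where [X >= L] one has [S >= L - |x|], so the half exponent kept in reserve by [pow_expR_le]
    yields this factor. It tends to 0 as [L] grows, at no cost elsewhere. *)
Definition tail_bound (L : nat) : R :=
  Kexp * expR (- (eta / 2 * (L%:R - `|x|))) * C.

Lemma trunc_error (f : T -> R) (L : nat) (j : nat) : (j <= 3)%N ->
  measurable_fun setT f -> (forall w, `|f w| <= S w ^+ j) ->
  `|\int[P]_w (f w * expR (Z w) * (X w < L)%:R) - \int[P]_w (f w * expR (Z w))|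
  <= tail_bound L.
Proof.
move=> j3 mf fS.
have [] := @dominated_poly f j 1 j3 ler01 mf.
  by move=> w; rewrite mul1r.
move=> df _; apply: (norm_ExpB_le H0 mH HC) => //.
- case: (df) => mfe [c hc]; split; first exact: measurable_funM.
  exists `|c| => w; rewrite normrM; apply: (@le_trans _ _ (`|f w * expR (Z w)|)).
    by rewrite ler_piMr // ger0_norm // lern1 leq_b1.
  by apply: le_trans (hc w) _; apply: ler_wpM2r => //; exact: ler_norm.
- by rewrite mulr_ge0 ?expR_ge0.
move=> w; have [XL|XL] := ltnP (X w) L.
  by rewrite mulr1 subrr normr0; do 2?apply: mulr_ge0 => //; exact: expR_ge0.
rewrite mulr0 sub0r normrN normrM (ger0_norm (expR_ge0 _)).
apply: (@le_trans _ _ (S w ^+ j * expR (r * S w))).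
  by apply: ler_pM; rewrite ?expR_ge0.
apply: le_trans (pow_expR_le eta0 eta1 j3 (S0 w) r4) _.
rewrite -[leRHS]mulrA; apply: ler_wpM2l => //; rewrite -expRD ler_expR.
have LS : L%:R - `|x| <= S w.
  apply: le_trans (normU w); apply: le_trans (ler_norm _).
  by apply: lerB; [rewrite ler_nat|exact: ler_norm].
have e2 : 0 <= eta / 2 by rewrite divr_ge0 // ltW.
have := ler_wpM2l e2 LS; lra.
Qed.

Lemma sum_tilted_wgt (f : T -> R) (phi : nat -> R) (L : nat) :
  (forall w, f w = phi (X w)) ->
  \sum_(k < L) wgt P X Y m u k * expR (h * (k%:R - x)) * phi k =
  \int[P]_w (f w * expR (Z w) * (X w < L)%:R).
Proof.
move=> fphi; under eq_bigr do rewrite -mulrA.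
rewrite (sum_wgt L (fun k => expR (h * (k%:R - x)) * phi k)).
by apply: eq_Rintegral => w _; rewrite fphi /Z expRD; ring.
Qed.

Lemma sum_tilted_wgt_bounds (L : nat) :
  let W k := wgt P X Y m u k * expR (h * (k%:R - x)) in
  let q := 1 + (\int[P]_w (Z w ^+ 2)) / 2 in
  [/\ \sum_(k < L) W k <= q + r ^+ 3 * Kexp * C,
      q - r ^+ 3 * Kexp * C - tail_bound L <= \sum_(k < L) W k,
      `|\sum_(k < L) W k * (k%:R - x) -
        (h * \int[P]_w (U w * U w) + u * \int[P]_w (U w * V w))|
        <= r ^+ 2 * Kexp * C + tail_bound L,
      \sum_(k < L) W k * (k%:R - x) ^+ 2 <= Kexp * C &
      \sum_(k < L) W k * `|k%:R - x| ^+ 3 <= Kexp * C].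
Proof.
move=> W q.
have W1 : \sum_(k < L) W k = \int[P]_w ((cst 1 : T -> R) w * expR (Z w) * (X w < L)%:R).
  rewrite -(@sum_tilted_wgt _ (fun=> 1)) //.
  by apply: eq_bigr => k _; rewrite mulr1.
have eq1 : \int[P]_w ((cst 1 : T -> R) w * expR (Z w)) = \int[P]_w expR (Z w).
  by apply: eq_Rintegral => w _; rewrite mul1r.
have m1 := @measurable_cst _ _ T R setT 1.
have t0 := @trunc_error (cst 1) L 0 isT m1 (fun w => ltac:(by rewrite normr1 expr0)).
have ty := Exp_expZ_taylor.
rewrite eq1 in t0.
have posE j : (j <= 3)%N -> (forall (g : T -> R), measurable_fun setT g ->
    (forall w, 0 <= g w <= S w ^+ j) ->
    \int[P]_w (g w * expR (Z w) * (X w < L)%:R) <= Kexp * C).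
  move=> j3 g mg gS.
  have gn w : `|g w| <= 1 * S w ^+ j.
    by rewrite mul1r; have /andP[g0 g1] := gS w; rewrite ger0_norm.
  have [[mge [c hc]] [_ B]] := @dominated_poly g j 1 j3 ler01 mg gn.
  rewrite mul1r in B; apply: le_trans B; apply: le_trans (ler_norm _).
  have dg : dominated H (fun w => g w * expR (Z w)) by split => //; exists c.
  apply: (le_Exp H0 mH HC) => //.
    split; first exact: measurable_funM.
    exists `|c| => w; rewrite normrM; apply: (@le_trans _ _ (`|g w * expR (Z w)|)).
      by rewrite ler_piMr // ger0_norm // lern1 leq_b1.
    by apply: le_trans (hc w) _; apply: ler_wpM2r => //; exact: ler_norm.
  move=> w; rewrite ler_piMr ?lern1 ?leq_b1 // mulr_ge0 ?expR_ge0 //.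
  by case/andP: (gS w).
(* Truncation only lowers a nonnegative integrand, so the upper estimate carries no tail term. *)
have tr1 : \sum_(k < L) W k <= \int[P]_w expR (Z w).
  rewrite W1 -eq1.
  have [D [_ _]] := @dominated_poly (cst 1) 0 1 isT ler01 m1 (fun w => ltac:(by rewrite normr1 mul1r expr0)).
  apply: (le_Exp H0 mH HC) => //.
    case: D => mfe [c hc]; split; first exact: measurable_funM.
    exists `|c| => w; rewrite normrM; apply: (@le_trans _ _ (`|(cst 1 : T -> R) w * expR (Z w)|)).
      by rewrite ler_piMr // ger0_norm // lern1 leq_b1.
    by apply: le_trans (hc w) _; apply: ler_wpM2r => //; exact: ler_norm.
  by move=> w; rewrite ler_piMr ?lern1 ?leq_b1 // mul1r expR_ge0.
split.
- apply: le_trans tr1 _; move: ty; rewrite ler_norml -/q => /andP[_]; lra.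
- rewrite W1; move: ty t0; rewrite !ler_norml -/q => /andP[h1 _] /andP[h2 _]; lra.
- have -> : \sum_(k < L) W k * (k%:R - x) = \int[P]_w (U w * expR (Z w) * (X w < L)%:R).
    exact: (@sum_tilted_wgt U (fun k => k%:R - x) L (fun=> erefl)).
  have t1 := @trunc_error U L 1 isT mU normU.
  have := Exp_U_expZ_taylor.
  move: t1; set I1 := \int[P]_w (U w * expR (Z w) * _); set I2 := \int[P]_w (U w * expR (Z w)).
  move=> t1 t2; have -> (b : R) : I1 - b = (I1 - I2) + (I2 - b) by ring.
  by apply: le_trans (ler_normD _ _) _; rewrite addrC lerD.
- rewrite (@sum_tilted_wgt (fun w => U w ^+ 2) (fun k => (k%:R - x) ^+ 2)) //.
  apply: (posE 2) => //; first exact: measurable_funX.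
  by move=> w; rewrite sqr_ge0 -[U w ^+ 2]real_normK ?num_real // lerXn2r ?nnegrE.
- rewrite (@sum_tilted_wgt (fun w => `|U w| ^+ 3) (fun k => `|k%:R - x| ^+ 3)) //.
  apply: (posE 3) => //; first by apply: measurable_funX; exact: measurableT_comp.
  by move=> w; rewrite exprn_ge0 //= lerXn2r ?nnegrE.
Qed.

(** The factor e^{uV} is within [|u V| e^{|u V|}] of 1, so a small tilt takes at most a multiple of
    [r] from each atom; this keeps finitely many atoms above a fixed mass. *)
Lemma wgt_lower (k : nat) : fine (P (X @^-1` [set k])) - r * Kexp * C <= wgt P X Y m u k.
Proof.
have mk : measurable (X @^-1` [set k]) by rewrite -[X in measurable X]setTI; apply: mX.
have d1 : dominated H (fun w => (X w == k)%:R).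
  split => //; exists 1 => w; rewrite mul1r ger0_norm //.
  apply: (@le_trans _ _ 1); first by rewrite lern1 leq_b1.
  by rewrite -[leLHS]expR0 ler_expR mulr_ge0 // ltW.
have -> : fine (P (X @^-1` [set k])) = \int[P]_w ((X w == k)%:R).
  rewrite /Rintegral; congr fine; rewrite -[in LHS](setIT (X @^-1` [set k])) -integral_indic //.
  apply: eq_integral => w _; congr EFin; rewrite indicE; congr (nat_of_bool _)%:R.
  by apply/idP/eqP => [/set_mem //|Xk]; apply/mem_set.
suff : `|wgt P X Y m u k - \int[P]_w ((X w == k)%:R)| <= r * Kexp * C.
  by rewrite ler_norml => /andP[]; lra.
apply: (norm_ExpB_le H0 mH HC) => //; first by rewrite mulr_ge0.
move=> w; rewrite -{2}[(X w == k)%:R]mul1r -mulrBl normrM.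
apply: (@le_trans _ _ `|expR (u * V w) - 1|).
  by rewrite ler_piMr // ger0_norm // lern1 leq_b1.
apply: le_trans (norm_expR_sub1_le _) _.
have uV : `|u * V w| <= r * S w by rewrite normrM; apply: ler_pM.
apply: le_trans (SH w (isT : (1 <= 3)%N) r0); rewrite expr1 mulrA.
by apply: ler_pM; rewrite ?expR_ge0 ?ler_expR.
Qed.

End Fixed.
End MomentBounds.

(** * Asymptotics of the Laplace coefficients *)

Lemma sandwich_le {R : realType} (l v A A' e f t : R) :
  0 <= A -> 0 <= A' -> 0 <= e -> 0 <= f -> 0 <= t ->
  l <= A + (v + e * t) -> - A' + (v - e * t - 2 * f * t) <= l ->
  `|l - v| <= (A + A' + e + 2 * f) * (1 + t).
Proof.
move=> A0 A'0 e0 f0 t0 h1 h2.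
have p1 : 0 <= A * t by rewrite mulr_ge0.
have p2 : 0 <= A' * t by rewrite mulr_ge0.
have p3 : 0 <= e * t by rewrite mulr_ge0.
have p4 : 0 <= f * t by rewrite mulr_ge0.
by rewrite ler_norml; apply/andP; split; lra.
Qed.

Section SmallTilt.
Context {R : realType} d (T : measurableType d) (P : probability T R).
Variables (X : T -> nat) (Y : T -> R) (x m eta C s0 delta X0 lam rho c0 : R).
Variables (n0 N K L : nat) (A : set nat).
Let B := Kexp eta * C.
Let U w : R := (X w)%:R - x.
Let V w : R := Y w - m.
Let s2 := \int[P]_w (U w * U w).
Let gam := \int[P]_w (U w * V w).
Let bet := \int[P]_w (V w * V w).
Let u := lam * rho.
Let alpha2 := bet - gam ^+ 2 / s2.
(** [D rho] bounds every tilt in use: the last summand covers [u], the first one makes the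
    derivative of [Z] change sign on [[- D rho, D rho]]. Below, [A2] bounds [alpha2], [E3] is the
    remainder of [Z] in units of [rho^3] (its 1 pays for the truncation), and [E4 rho^2] bounds
    [yy]. *)
Let D := (`|lam| * B + 1) / s0 + `|lam|.
Let A2 := B + B ^+ 2 / s0.
Let E3 := D ^+ 3 * B + 1.
Let E4 := lam ^+ 2 * A2 + E3.
Let W h k := wgt P X Y m u k * expR (h * (k%:R - x)).
Let Z h := \sum_(k < L) W h k.

Hypotheses (mX : measurable_fun setT X) (mY : measurable_fun setT Y).
Hypotheses (eta0 : 0 < eta) (eta1 : eta <= 1) (C1 : 1 <= C).
Hypothesis HC : (\int[P]_w (expR (eta * (`|(X w)%:R - x| + `|Y w - m|)))%:E <= C%:E)%E.
Hypotheses (EU : \int[P]_w U w = 0) (EV : \int[P]_w V w = 0).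
Hypotheses (s00 : 0 < s0) (s0s2 : s0 <= s2) (delta0 : 0 < delta) (xX0 : `|x| <= X0).
Hypothesis HA : forall k, (k < n0)%N -> A k -> delta <= fine (P (X @^-1` [set k])).
(** [rhoE] keeps all tilts inside the exponential moments, [rho2] brackets the saddle, [rho3] gives
    [Z <= 2], [rho4] gives [Z >= 1 / 2], and [rho5], [rho6] keep the tilted weights of the atoms
    below [n0] above [delta / 4]. *)
Hypotheses (rho0 : 0 < rho) (rho1 : rho <= 1) (rhoE : D * rho <= eta / 4).
Hypothesis rho2 : (D ^+ 2 * B + 1) * rho <= 1.
Hypothesis rho3 : (2 * D ^+ 2 * B + E3) * rho <= 1.
Hypothesis rho4 : E4 * rho <= 1 / 2.
Hypothesis rho5 : D * rho * B <= delta / 2.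
Hypothesis rho6 : D * rho * (n0%:R + X0) <= 1 / 2.
Hypothesis tailL : tail_bound x eta C L <= rho ^+ 3.
Hypothesis n0L : (n0 <= L)%N.
Hypothesis c00 : 0 < c0.
Hypothesis HS : forall (L : nat) (W : nat -> R) (delta : R),
    (n0 <= L)%N -> (forall k, 0 <= W k) -> 0 <= delta ->
    (forall k, (k < n0)%N -> A k -> delta <= W k) ->
    forall t, 0 <= t <= pi -> c0 * delta ^+ 2 * t ^+ 2 <=
      \sum_(k < L) \sum_(l < L) W k * W l * (1 - cos (t * (k%:R - l%:R))).

Let B1 : 1 <= B.
Proof.
have K1 := Kexp_ge1 eta0 eta1; rewrite -[leLHS]mulr1; exact: ler_pM.
Qed.
Let B0 : 0 <= B. Proof. exact: le_trans B1. Qed.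
Let lB0 : 0 <= (`|lam| * B + 1) / s0.
Proof.
apply: divr_ge0; last exact: ltW.
by apply: addr_ge0 => //; exact: mulr_ge0.
Qed.
Let D0 : 0 <= D. Proof. exact: addr_ge0. Qed.
Let lamD : `|lam| <= D. Proof. by rewrite lerDr. Qed.
Let uD : `|u| <= D * rho.
Proof. by rewrite normrM (gtr0_norm rho0); apply: ler_wpM2r => //; exact: ltW. Qed.

Let mU : measurable_fun setT U.
Proof.
apply: measurable_funB => //.
exact: (measurableT_comp (measurable_fun_nat (fun k => k%:R : R))).
Qed.
Let mV : measurable_fun setT V. Proof. exact: measurable_funB. Qed.
Let US w : `|U w| <= `|U w| + `|V w|. Proof. by rewrite lerDl. Qed.
Let VS w : `|V w| <= `|U w| + `|V w|. Proof. by rewrite lerDr. Qed.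
Let mul2 := @norm_Exp_mul2_le R _ T P X Y x m eta C mX mY eta0 eta1 HC 0 0
  (eq_ind_r (fun y => y <= 0) (lexx 0) (normr0 R)) (divr_ge0 (ltW eta0) (ler0n R 4)).
Let gamB : `|gam| <= B. Proof. exact: mul2 mU mV US VS. Qed.
Let s2B : s2 <= B.
Proof. by apply: le_trans (ler_norm _) _; exact: mul2 mU mU US US. Qed.
Let betB : `|bet| <= B. Proof. exact: mul2 mV mV VS VS. Qed.

Let s20 : 0 < s2. Proof. exact: lt_le_trans s0s2. Qed.

Lemma norm_alpha2_le : `|alpha2| <= A2.
Proof.
apply: le_trans (ler_normB _ _) _; apply: lerD => //.
rewrite ger0_norm ?divr_ge0 ?sqr_ge0 ?(ltW s20) //.
have g2 : gam ^+ 2 <= B ^+ 2.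
  by rewrite -[gam ^+ 2]real_normK ?num_real //; apply: lerXn2r; rewrite ?nnegrE.
by apply: ler_pM; rewrite ?sqr_ge0 ?invr_ge0 ?(ltW s20) // lef_pV2 ?posrE.
Qed.

Let q h := 1 + (h ^+ 2 * s2 + 2 * h * u * gam + u ^+ 2 * bet) / 2.

Lemma tilt_bounds h : `|h| <= D * rho ->
  [/\ Z h <= q h + D ^+ 3 * B * rho ^+ 3, q h - E3 * rho ^+ 3 <= Z h,
      `|\sum_(k < L) W h k * (k%:R - x) - (h * s2 + u * gam)| <= (D ^+ 2 * B + 1) * rho ^+ 2,
      \sum_(k < L) W h k * (k%:R - x) ^+ 2 <= B &
      \sum_(k < L) W h k * `|k%:R - x| ^+ 3 <= B].
Proof.
move=> hD.
have rr := sum_tilted_wgt_bounds mX mY eta0 eta1 HC hD uD rhoE EU EV L.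
have [e1 e2 e3 e4 e5] := rr.
have sq := Exp_sqrZ mX mY eta0 eta1 HC hD uD rhoE.
rewrite -/U -/V in sq.
move: e1 e2 e3; rewrite sq -/s2 -/gam -/bet -/(q h) => e1 e2 e3.
have r23 : rho ^+ 3 <= rho ^+ 2.
  by rewrite exprSr ler_piMr // ?sqr_ge0.
have E (j : nat) : (D * rho) ^+ j * Kexp eta * C = D ^+ j * B * rho ^+ j.
  by rewrite exprMn /B; ring.
rewrite E in e1; rewrite E in e2; rewrite E in e3.
split => //.
- apply: le_trans e2; rewrite /E3 mulrDl mul1r opprD addrA.
  by apply: lerB.
- apply: le_trans e3 _; rewrite mulrDl mul1r; apply: lerD => //.
  exact: le_trans tailL r23.
Qed.

Lemma q_le h : `|h| <= D * rho -> q h <= 1 + 2 * D ^+ 2 * B * rho ^+ 2.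
Proof.
move=> hD; rewrite /q lerD2l.
have b0 := B0.
have Dr0 : 0 <= D * rho by apply: le_trans hD.
have sq y : `|y| <= D * rho -> y ^+ 2 <= (D * rho) ^+ 2.
  by move=> yD; rewrite -[y ^+ 2]real_normK ?num_real // ler_sqr ?nnegrE.
have h1 : h ^+ 2 * s2 <= (D * rho) ^+ 2 * B.
  by apply: ler_pM; rewrite ?sqr_ge0 ?(ltW s20) //; exact: sq.
have h2 : u ^+ 2 * bet <= (D * rho) ^+ 2 * B.
  apply: le_trans (ler_norm _) _; rewrite normrM ger0_norm ?sqr_ge0 //.
  by apply: ler_pM; rewrite ?sqr_ge0 //; exact: sq.
have h3 : h * u * gam <= (D * rho) ^+ 2 * B.
  apply: le_trans (ler_norm _) _; rewrite (normrM (h * u)) (normrM h) expr2.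
  by apply: ler_pM => //; exact: ler_pM.
move: h1 h2 h3; rewrite exprMn; set a := D ^+ 2 * rho ^+ 2 * B.
have -> : 2 * D ^+ 2 * B * rho ^+ 2 = 2 * a by rewrite /a; ring.
lra.
Qed.

(** Completing the square in [h]. The minimum is at [- u] times the regression coefficient
    [gam / s2], which is how the residual variance enters. Valid for every [h], it applies at the
    saddle without knowing where that is. *)
Lemma q_ge h : 1 + u ^+ 2 * alpha2 / 2 <= q h.
Proof.
rewrite /q lerD2l ler_pM2r //.
have -> : h ^+ 2 * s2 + 2 * h * u * gam + u ^+ 2 * bet =
  u ^+ 2 * alpha2 + s2 * (h + gam * u / s2) ^+ 2.
  by rewrite /alpha2; field; rewrite gt_eqF.
by rewrite lerDl mulr_ge0 ?sqr_ge0 // ltW.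
Qed.

Let h0 := - (gam * u / s2).

Lemma q_min : q h0 = 1 + u ^+ 2 * alpha2 / 2.
Proof. by rewrite /q /h0 /alpha2; field; rewrite gt_eqF. Qed.

Lemma h0D : `|h0| <= D * rho.
Proof.
have b0 := B0.
rewrite normrN !normrM normfV (gtr0_norm rho0) (gtr0_norm s20).
have -> : `|gam| * (`|lam| * rho) / s2 = `|gam| / s2 * `|lam| * rho by field; rewrite gt_eqF.
apply: ler_wpM2r; first exact: ltW.
apply: (@le_trans _ _ (B / s0 * `|lam|)).
  apply: ler_wpM2r => //; apply: ler_pM; rewrite ?invr_ge0 ?(ltW s20) //.
  by rewrite lef_pV2 ?posrE.
rewrite /D mulrDl mulrAC [B * _]mulrC -addrA lerDl.
by rewrite addr_ge0 // divr_ge0 // ltW.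
Qed.

Let r2 : rho ^+ 2 <= rho.
Proof. by rewrite expr2 ler_piMr // ltW. Qed.
Let r3 : rho ^+ 3 <= rho ^+ 2.
Proof. by rewrite exprSr ler_piMr // sqr_ge0. Qed.
Let r20 : 0 <= rho ^+ 2. Proof. exact: sqr_ge0. Qed.

Let DB0 j : 0 <= D ^+ j * B.
Proof. by rewrite mulr_ge0 ?exprn_ge0 //; apply: le_trans B1. Qed.
Let E30 : 0 <= E3. Proof. by rewrite addr_ge0. Qed.
Let E40 : 0 <= E4.
Proof.
have b0 := B0.
by rewrite addr_ge0 // mulr_ge0 ?sqr_ge0 // addr_ge0 // divr_ge0 ?sqr_ge0 // ltW.
Qed.

Let yy := u ^+ 2 * alpha2 / 2 - E3 * rho ^+ 3.

Lemma norm_yy_le : `|yy| <= E4 * rho ^+ 2.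
Proof.
apply: le_trans (ler_normB _ _) _; rewrite [leRHS]mulrDl; apply: lerD.
  have -> : `|u ^+ 2 * alpha2 / 2| = u ^+ 2 * `|alpha2| / 2.
    by rewrite (normrM (_ * _)) (normrM (u ^+ 2)) (ger0_norm (sqr_ge0 u)) [`|2^-1|]ger0_norm.
  have ha := norm_alpha2_le.
  have A20 : 0 <= A2 by apply: le_trans ha.
  have -> : lam ^+ 2 * A2 * rho ^+ 2 = u ^+ 2 * A2 by rewrite /u exprMn; ring.
  have h1 : u ^+ 2 * `|alpha2| <= u ^+ 2 * A2 by apply: ler_wpM2l => //; exact: sqr_ge0.
  have h2 : 0 <= u ^+ 2 * A2 by rewrite mulr_ge0 ?sqr_ge0.
  by move: h1 h2; set p1 := u ^+ 2 * `|alpha2|; set p2 := u ^+ 2 * A2; lra.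
by rewrite ger0_norm ?mulr_ge0 ?exprn_ge0 ?(ltW rho0) //; apply: ler_wpM2l.
Qed.

Lemma norm_yy_half : `|yy| <= 1 / 2.
Proof.
apply: le_trans norm_yy_le _; apply: le_trans rho4.
by apply: ler_wpM2l.
Qed.

Lemma Z_ge_yy h : `|h| <= D * rho -> 1 + yy <= Z h.
Proof.
by move=> /tilt_bounds[_ + _ _ _]; apply: le_trans; have := q_ge h; rewrite /yy; lra.
Qed.

Lemma Z_ge_half h : `|h| <= D * rho -> 1 / 2 <= Z h.
Proof.
move=> /Z_ge_yy; apply: le_trans; have := norm_yy_half.
by rewrite ler_norml => /andP[+ _]; lra.
Qed.

Lemma Z_le2 h : `|h| <= D * rho -> Z h <= 2.
Proof.
move=> hD; have [e _ _ _ _] := tilt_bounds hD; have := q_le hD => e'.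
have h1 : 2 * D ^+ 2 * B * rho ^+ 2 <= 2 * D ^+ 2 * B * rho.
  by apply: ler_wpM2l => //; rewrite -mulrA mulr_ge0.
have h2 : D ^+ 3 * B * rho ^+ 3 <= E3 * rho.
  apply: ler_pM => //; rewrite ?exprn_ge0 ?(ltW rho0) //.
    by rewrite /E3 lerDl.
  exact: le_trans r2.
have := rho3; rewrite mulrDl; lra.
Qed.

Lemma W_ge0 h k : 0 <= W h k.
Proof. by rewrite mulr_ge0 ?wgt_ge0 ?expR_ge0. Qed.

Lemma W_lower h k : `|h| <= D * rho -> (k < n0)%N -> A k -> delta / 4 <= W h k.
Proof.
move=> hD kn Ak.
have w1 : delta / 2 <= wgt P X Y m u k.
  have := wgt_lower mX mY eta0 eta1 HC hD uD rhoE k.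
  apply: le_trans; have := HA kn Ak; have := rho5; rewrite /B mulrA.
  set a := D * rho * _ * _; lra.
have w2 : 1 / 2 <= expR (h * (k%:R - x)).
  apply: le_trans (expR_ge1Dx _).
  have : `|h * (k%:R - x)| <= D * rho * (n0%:R + X0).
    rewrite normrM; apply: ler_pM => //; apply: le_trans (ler_normB _ _) _.
    by apply: lerD => //; rewrite ger0_norm // ler_nat ltnW.
  by rewrite ler_norml => /andP[+ _]; have := rho6; lra.
have -> : delta / 4 = delta / 2 * (1 / 2) by field.
by apply: ler_pM => //; rewrite divr_ge0 // ltW.
Qed.

(** The aperiodicity bound with masses [delta / 4]; since [Z <= 2], the factor [Z^2 / 4] required by
    the normalisation can be inserted. *)
Lemma W_quadratic h : `|h| <= D * rho -> forall t, 0 <= t <= pi ->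
  (c0 * (delta / 4) ^+ 2 / 4) * Z h ^+ 2 * t ^+ 2 <=
  \sum_(k < L) \sum_(l < L) W h k * W h l * (1 - cos (t * (k%:R - l%:R))).
Proof.
move=> hD t tpi.
have d4 : 0 <= delta / 4 by rewrite divr_ge0 // ltW.
apply: le_trans (HS n0L (W_ge0 h) d4 (fun k kn Ak => W_lower hD kn Ak) tpi).
apply: ler_wpM2r; first exact: sqr_ge0.
rewrite mulrAC ler_pdivrMr //; apply: ler_wpM2l.
  by rewrite mulr_ge0 ?sqr_ge0 // ltW.
have -> : 4 = 2 ^+ 2 :> R by ring.
rewrite ler_sqr ?nnegrE //; first exact: Z_le2.
by apply: sumr_ge0 => k _; exact: W_ge0.
Qed.

(** The sum is the derivative of [Z] in [h], equal to [h s2 + u gam] up to order [rho^2]. At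
    [h = D rho] and [h = - D rho] the term [h s2] dominates, by the choice of [D]; the intermediate
    value theorem gives a zero. *)
Lemma exists_saddle : exists2 h, `|h| <= D * rho &
  \sum_(k < L) W h k * (k%:R - x) = 0.
Proof.
have b0 := B0.
have Dr0 : 0 <= D * rho by rewrite mulr_ge0 // ltW.
pose F h := \sum_(k < L) W h k * (k%:R - x).
have ug : `|u * gam| <= `|lam| * B * rho.
  rewrite normrM normrM (gtr0_norm rho0) mulrAC.
  by apply: ler_wpM2r; [exact: ltW|apply: ler_wpM2l].
have main : `|lam| * B * rho + (D ^+ 2 * B + 1) * rho ^+ 2 <= D * rho * s2.
  have : `|lam| * B * rho + rho <= D * rho * s2.
    have -> : `|lam| * B * rho + rho = ((`|lam| * B + 1) / s0) * s0 * rho.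
      by field; rewrite gt_eqF.
    rewrite [D * rho * _]mulrAC; apply: ler_wpM2r; first exact: ltW.
    apply: ler_pM; rewrite ?(ltW s00) //.
    by rewrite /D lerDl.
  apply: le_trans; rewrite lerD2l expr2 mulrA ler_piMl //; exact: ltW.
have Fp : 0 <= F (D * rho).
  have /tilt_bounds[_ _ + _ _] : `|D * rho| <= D * rho by rewrite ger0_norm.
  rewrite -/(F _) ler_norml => /andP[+ _]; move: ug; rewrite ler_norml => /andP[+ _].
  by move: main; lra.
have Fm : F (- (D * rho)) <= 0.
  have /tilt_bounds[_ _ + _ _] : `|- (D * rho)| <= D * rho by rewrite normrN ger0_norm.
  rewrite -/(F _) ler_norml => /andP[_ +]; move: ug; rewrite ler_norml => /andP[_ +].
  by move: main; lra.
have cF : {within `[- (D * rho), D * rho], continuous F}.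
  apply: continuous_subspaceT => h.
  apply: (@cvg_big _ _ _ _ _ add_continuous) => k _; apply: cvgM; last exact: cvg_cst.
  apply: cvgM; first exact: cvg_cst.
  apply: (@continuous_comp _ _ _ (fun h : R => h * (k%:R - x)) expR).
    by apply: cvgM; [exact: cvg_id|exact: cvg_cst].
  exact: continuous_expR.
have [||h hin Fh] := @IVT R F (- (D * rho)) (D * rho) 0 _ cF.
- by rewrite ge0_cp.
- by rewrite ge_min le_max Fm Fp orbT.
- by exists h => //; move: hin; rewrite in_itv /= ler_norml.
Qed.

Variables (C2 c1 : R) (N1 : nat).
Hypotheses (C20 : 0 < C2) (c10 : 0 < c1).
Hypothesis LLT : forall (L N K : nat) (w : nat -> R) (x h : R),
  let W k := w k * expR (h * (k%:R - x)) in
  let Z := \sum_(k < L) W k in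
  (0 < N)%N -> (forall k, 0 <= w k) -> 0 < Z -> N%:R * x = K%:R ->
  (forall t, 0 <= t <= pi -> (c0 * (delta / 4) ^+ 2 / 4) * Z ^+ 2 * t ^+ 2 <=
    \sum_(k < L) \sum_(l < L) W k * W l * (1 - cos (t * (k%:R - l%:R)))) ->
  conv_coef L w N K <= C2 / Num.sqrt N%:R * Z ^+ N /\
  ((N1 <= N)%N -> \sum_(k < L) W k * (k%:R - x) = 0 ->
  \sum_(k < L) W k * (k%:R - x) ^+ 2 <= 2 * B * Z ->
  \sum_(k < L) W k * `|k%:R - x| ^+ 3 <= 2 * B * Z ->
  c1 / Num.sqrt N%:R * Z ^+ N <= conv_coef L w N K).
Hypotheses (N0 : (0 < N)%N) (N1N : (N1 <= N)%N) (NxK : N%:R * x = K%:R).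

Let conv := conv_coef L (wgt P X Y m u) N K.

(** Two different tilts are used: the upper bound at the explicit minimiser [h0] of [q], the lower
    bound at the saddle, where [Z h >= 1 + yy] still holds. Both logarithms equal [u^2 alpha2 / 2]
    up to order [rho^3], and [N] multiplies them. *)
Lemma ln_conv_bounds : 0 < conv /\
  `|ln (Num.sqrt N%:R * conv) - N%:R * (u ^+ 2 * alpha2 / 2)| <=
  (`|ln C2| + `|ln c1| + E3 + 2 * E4 ^+ 2) * (1 + N%:R * rho ^+ 3).
Proof.
have N0' : 0 < N%:R :> R by rewrite ltr0n.
have sN : 0 < Num.sqrt N%:R :> R by rewrite sqrtr_gt0.
have Zp h : `|h| <= D * rho -> 0 < Z h.
  by move=> hD; apply: lt_le_trans (Z_ge_half hD).
have w0 k : 0 <= wgt P X Y m u k by exact: wgt_ge0.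
have [h hD hs] := exists_saddle.
have [_ low] := LLT N0 w0 (Zp h hD) NxK (W_quadratic hD).
have [_ _ _ m2 m3] := tilt_bounds hD.
(* The moment constant of the local estimate is [2 B] because [Z >= 1 / 2]. *)
have BZ : B <= 2 * B * Z h.
  have := Z_ge_half hD => zh; rewrite -[leLHS]mulr1 -mulrA mulrCA.
  by apply: ler_wpM2l => //; lra.
have {}low := low N1N hs (le_trans m2 BZ) (le_trans m3 BZ).
have [up _] := LLT N0 w0 (Zp _ h0D) NxK (W_quadratic h0D).
rewrite -/conv -/(Z h) in low; rewrite -/conv -/(Z h0) in up.
have conv0 : 0 < conv.
  by apply: lt_le_trans low; rewrite mulr_gt0 ?exprn_gt0 ?divr_gt0 ?Zp.
split => //.
have {}low : c1 * Z h ^+ N <= Num.sqrt N%:R * conv.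
  by rewrite [leRHS]mulrC -ler_pdivrMr // mulrAC.
have {}up : Num.sqrt N%:R * conv <= C2 * Z h0 ^+ N.
  by rewrite [leLHS]mulrC -ler_pdivlMr // mulrAC.
have sc : 0 < Num.sqrt N%:R * conv by rewrite mulr_gt0.
have lnZ (c z : R) : 0 < c -> 0 < z -> ln (c * z ^+ N) = ln c + N%:R * ln z.
  move=> cp zp; rewrite lnM ?posrE ?exprn_gt0 // lnXn // mulr_natl //.
have upl : ln (Num.sqrt N%:R * conv) <= ln C2 + N%:R * ln (Z h0).
  by rewrite -lnZ ?Zp ?h0D // ler_ln ?posrE // mulr_gt0 ?exprn_gt0 ?Zp ?h0D.
have lowl : ln c1 + N%:R * ln (Z h) <= ln (Num.sqrt N%:R * conv).
  by rewrite -lnZ ?Zp // ler_ln ?posrE // mulr_gt0 ?exprn_gt0 ?Zp.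
have rho30 : 0 <= rho ^+ 3 by rewrite exprn_ge0 // ltW.
have u1 : ln (Z h0) <= u ^+ 2 * alpha2 / 2 + E3 * rho ^+ 3.
  have [e _ _ _ _] := tilt_bounds h0D; rewrite q_min in e.
  have zp := Zp _ h0D.
  have : ln (Z h0) <= Z h0 - 1.
    move: zp; move: (Z h0) => z zp; have E : 1 + (z - 1) = z by ring.
    by rewrite -{1}E; apply: le_ln1Dx; rewrite ltrBrDr addNr.
  have : D ^+ 3 * B * rho ^+ 3 <= E3 * rho ^+ 3.
    by apply: ler_wpM2r => //; rewrite lerDl.
  by move: e; lra.
have l1 : u ^+ 2 * alpha2 / 2 - E3 * rho ^+ 3 - 2 * E4 ^+ 2 * rho ^+ 3 <= ln (Z h).
  have y1 := norm_yy_half; have y2 := norm_yy_le.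
  have zy := Z_ge_yy hD.
  have yp : 0 < 1 + yy by move: y1; rewrite ler_norml => /andP[+ _]; lra.
  apply: (@le_trans _ _ (ln (1 + yy))); last by rewrite ler_ln ?posrE // Zp.
  apply: le_trans (ln_ge_sub_sqr y1).
  have ys : yy ^+ 2 <= E4 ^+ 2 * rho ^+ 3.
    rewrite -[yy ^+ 2]real_normK ?num_real //.
    apply: (@le_trans _ _ ((E4 * rho ^+ 2) ^+ 2)).
      by rewrite ler_sqr ?nnegrE // mulr_ge0.
    rewrite exprMn -exprM; apply: ler_wpM2l; first exact: sqr_ge0.
    by change (rho ^+ 4 <= rho ^+ 3); rewrite exprSr ler_piMr.
  by rewrite -/yy lerD2l lerN2 -mulrA ler_pM2l.
set lnv := ln (Num.sqrt _ * _) in upl lowl *.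
have Nr : 0 <= N%:R * rho ^+ 3 by rewrite mulr_ge0.
have U1 := ler_wpM2l (ltW N0') u1; have L1 := ler_wpM2l (ltW N0') l1.
rewrite mulrDr [N%:R * (E3 * _)]mulrCA in U1; rewrite 2!mulrBr [N%:R * (E3 * _)]mulrCA [N%:R * (2 * _ * _)]mulrCA in L1.
apply: sandwich_le => //; first exact: sqr_ge0.
- by apply: le_trans upl _; apply: lerD => //; exact: ler_norm.
- apply: le_trans lowl; have n2 := ler_norm (- ln c1); rewrite normrN in n2.
  by apply: lerD => //; rewrite lerNl.
Qed.

End SmallTilt.

Lemma exists_tail_bound {R : realType} (x eta C eps : R) (n : nat) :
  0 < eta -> eta <= 1 -> 1 <= C -> 0 < eps ->
  exists L, (n <= L)%N /\ tail_bound x eta C L <= eps.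
Proof.
move=> eta0 eta1 C1 eps0.
have K1 := Kexp_ge1 eta0 eta1.
pose B := Kexp eta * C; have B0 : 0 < B by rewrite mulr_gt0 //; lra.
have [L0 [_ hL0]] := exists_natr_ge (`|x| + 2 / eta * (B / eps)).
exists (maxn n L0); split; first exact: leq_maxl.
have hL : `|x| + 2 / eta * (B / eps) <= (maxn n L0)%:R.
  by apply: le_trans hL0 _; rewrite ler_nat leq_maxr.
rewrite /tail_bound mulrAC -/B.
set y := eta / 2 * _; have yB : B / eps <= y.
  have -> : B / eps = eta / 2 * (2 / eta * (B / eps)) by field; rewrite !gt_eqF.
  by apply: ler_wpM2l; [rewrite divr_ge0 // ltW|rewrite lerBrDl].
have y0 : 0 < y by apply: lt_le_trans yB; rewrite divr_gt0.
rewrite expRN ler_pdivrMr ?expR_gt0 // mulrC -ler_pdivrMr //.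
apply: le_trans yB _; apply: le_trans (expR_ge1Dx _); lra.
Qed.

(** The order of quantifiers is the point. [n0] depends on the support alone, so the mass bound
    [delta] on the atoms below [n0] can be found afterwards; the constants then hold for all laws
    meeting the moment bounds. Only the truncation level [L] depends on the law and on [rho]. *)
Lemma conv_coef_asymptotics {R : realType} (A : set nat)
    (eta C s0 X0 lam : R) :
  (forall m b, A `<=` [set (m * j + b)%N | j in [set: nat]] -> (m <= 1)%N) ->
  0 < eta -> eta <= 1 -> 1 <= C -> 0 < s0 ->
  exists n0 : nat, forall delta : R, 0 < delta -> exists (C' rho0 : R) (N1 : nat), 0 < rho0 /\
  forall d (T : measurableType d) (P : probability T R) (X : T -> nat) (Y : T -> R)
    (x m rho : R) (N K : nat),
  measurable_fun setT X -> measurable_fun setT Y ->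
  (\int[P]_w (expR (eta * (`|(X w)%:R - x| + `|Y w - m|)))%:E <= C%:E)%E ->
  \int[P]_w ((X w)%:R - x) = 0 -> \int[P]_w (Y w - m) = 0 ->
  let s2 := \int[P]_w (((X w)%:R - x) * ((X w)%:R - x)) in
  let gam := \int[P]_w (((X w)%:R - x) * (Y w - m)) in
  let bet := \int[P]_w ((Y w - m) * (Y w - m)) in
  s0 <= s2 -> `|x| <= X0 ->
  (forall k, (k < n0)%N -> A k -> delta <= fine (P (X @^-1` [set k]))) ->
  0 < rho -> rho <= rho0 -> (0 < N)%N -> (N1 <= N)%N -> N%:R * x = K%:R ->
  exists L, (K < L)%N /\ 0 < conv_coef L (wgt P X Y m (lam * rho)) N K /\
  `|ln (Num.sqrt N%:R * conv_coef L (wgt P X Y m (lam * rho)) N K)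
    - N%:R * ((lam * rho) ^+ 2 * (bet - gam ^+ 2 / s2) / 2)| <=
  C' * (1 + N%:R * rho ^+ 3).
Proof.
move=> aper eta0 eta1 C1 s00.
have [n0 [c0 [c00 HS]]] := @aperiodic_quadratic_bound R A aper.
exists n0 => delta delta0.
pose B := Kexp eta * C.
have B1 : 1 <= B by rewrite -[leLHS]mulr1; apply: ler_pM => //; exact: Kexp_ge1.
have cl0 : 0 < c0 * (delta / 4) ^+ 2 / 4 by rewrite divr_gt0 // mulr_gt0 // exprn_gt0 // divr_gt0.
have B20 : 0 < 2 * B by rewrite mulr_gt0 //; apply: lt_le_trans B1.
have [C2 [c1 [N1 [C20 c10 LLT]]]] := @conv_coef_two_sided R _ _ cl0 B20.
pose D := (`|lam| * B + 1) / s0 + `|lam|.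
pose A2 := B + B ^+ 2 / s0.
pose E3 := D ^+ 3 * B + 1.
pose E4 := lam ^+ 2 * A2 + E3.
have b0 : 0 <= B by apply: le_trans B1.
have D0 : 0 <= D.
  apply: addr_ge0 => //; apply: divr_ge0; last exact: ltW.
  by apply: addr_ge0 => //; exact: mulr_ge0.
have A20 : 0 <= A2 by apply: addr_ge0 => //; apply: divr_ge0; [exact: sqr_ge0|exact: ltW].
have E30 : 0 <= E3 by apply: addr_ge0 => //; apply: mulr_ge0 => //; exact: exprn_ge0.
have E40 : 0 <= E4 by apply: addr_ge0 => //; apply: mulr_ge0 => //; exact: sqr_ge0.
(* Each smallness condition on [rho] reads [t * rho <= 1] for one of these; [rho <= 1 / Tt], with
   [Tt] above all of them and above 1, meets all at once. *)
pose t1 := 4 * D / eta; pose t2 := D ^+ 2 * B + 1; pose t3 := 2 * D ^+ 2 * B + E3.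
pose t4 := 2 * E4; pose t5 := 2 * D * B / delta; pose t6 := 2 * D * (n0%:R + `|X0|).
have t10 : 0 <= t1 by apply: divr_ge0; [exact: mulr_ge0|exact: ltW].
have DD : 0 <= D ^+ 2 * B by apply: mulr_ge0 => //; exact: exprn_ge0.
have t20 : 0 <= t2 by exact: addr_ge0.
have t30 : 0 <= t3 by apply: addr_ge0 => //; rewrite -mulrA mulr_ge0.
have t40 : 0 <= t4 by exact: mulr_ge0.
have t50 : 0 <= t5 by apply: divr_ge0; [apply: mulr_ge0 => //; exact: mulr_ge0|exact: ltW].
have t60 : 0 <= t6 by apply: mulr_ge0; [exact: mulr_ge0|exact: addr_ge0].
pose Tt := 1 + t1 + t2 + t3 + t4 + t5 + t6.
have [T1 T2 T3] : [/\ t1 <= Tt, t2 <= Tt & t3 <= Tt] by rewrite /Tt; split; lra.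
have [T4 T5 T6] : [/\ t4 <= Tt, t5 <= Tt & t6 <= Tt] by rewrite /Tt; split; lra.
have T1' : 1 <= Tt by rewrite /Tt; lra.
have Tt0 : 0 < Tt by apply: lt_le_trans T1'.
exists (`|ln C2| + `|ln c1| + E3 + 2 * E4 ^+ 2), (Tt^-1), N1; split; first by rewrite invr_gt0.
move=> d T P X Y x m rho N K mX mY HC EU EV s2 gam bet s0s2 xX0 HA rho0 rhoT N0 N1N NxK.
have Tr : Tt * rho <= 1 by rewrite -ler_pdivlMl // mulr1.
have small t : 0 <= t -> t <= Tt -> t * rho <= 1.
  by move=> tp tT; apply: le_trans Tr; apply: ler_wpM2r => //; exact: ltW.
have r1 : rho <= 1 by rewrite -[leLHS]mul1r; exact: small.
have rE : D * rho <= eta / 4.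
  have : t1 * rho <= 1 by exact: small.
  have -> : t1 * rho = D * rho / (eta / 4) by rewrite /t1; field; rewrite gt_eqF.
  by rewrite ler_pdivrMr ?divr_gt0 // mul1r.
have r2 : t2 * rho <= 1 by exact: small.
have r3 : t3 * rho <= 1 by exact: small.
have r4 : E4 * rho <= 1 / 2.
  have : t4 * rho <= 1 by exact: small.
  by rewrite /t4 -mulrA -ler_pdivlMl // mulr1 div1r.
have r5 : D * rho * B <= delta / 2.
  have : t5 * rho <= 1 by exact: small.
  have -> : t5 * rho = D * rho * B / (delta / 2) by rewrite /t5; field; rewrite gt_eqF.
  by rewrite ler_pdivrMr ?divr_gt0 // mul1r.
have r6 : D * rho * (n0%:R + `|X0|) <= 1 / 2.
  have : t6 * rho <= 1 by exact: small.
  have -> : t6 * rho = 2 * (D * rho * (n0%:R + `|X0|)) by rewrite /t6; ring.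
  by rewrite -ler_pdivlMl // mulr1 div1r.
have rho30 : 0 < rho ^+ 3 by rewrite exprn_gt0.
have [L [nL tL]] := @exists_tail_bound R x eta C _ (maxn n0 K.+1) eta0 eta1 C1 rho30.
exists L; split; first by apply: leq_trans nL; exact: leq_maxr.
have n0L : (n0 <= L)%N by apply: leq_trans nL; exact: leq_maxl.
have xX0' : `|x| <= `|X0| by apply: le_trans xX0 (ler_norm _).
exact: (ln_conv_bounds mX mY eta0 eta1 C1 HC EU EV s00 s0s2 delta0 xX0' HA rho0 r1
  rE r2 r3 r4 r5 r6 tL n0L c00 HS C20 c10 LLT N0 N1N NxK).
Qed.

(** * The Gaertner-Ellis argument for a quadratic limit *)

Section LimsupLiminf.
Context {R : realType}.
Local Open Scope ereal_scope.

Lemma limn_esup_le_near (u : (\bar R)^nat) (M : \bar R) :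
  (\forall n \near \oo, u n <= M) -> limn_esup u <= M.
Proof.
move=> uM; apply: ge_ereal_inf; exists (ereal_sup (u @` [set n | u n <= M])).
  by exists [set n | u n <= M].
by apply: ge_ereal_sup => _ [n /= unM <-].
Qed.

Lemma limn_einf_ge_near (u : (\bar R)^nat) (M : \bar R) :
  (\forall n \near \oo, M <= u n) -> M <= limn_einf u.
Proof.
move=> uM; rewrite leeNr; apply: limn_esup_le_near.
by near do rewrite /= leeN2.
Unshelve. all: by end_near. Qed.

End LimsupLiminf.

Section RealIntegrals.
Context {R : realType} d (T : measurableType d) (mu : {measure set T -> \bar R}).
Implicit Types f g : T -> R.
Local Open Scope ereal_scope.

Lemma ge0_integralD_real f g : measurable_fun setT f -> measurable_fun setT g ->
  (forall w, 0 <= f w)%R -> (forall w, 0 <= g w)%R ->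
  \int[mu]_w (f w + g w)%:E = \int[mu]_w (f w)%:E + \int[mu]_w (g w)%:E.
Proof.
move=> mf mg f0 g0; under eq_integral do rewrite EFinD.
by apply: ge0_integralD => //; do ?[by move=> w _; rewrite lee_fin|exact/measurable_EFinP].
Qed.

Lemma ge0_le_integral_real f g : measurable_fun setT f -> measurable_fun setT g ->
  (forall w, 0 <= f w)%R -> (forall w, f w <= g w)%R ->
  \int[mu]_w (f w)%:E <= \int[mu]_w (g w)%:E.
Proof.
move=> mf mg f0 fg; apply: ge0_le_integral => //.
- by move=> w _; rewrite lee_fin.
- exact/measurable_EFinP.
- exact/measurable_EFinP.
- by move=> w _; rewrite lee_fin.
Qed.

End RealIntegrals.

(** * Exponential inequalities for a single conditioned law *)

Section GaertnerEllisOne.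
Context {R : realType} d (T : measurableType d) (P : probability T R).
Variables (D : set T) (Z : T -> R) (a : R) (Lam : R -> R).
Hypotheses (mD : measurable D) (mZ : measurable_fun setT Z) (a0 : 0 < a).
(** The transform is not normalised: [Lam 0] is the probability of the conditioning event. Stating
    it as an equation with a real number certifies finiteness. *)
Let isLam l := (\int[P]_w (expR (l * Z w / a) * \1_D w)%:E = (Lam l)%:E)%E.
Hypothesis LamE0 : isLam 0.
Hypothesis Lam00 : 0 < Lam 0.

Let pos l w : (0 <= (expR (l * Z w / a) * \1_D w)%:E)%E.
Proof. by rewrite lee_fin mulr_ge0 ?expR_ge0. Qed.

Let mexp l : measurable_fun setT (fun w => expR (l * Z w / a) * \1_D w : R).
Proof.
apply: measurable_funM; last exact: measurable_indic.
apply: measurableT_comp; first exact: measurable_expR.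
by apply: measurable_funM => //; exact: measurable_funM.
Qed.

Lemma cond_prob_den : P D = (Lam 0)%:E.
Proof.
rewrite -LamE0 -(setIT D) -integral_indic //; apply: eq_integral => w _.
by rewrite setIT mul0r mul0r expR0 mul1r.
Qed.

Let mZA (A : set R) : measurable A -> measurable (Z @^-1` A).
Proof. by move=> mA; rewrite -[X in measurable X]setTI; apply: mZ. Qed.

Let num_fin (A : set R) : measurable A -> P (Z @^-1` A `&` D) \is a fin_num.
Proof. by move=> mA; apply: fin_num_measure; apply: measurableI => //; exact: mZA. Qed.

Lemma cond_lawE (A : set R) : measurable A ->
  cond_law P D Z A = (fine (P (Z @^-1` A `&` D)) / Lam 0)%:E.
Proof.
move=> mA; rewrite /cond_law cond_prob_den inver gt_eqF //.
by rewrite -[in LHS](fineK (num_fin mA)) -EFinM.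
Qed.

Lemma integral_cond (A : set R) : measurable A ->
  (\int[P]_w (\1_(Z @^-1` A) w * \1_D w)%:E = (fine (P (Z @^-1` A `&` D)))%:E)%E.
Proof.
move=> mA; rewrite fineK ?num_fin // -[in RHS](setIT (_ `&` _)) -integral_indic //.
  by apply: eq_integral => w _; rewrite indicI.
by apply: measurableI => //; exact: mZA.
Qed.

(** Two-sided Chernoff bound. Treating both tails together is enough because the rate function is
    even and increases with [|y|]. *)
Lemma cond_law_le (A : set R) (del l : R) : measurable A -> (forall y, A y -> del <= `|y|) ->
  0 <= l -> isLam l -> isLam (- l) -> (cond_law P D Z A <=
    (expR (- (l * del / a)) * (Lam l / Lam 0 + Lam (- l) / Lam 0))%:E)%E.
Proof.
move=> mA Adel l0 Ll LNl; rewrite cond_lawE // lee_fin -mulrDl mulrA ler_pM2r ?invr_gt0 //.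
rewrite -lee_fin -integral_cond // EFinM EFinD -Ll -LNl.
set c := expR _; have c0 : 0 <= c by exact: expR_ge0.
have pos' l' w : 0 <= expR (l' * Z w / a) * \1_D w by rewrite mulr_ge0 ?expR_ge0.
rewrite -ge0_integralD_real // -ge0_integralZl_real //; last first.
  by apply: measurable_funD; exact: mexp.
apply: ge0_le_integral_real.
- by apply: measurable_funM; apply: measurable_indic => //; exact: mZA.
- by apply: measurable_funM => //; apply: measurable_funD; exact: mexp.
- by move=> w; rewrite mulr_ge0.
move=> w; rewrite -mulrDl mulrA ler_wpM2r // indicE.
have [wA|wA] := boolP (w \in _); last by rewrite mulr_ge0 // addr_ge0 ?expR_ge0.
have dZ : del <= `|Z w| by apply: Adel; move/set_mem: wA.
apply: (@le_trans _ _ (c * expR (l * `|Z w| / a))).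
  rewrite -expRD -[leLHS]expR0 ler_expR addrC subr_ge0 ler_pM2r ?invr_gt0 //.
  exact: ler_wpM2l.
apply: ler_wpM2l => //; have [z0|z0] := leP 0 (Z w).
  by rewrite ger0_norm // lerDl expR_ge0.
by rewrite ltr0_norm // mulrN -mulNr lerDr expR_ge0.
Qed.

(** The Gaertner-Ellis lower bound without changing measure: e^{l Z / a} is split pointwise
    according to whether [Z] is within [eps] of [y], above, or below. The two tails are Chernoff
    bounds under the tilted law, written as transforms at [l + del] and [l - del]. *)
Lemma cond_law_ge (A : set R) (y eps l del : R) : measurable A ->
  (forall z, `|z - y| < eps -> A z) -> 0 <= del ->
  isLam l -> isLam (l + del) -> isLam (l - del) ->
  Lam l / Lam 0 <= expR ((l * y + `|l| * eps) / a) * (fine (P (Z @^-1` A `&` D)) / Lam 0)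
    + expR (- (del * (y + eps) / a)) * (Lam (l + del) / Lam 0)
    + expR (del * (y - eps) / a) * (Lam (l - del) / Lam 0).
Proof.
move=> mA Aeps del0 Ll Lp Lm; rewrite !mulrA -!mulrDl ler_pM2r ?invr_gt0 //.
set c1 := expR _; set c2 := expR _; set c3 := expR _.
have c10 : 0 <= c1 by exact: expR_ge0.
have c20 : 0 <= c2 by exact: expR_ge0.
have c30 : 0 <= c3 by exact: expR_ge0.
have mI : measurable_fun setT (fun w => \1_(Z @^-1` A) w * \1_D w : R).
  by apply: measurable_funM; apply: measurable_indic => //; exact: mZA.
have pos' l' w : 0 <= expR (l' * Z w / a) * \1_D w by rewrite mulr_ge0 ?expR_ge0.
have posI w : 0 <= \1_(Z @^-1` A) w * \1_D w :> R by rewrite mulr_ge0.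
rewrite -lee_fin !EFinD !EFinM -Ll -Lp -Lm -integral_cond //.
have mc (c : R) (f : T -> R) : measurable_fun setT f -> measurable_fun setT (fun w : T => c * f w : R).
  by move=> mf; exact: measurable_funM.
have pc (c : R) (f : T -> R) : 0 <= c -> (forall w, 0 <= f w) -> forall w, 0 <= c * f w.
  by move=> c0 f0 w; exact: mulr_ge0.
rewrite -!ge0_integralZl_real //.
have p1 := pc _ _ c10 posI; have m1 := mc c1 _ mI.
have p2 := pc _ _ c20 (pos' (l + del)); have m2 := mc c2 _ (mexp (l + del)).
have p3 := pc _ _ c30 (pos' (l - del)); have m3 := mc c3 _ (mexp (l - del)).
rewrite -(ge0_integralD_real P m1 m2 p1 p2).
rewrite -(ge0_integralD_real P (measurable_funD m1 m2) m3 (fun w => addr_ge0 (p1 w) (p2 w)) p3).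
apply: ge0_le_integral_real => //.
- exact: (measurable_funD (measurable_funD m1 m2) m3).
move=> w /=; rewrite !mulrA -!mulrDl; apply: ler_wpM2r => //.
have [wA|] := ltP `|Z w - y| eps.
  rewrite indicE mem_set; last exact: Aeps.
  rewrite mulr1; apply: (@le_trans _ _ c1); last first.
    by rewrite -addrA lerDl addr_ge0 // mulr_ge0 ?expR_ge0.
  rewrite ler_expR ler_pM2r ?invr_gt0 //.
  have -> : Z w = y + (Z w - y) by ring.
  rewrite mulrDr lerD2l; apply: le_trans (ler_norm _) _; rewrite normrM.
  by apply: ler_wpM2l => //; exact: ltW.
have c1p : 0 <= c1 * \1_(Z @^-1` A) w by exact: mulr_ge0.
have split (l' q : R) : l * Z w <= q + l' * Z w ->
    expR (l * Z w / a) <= expR (q / a) * expR (l' * Z w / a).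
  by move=> h; rewrite -expRD ler_expR -mulrDl ler_pM2r ?invr_gt0.
rewrite ler_normr => /orP[h|h].
  apply: (@le_trans _ _ (c2 * expR ((l + del) * Z w / a))).
    rewrite /c2 -mulNr; apply: split; have := ler_wpM2l del0 h; lra.
  by rewrite addrAC lerDr addr_ge0 // mulr_ge0 ?expR_ge0.
apply: (@le_trans _ _ (c3 * expR ((l - del) * Z w / a))).
  by apply: split; have := ler_wpM2l del0 h; lra.
by rewrite lerDr addr_ge0 // mulr_ge0 ?expR_ge0.
Qed.

End GaertnerEllisOne.

(** At [y = l al] the tail exponents equal [l^2 al / 2 + del^2 al / 2 - del eps + eta]. The first
    hypothesis makes the gain at least [del eps / 2], and the second keeps half of it after two
    losses of [eta]. *)
Lemma tail_exponent_le {R : realFieldType} (l al del eps eta : R) :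
  del * (del * al) <= del * eps -> eta <= del * eps / 2 / 4 ->
  - (del * (l * al + eps)) + ((l + del) ^+ 2 * al / 2 + eta) <=
    l ^+ 2 * al / 2 - eta - del * eps / 2 / 2 /\
  del * (l * al - eps) + ((l - del) ^+ 2 * al / 2 + eta) <=
    l ^+ 2 * al / 2 - eta - del * eps / 2 / 2.
Proof. by move=> h1 h2; split; lra. Qed.

Lemma lower_exponent_le {R : realFieldType} (q e eta : R) : eta <= e / 4 -> 0 < e ->
  - q - e <= - q - eta - e / 4 - e / 4.
Proof. by lra. Qed.

Lemma half_le_of_quarters {R : realFieldType} (r p q s t : R) :
  r <= p + q + s -> t <= r -> q <= t / 4 -> s <= t / 4 -> t / 2 <= p.
Proof. by lra. Qed.

Lemma main_exponent_le {R : realFieldType} (l al e eta b : R) :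
  b <= e / 4 ->
  l * (l * al) + b + (- (l ^+ 2 * al / 2) - eta - e / 4) <= l ^+ 2 * al / 2 - eta.
Proof. by lra. Qed.

(** * The large deviation principle from the limit of the transforms *)

Section GaertnerEllis.
Context {R : realType}.
Variables (ds : nat -> measure_display) (Ts : forall n, measurableType (ds n)).
Variable Ps : forall n, probability (Ts n) R.
Variables (D : forall n, set (Ts n)) (Z : forall n, Ts n -> R) (a : nat -> R).
Variables (alpha2 : R) (Lam : nat -> R -> R).
Hypothesis mD : forall n, (0 < n)%N -> measurable (@D n).
Hypothesis mZ : forall n, (0 < n)%N -> measurable_fun setT (@Z n).
Hypothesis a0 : forall n, (0 < n)%N -> 0 < a n.
Let isLam n l :=
  (\int[Ps n]_w (expR (l * Z w / a n) * \1_(@D n) w)%:E = (Lam n l)%:E)%E.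
Hypothesis LamE0 : forall n, (0 < n)%N -> isLam n 0.
Hypothesis LamE : forall l, \forall n \near \oo, isLam n l.
Hypothesis Lam00 : forall n, (0 < n)%N -> 0 < Lam n 0.
Hypothesis Lam_gt0 : forall l, \forall n \near \oo, 0 < Lam n l.
Hypothesis acvg : a n @[n --> \oo] --> 0.
Hypothesis alpha20 : 0 <= alpha2.
Hypothesis Gcvg : forall l,
  a n * ln (Lam n l / Lam n 0) @[n --> \oo] --> l ^+ 2 * alpha2 / 2.

Let mu n := cond_law (Ps n) (@D n) (@Z n).
Let J := quadratic_rate alpha2.

Let a_small c : 0 < c -> \forall n \near \oo, a n < c.
Proof.
move=> c0; have /pseudometric_normed_Zmodule.cvgrPdist_lt/(_ _ c0) := acvg.
by apply: filterS => n; rewrite sub0r normrN; exact/le_lt_trans/ler_norm.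
Qed.

Lemma laplace_ratio_bounds l e : 0 < e -> \forall n \near \oo,
  Lam n l / Lam n 0 <= expR ((l ^+ 2 * alpha2 / 2 + e) / a n) /\
  expR ((l ^+ 2 * alpha2 / 2 - e) / a n) <= Lam n l / Lam n 0.
Proof.
move=> e0; near=> n.
have n0 : (0 < n)%N by near: n; exact: nbhs_infty_gt.
have an0 := a0 n0; have L0 := Lam00 n0.
have Ll : 0 < Lam n l by near: n; exact: Lam_gt0.
have r0 : 0 < Lam n l / Lam n 0 by rewrite divr_gt0.
have : `|l ^+ 2 * alpha2 / 2 - a n * ln (Lam n l / Lam n 0)| < e.
  by near: n; have /pseudometric_normed_Zmodule.cvgrPdist_lt := @Gcvg l; exact.
rewrite ltr_norml => /andP[h1 h2].
rewrite -[Lam n l / Lam n 0]lnK ?posrE // !ler_expR.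
by rewrite ler_pdivlMr // ler_pdivrMr // ![ln _ * _]mulrC; split; lra.
Unshelve. all: by end_near. Qed.

Lemma quadratic_rate_gt0 : 0 < alpha2 ->
  J = (fun y => (y ^+ 2 / (2 * alpha2))%:E).
Proof.
move=> al0; apply/funext => y.
by rewrite /J /quadratic_rate inver gt_eqF ?mulr_gt0 // -EFinM.
Qed.

Lemma quadratic_rate0 y : alpha2 = 0 -> J y = if y == 0 then 0%E else +oo%E.
Proof.
move=> al0; rewrite /J /quadratic_rate al0 mulr0 inver eqxx.
case: eqP => [->|/eqP yn0]; first by rewrite expr0n /= mul0e.
by rewrite gt0_muley // lte_fin lt_neqAle sqr_ge0 eq_sym sqrf_eq0 yn0.
Qed.

Lemma quadratic_rate_ge0 y : (0 <= J y)%E.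
Proof.
rewrite /J /quadratic_rate mule_ge0 ?lee_fin ?sqr_ge0 // inve_ge0 lee_fin.
by rewrite mulr_ge0.
Qed.

(** The degenerate case is separate throughout: for [alpha2 = 0] the rate is [+oo] off the origin,
    hence neither real valued nor attained at a dual point [y / alpha2]. *)
Let alpha2_cases : alpha2 = 0 \/ 0 < alpha2.
Proof. by move: alpha20; rewrite le_eqVlt => /orP[/eqP<-|]; [left|right]. Qed.

Lemma quadratic_rate_lsc : lower_semicontinuous J.
Proof.
apply/lower_semicontinuousP => c; case: alpha2_cases => [al0|al0].
  have [c0|c0] := ltP c 0.
    rewrite (_ : [set x | _] = setT); first exact: openT.
    apply/seteqP; split => // y _ /=.
    by apply: lt_le_trans (quadratic_rate_ge0 y); rewrite lte_fin.
  rewrite (_ : [set x | _] = ~` [set 0]); first by rewrite openC; exact: closed_eq.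
  apply/seteqP; split => y /=; rewrite quadratic_rate0 //; case: eqP => //.
    by rewrite lte_fin => _ /(le_lt_trans c0); rewrite ltxx.
  by rewrite ltry.
rewrite quadratic_rate_gt0 //.
pose f (y : R) := y ^+ 2 / (2 * alpha2).
rewrite (_ : [set x | _] = f @^-1` [set z | c < z]); last first.
  by apply/seteqP; split => y /=; rewrite lte_fin.
apply: open_comp; last exact: open_gt.
by move=> y _; apply: cvgM; [exact: exprn_continuous|exact: cvg_cst].
Qed.

Lemma quadratic_rate_good : good_rate J.
Proof.
move=> c c0; case: alpha2_cases => [al0|al0].
  rewrite (_ : [set x | _] = [set 0]); first exact: compact_set1.
  apply/seteqP; split => y /=; rewrite quadratic_rate0 //.
    by case: eqP.
  by move=> ->; rewrite eqxx lee_fin.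
rewrite quadratic_rate_gt0 // (_ : [set x | _] =
    `[- Num.sqrt (c * (2 * alpha2)), Num.sqrt (c * (2 * alpha2))]%classic).
  exact: segment_compact.
have ca : 0 <= c * (2 * alpha2) by rewrite mulr_ge0 // mulr_ge0.
apply/seteqP; split => y /=; rewrite in_itv /= -ler_norml lee_fin ler_pdivrMr ?mulr_gt0 //.
  by move=> h; rewrite -sqrtr_sqr ler_wsqrtr.
by move=> h; rewrite -[y ^+ 2]real_normK ?num_real // -[leRHS](sqr_sqrtr ca) lerXn2r ?nnegrE ?sqrtr_ge0.
Qed.

Lemma lee_of_lt_EFin (b z : \bar R) :
  (forall c : R, (c%:E < b)%E -> (c%:E <= z)%E) -> (b <= z)%E.
Proof.
move=> h; rewrite leNgt; apply/negP; case: b z h => [b||] [z||] //= h.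
- rewrite lte_fin => zb; have := h ((b + z) / 2); rewrite lte_fin lee_fin => h'.
  by have := h' ltac:(lra); lra.
- by move=> _; have := h (b - 1); rewrite lte_fin ltrBlDr ltrDl ltr01 => /(_ isT).
- by move=> _; have := h (z + 1) (ltry _); rewrite lee_fin gerDl leNgt ltr01.
- by move=> _; have := h 0 (ltry _).
Qed.

Let muE n (A : set R) (n0 : (0 < n)%N) (mA : measurable A) :
  mu n A = (fine (Ps n (@Z n @^-1` A `&` @D n)) / Lam n 0)%:E.
Proof. exact: (cond_lawE (mD n0) (mZ n0) (LamE0 n0) (Lam00 n0)). Qed.

Let mu_le1 n (A : set R) : (0 < n)%N -> measurable A -> (mu n A <= 1)%E.
Proof.
move=> n0 mA; rewrite muE // lee_fin ler_pdivrMr ?Lam00 // mul1r.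
have := cond_prob_den (mD n0) (LamE0 n0) => PD.
have mZA : measurable (@Z n @^-1` A) by rewrite -[X in measurable X]setTI; apply: mZ.
rewrite -lee_fin fineK; last by apply: fin_num_measure; apply: measurableI => //; exact: mD.
rewrite -PD; apply: le_measure; rewrite ?inE //; [|exact: mD].
by apply: measurableI => //; exact: mD.
Qed.

Lemma scaled_lne_le (x : \bar R) (B c : R) : (0 <= x)%E -> (x <= B%:E)%E -> 0 < B ->
  0 < c -> (c%:E * lne x <= (c * ln B)%:E)%E.
Proof.
move=> x0 xB B0 c0; rewrite EFinM; apply: lee_wpmul2l; first by rewrite lee_fin ltW.
rewrite -lne_EFin // lee_lne // in_itv /=; first by rewrite x0 leey.
by rewrite lee_fin ltW // leey.
Qed.

(** It suffices to reach every real [c] below the infimum of [J] on the closure. For [c < 0] the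
    trivial bound 1 is enough; otherwise [A] avoids a neighbourhood of 0, and Chernoff applies at
    its radius [del]. *)
Lemma ldp_upper (A : set R) : measurable A ->
  (limn_esup (fun n => (a n)%:E * lne (mu n A)) <= - ereal_inf (J @` closure A))%E.
Proof.
move=> mA; rewrite leeNr; apply: lee_of_lt_EFin => c cb; rewrite leeNr.
have Jc y : A y -> (c%:E < J y)%E.
  move=> Ay; apply: lt_le_trans cb _; apply: ereal_inf_lbound.
  by exists y => //; exact: subset_closure.
have mu0 n : (0 < n)%N -> (0 <= mu n A)%E.
  move=> n0; rewrite muE // lee_fin divr_ge0 ?fine_ge0 //; exact/ltW/Lam00.
have [c0|c0] := ltP c 0.
  apply: limn_esup_le_near; near=> n.
  have n0 : (0 < n)%N by near: n; exact: nbhs_infty_gt.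
  apply: le_trans (scaled_lne_le (mu0 _ n0) (mu_le1 n0 mA) ltr01 (a0 n0)) _.
  by rewrite ln1 mulr0 lee_fin oppr_ge0 ltW.
(* For [alpha2 > 0], [J y > c] means [|y| > sqrt (2 alpha2 c)], which is [del], and
   [l = del / alpha2] maximises [l del - l^2 alpha2 / 2]. For [alpha2 = 0] any ball of radius [e]
   missing the closure works, with [l = c / e]. *)
have [del [l [l0 Adel dl]]] : exists del l : R, [/\ 0 <= l, forall y, A y -> del <= `|y| &
    c <= l * del - l ^+ 2 * alpha2 / 2].
  case: alpha2_cases => [al0|al0].
    have nA0 : ~ closure A 0.
      move=> cA0; have : (ereal_inf (J @` closure A) <= J 0)%E.
        by apply: ereal_inf_lbound; exists 0.
      rewrite quadratic_rate0 // eqxx => /(lt_le_trans cb); rewrite lte_fin.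
      by move=> /(le_lt_trans c0); rewrite ltxx.
    have oA : open (~` closure A) by rewrite openC; exact: closed_closure.
    have /nbhs_ballP[e /= e0 eA] := oA 0 nA0.
    exists e, (c / e); split.
    - by rewrite divr_ge0 // ltW.
    - move=> y Ay; rewrite leNgt; apply/negP => ye; apply: (eA y).
        by rewrite /ball /= sub0r normrN.
      exact: subset_closure.
    - by rewrite al0 mulr0 mul0r subr0 divfK // gt_eqF.
  have ca : 0 <= c * (2 * alpha2) by rewrite mulr_ge0 // mulr_ge0.
  pose del := Num.sqrt (c * (2 * alpha2)).
  exists del, (del / alpha2); split.
  - by rewrite divr_ge0 ?sqrtr_ge0.
  - move=> y /Jc; rewrite quadratic_rate_gt0 // lte_fin ltr_pdivlMr ?mulr_gt0 // => h.
    by rewrite -sqrtr_sqr ler_wsqrtr // ltW.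
  - have -> : del / alpha2 * del - (del / alpha2) ^+ 2 * alpha2 / 2 =
      del ^+ 2 / (2 * alpha2) by field; rewrite gt_eqF.
    by rewrite sqr_sqrtr // mulfK // gt_eqF // mulr_gt0.
apply/lee_addgt0Pr => e e0; apply: limn_esup_le_near.
have l2 : 0 < ln 2 :> R by rewrite ln_gt0 // ltr1n.
have e20 : 0 < e / 2 by rewrite divr_gt0.
have r1 := laplace_ratio_bounds l e20; have r2 := laplace_ratio_bounds (- l) e20.
near=> n.
have n0 : (0 < n)%N by near: n; exact: nbhs_infty_gt.
have [b1 _] : Lam n l / Lam n 0 <= expR ((l ^+ 2 * alpha2 / 2 + e / 2) / a n) /\
  expR ((l ^+ 2 * alpha2 / 2 - e / 2) / a n) <= Lam n l / Lam n 0 by near: n; exact: r1.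
have [b2 _] : Lam n (- l) / Lam n 0 <= expR (((- l) ^+ 2 * alpha2 / 2 + e / 2) / a n) /\
  expR (((- l) ^+ 2 * alpha2 / 2 - e / 2) / a n) <= Lam n (- l) / Lam n 0
  by near: n; exact: r2.
rewrite sqrrN in b2.
have an2 : a n * ln 2 < e / 2.
  rewrite -ltr_pdivlMr //; near: n.
  by apply: a_small; rewrite divr_gt0.
have an0 := a0 n0.
(* The 2 counts the two tails; it costs [a n * ln 2], eventually below [e / 2]. *)
pose B := 2 * expR ((- c + e / 2) / a n).
have muB : (mu n A <= B%:E)%E.
  have L1 : isLam n l by near: n; exact: LamE.
  have L2 : isLam n (- l) by near: n; exact: LamE.
  apply: le_trans (cond_law_le (mD n0) (mZ n0) an0 (LamE0 n0) (Lam00 n0) mA Adel l0 L1 L2) _.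
  rewrite lee_fin /B.
  apply: (@le_trans _ _ (expR (- (l * del / a n)) * (2 * expR ((l ^+ 2 * alpha2 / 2 + e / 2) / a n)))).
    by apply: ler_wpM2l; [exact: expR_ge0|rewrite mulrDl !mul1r lerD].
  rewrite mulrCA ler_pM2l // -expRD ler_expR -mulNr -mulrDl ler_pM2r ?invr_gt0 //.
  by move: dl; lra.
have B0 : 0 < B by rewrite mulr_gt0 ?expR_gt0.
apply: le_trans (scaled_lne_le (mu0 _ n0) muB B0 an0) _.
rewrite -EFinN -EFinD lee_fin lnM ?posrE ?expR_gt0 // expRK mulrDr.
have -> : a n * ((- c + e / 2) / a n) = - c + e / 2 by field; rewrite gt_eqF.
by move: an2; lra.
Unshelve. all: by end_near. Qed.

(* With del = eps / (alpha2 + 1) the two tail terms of cond_law_ge are smaller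
   than the main one by a factor e^{-del eps / (2 a_n)}. *)
Lemma ldp_lower_point (A : set R) (y l : R) : measurable A -> interior A y ->
  y = l * alpha2 ->
  ((- (l ^+ 2 * alpha2 / 2))%:E <= limn_einf (fun n => (a n)%:E * lne (mu n A)))%E.
Proof.
move=> mA; rewrite /interior => /nbhs_ballP[e1 /= e10 eA] yl.
apply/lee_subgt0Pr => e e0; rewrite -EFinB; apply: limn_einf_ge_near.
have [eps [eps0 epsA epsl]] : exists eps, [/\ 0 < eps,
    forall z, `|z - y| < eps -> A z & `|l| * eps <= e / 4].
  exists (Num.min e1 (e / 4 / (`|l| + 1))).
  have l1 : 0 < `|l| + 1 by rewrite ltr_wpDl.
  have e2 : 0 < e / 4 / (`|l| + 1) by rewrite !divr_gt0.
  split.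
  - by rewrite lt_min e10.
  - move=> z; rewrite lt_min => /andP[z1 _]; apply: eA.
    by rewrite /ball /= distrC.
  - apply: (@le_trans _ _ ((`|l| + 1) * (e / 4 / (`|l| + 1)))).
      by apply: ler_pM => //; rewrite ?ge_min ?lexx ?orbT ?lerDl // le_min !ltW.
    by rewrite mulrC divfK // gt_eqF.
have al1 : 0 < alpha2 + 1 by rewrite ltr_wpDl.
pose del := eps / (alpha2 + 1).
have del0 : 0 < del by rewrite divr_gt0.
have ale : del * alpha2 <= eps.
  by rewrite /del mulrAC ler_pdivrMr // ler_pM2l // lerDl.
pose kap := del * eps / 2.
have kap0 : 0 < kap by rewrite divr_gt0 // mulr_gt0.
(* The bound [e / 4] limits the final loss, [kap / 4] keeps the tails below the main term;
   [kap = del eps / 2] is the gain in the tail exponents. *)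
pose eta := Num.min (e / 4) (kap / 4).
have eta0 : 0 < eta by rewrite lt_min !pmulr_lgt0 ?invr_gt0 // e0.
have [eta1 eta2] : eta <= e / 4 /\ eta <= kap / 4 by rewrite !ge_min !lexx ?orbT.
have l4 : 0 < ln 4 :> R by rewrite ln_gt0 // ltr1n.
have R0 := laplace_ratio_bounds l eta0.
have R1 := laplace_ratio_bounds (l + del) eta0.
have R2 := laplace_ratio_bounds (l - del) eta0.
near=> n.
have n0 : (0 < n)%N by near: n; exact: nbhs_infty_gt.
have [_ b0] : Lam n l / Lam n 0 <= expR ((l ^+ 2 * alpha2 / 2 + eta) / a n) /\
  expR ((l ^+ 2 * alpha2 / 2 - eta) / a n) <= Lam n l / Lam n 0 by near: n; exact: R0.
have [b1 _] : Lam n (l + del) / Lam n 0 <= expR (((l + del) ^+ 2 * alpha2 / 2 + eta) / a n) /\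
  expR (((l + del) ^+ 2 * alpha2 / 2 - eta) / a n) <= Lam n (l + del) / Lam n 0
  by near: n; exact: R1.
have [b2 _] : Lam n (l - del) / Lam n 0 <= expR (((l - del) ^+ 2 * alpha2 / 2 + eta) / a n) /\
  expR (((l - del) ^+ 2 * alpha2 / 2 - eta) / a n) <= Lam n (l - del) / Lam n 0
  by near: n; exact: R2.
have an0 := a0 n0.
have an1 : a n * ln 4 < kap / 2.
  rewrite -ltr_pdivlMr //; near: n.
  by apply: a_small; rewrite !pmulr_lgt0 ?invr_gt0.
have an2 : a n * ln 4 < e / 4.
  rewrite -ltr_pdivlMr //; near: n.
  by apply: a_small; rewrite !pmulr_lgt0 ?invr_gt0.
have L1 : isLam n l by near: n; exact: LamE.
have L2 : isLam n (l + del) by near: n; exact: LamE.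
have L3 : isLam n (l - del) by near: n; exact: LamE.
have := cond_law_ge (mD n0) (mZ n0) an0 (Lam00 n0) mA epsA (ltW del0) L1 L2 L3.
set mA_ := fine _ / _ => main.
set E := expR ((l ^+ 2 * alpha2 / 2 - eta) / a n) in b0.
have E0 : 0 < E by exact: expR_gt0.
(* The exponent gap [kap / (2 a n)] exceeds [ln 4] once [a n] is small, so each tail takes at most a
   quarter of the main term. *)
have quarter (c : R) : c <= l ^+ 2 * alpha2 / 2 - eta - kap / 2 -> expR (c / a n) <= E / 4.
  move=> hc; rewrite -[4]lnK ?posrE // -expRN -expRD ler_expR.
  rewrite -(ler_pM2l an0) mulrC divfK ?gt_eqF // mulrBr [_ * (_ / a n)]mulrC divfK ?gt_eqF //.
  by apply: le_trans hc _; rewrite lerD2l lerN2 ltW.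
have del2 : del * (del * alpha2) <= del * eps by rewrite ler_pM2l.
have [x1 x2] := tail_exponent_le l del2 eta2.
have t1 : expR (- (del * (y + eps) / a n)) * (Lam n (l + del) / Lam n 0) <= E / 4.
  apply: le_trans (ler_wpM2l (expR_ge0 _) b1) _.
  by rewrite -expRD -mulNr -mulrDl; apply: quarter; rewrite yl.
have t2 : expR (del * (y - eps) / a n) * (Lam n (l - del) / Lam n 0) <= E / 4.
  apply: le_trans (ler_wpM2l (expR_ge0 _) b2) _.
  by rewrite -expRD -mulrDl; apply: quarter; rewrite yl.
have E2 := half_le_of_quarters main b0 t1 t2.
have lowA : expR ((- (l ^+ 2 * alpha2 / 2) - eta - e / 4) / a n) / 2 <= mA_.
  rewrite -(ler_pM2l (expR_gt0 ((l * y + `|l| * eps) / a n))).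
  apply: le_trans E2; rewrite mulrA ler_pM2r // -expRD -mulrDl ler_expR ler_pM2r ?invr_gt0 //.
  by rewrite yl main_exponent_le.
rewrite muE // -/mA_.
have mA0 : 0 < mA_ by apply: lt_le_trans lowA; rewrite divr_gt0 ?expR_gt0.
rewrite lne_EFin // -EFinM lee_fin.
apply: (@le_trans _ _ (a n * ln (expR ((- (l ^+ 2 * alpha2 / 2) - eta - e / 4) / a n) / 2))).
  rewrite ln_div ?posrE ?expR_gt0 // expRK mulrBr [a n * (_ / _)]mulrC divfK ?gt_eqF //.
  have ln24 : a n * ln 2 <= a n * ln 4.
    by rewrite ler_pM2l // ler_ln ?posrE // ler_nat.
  apply: (@le_trans _ _ (- (l ^+ 2 * alpha2 / 2) - eta - e / 4 - e / 4)).
    exact: lower_exponent_le eta1 e0.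
  by rewrite lerD2l lerN2 (le_trans ln24) // ltW.
by rewrite ler_pM2l // ler_ln ?posrE // divr_gt0 ?expR_gt0.
Unshelve. all: by end_near. Qed.

(** The dual point of [y] is [l = y / alpha2]. When [alpha2 = 0] the bound is void except at
    [y = 0], where [l = 0] works. *)
Lemma ldp_lower (A : set R) : measurable A ->
  (- ereal_inf (J @` interior A) <= limn_einf (fun n => (a n)%:E * lne (mu n A)))%E.
Proof.
move=> mA; rewrite leeNl; apply: le_ereal_inf_tmp => _ [y Ay <-]; rewrite leeNl.
case: alpha2_cases => [al0|al0].
  rewrite quadratic_rate0 //; case: eqP => [y0|_]; last by rewrite leNye.
  have /= := @ldp_lower_point A y 0 mA Ay.
  by rewrite expr0n /= !mul0r oppr0 => /(_ y0).
have /= := @ldp_lower_point A y (y / alpha2) mA Ay.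
rewrite divfK ?gt_eqF // => /(_ erefl); apply: le_trans.
rewrite quadratic_rate_gt0 // -EFinN lee_fin lerN2.
by rewrite le_eqVlt; apply/orP; left; apply/eqP; field; rewrite gt_eqF.
Qed.

Lemma gaertner_ellis_quadratic : LDP mu J a /\ good_rate J.
Proof.
split; last exact: quadratic_rate_good.
split; [exact: quadratic_rate_ge0|exact: quadratic_rate_lsc|move=> A mA; split].
- exact: ldp_lower.
- exact: limn_einf_sup.
- exact: ldp_upper.
Qed.

End GaertnerEllis.

(** * Convergence in law under exponential moment bounds *)

Section Cutoff.
Context {R : realType}.
Implicit Types (u : nat * R) (M : R).

Definition weight u : R := u.1%:R + `|u.2|.

Lemma weight_ge0 u : 0 <= weight u.
Proof. by rewrite addr_ge0. Qed.

(** [nat] is discrete, so even the indicator of a fibre is a test function for convergence in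
    law. *)
Lemma continuous_nat_fst (f : nat -> R) : continuous (fun u : nat * R => f u.1).
Proof.
move=> u; apply: (@continuous_comp _ _ _ fst f); first exact: cvg_fst.
move=> A /nbhs_singleton hA.
suff : nbhs u.1 (f @^-1` A) by [].
by rewrite nbhs_principalE; apply/principal_filterP.
Qed.

Lemma measurable_nat_fst (f : nat -> R) : measurable_fun setT (fun u : nat * R => f u.1).
Proof. exact: (measurableT_comp (measurable_fun_nat f) measurable_fst). Qed.

Lemma continuous_weight : continuous weight.
Proof.
move=> u; apply: (@continuousD _ _ _ (fun v : nat * R => v.1%:R : R) (fun v => `|v.2|)).
  exact: (@continuous_nat_fst (fun k => k%:R) u).
by apply: cvg_norm; exact: cvg_snd.
Qed.

Lemma measurable_weight : measurable_fun setT weight.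
Proof.
apply: measurable_funD; first exact: (measurable_nat_fst (fun k => k%:R : R)).
exact: measurableT_comp measurable_snd.
Qed.

(** A continuous ramp from 1, where the weight is at most [M], to 0, where it exceeds [2 M]:
    convergence in law tests only bounded continuous functions. *)
Definition cutoff M u : R := Num.max 0 (Num.min 1 (2 - weight u / M)).

Lemma cutoff_ge0 M u : 0 <= cutoff M u.
Proof. by rewrite le_max lexx. Qed.

Lemma cutoff_le1 M u : cutoff M u <= 1.
Proof. by rewrite ge_max ler01 ge_min lexx. Qed.

Lemma cutoff_eq1 M u : 0 < M -> weight u <= M -> cutoff M u = 1.
Proof.
move=> M0 uM; have : weight u / M <= 1 by rewrite ler_pdivrMr // mul1r.
by move=> h; rewrite /cutoff min_l ?max_r //; lra.
Qed.

Lemma cutoff_eq0 M u : 0 < M -> 2 * M <= weight u -> cutoff M u = 0.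
Proof.
move=> M0 uM; have h : 2 <= weight u / M by rewrite ler_pdivlMr.
by rewrite /cutoff max_l // ge_min; apply/orP; right; lra.
Qed.

Lemma cutoff_mono M M' u : 0 < M -> M <= M' -> cutoff M u <= cutoff M' u.
Proof.
move=> M0 MM'; have M'0 := lt_le_trans M0 MM'.
rewrite /cutoff ge_max !le_max lexx /=; apply/orP; right.
rewrite le_min !ge_min lexx /= lerB // ?orbT // ler_wpM2l ?weight_ge0 // lef_pV2 //.
Qed.

Lemma continuous_cutoff M : continuous (cutoff M).
Proof.
move=> u.
have c1 : {for u, continuous (fun v => 2 - weight v / M : R^o)}.
  apply: (@continuousB _ R^o _ (cst 2) (fun v => weight v / M)); first exact: cst_continuous.
  by apply: (@continuousM R _ weight (cst M^-1)); [exact: continuous_weight|exact: cst_continuous].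
have c2 : {for u, continuous ((cst 1 : nat * R -> R^o) \min (fun v => 2 - weight v / M))}.
  by apply: continuous_min c1; exact: cst_continuous.
by have := @continuous_max R _ (cst 0) _ u (@cst_continuous _ _ _ _) c2.
Qed.

Lemma measurable_cutoff M : measurable_fun setT (cutoff M).
Proof.
apply: measurable_maxr => //; apply: measurable_minr => //.
apply: measurable_funB => //; apply: measurable_funM => //; exact: measurable_weight.
Qed.

End Cutoff.

(** * Convergence of expectations of unbounded functions *)

Section LawConvergence.
Context {R : realType} d (T : measurableType d) (P : probability T R).
Variables (X : T -> nat) (Y : T -> R).
Variables (dn : nat -> measure_display) (Tn : forall n, measurableType (dn n)).
Variables (Pn : forall n, probability (Tn n) R).
Variables (Xn : forall n, Tn n -> nat) (Yn : forall n, Tn n -> R).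
Hypotheses (mX : measurable_fun setT X) (mY : measurable_fun setT Y).
Hypotheses (mXn : forall n, measurable_fun setT (@Xn n)).
Hypotheses (mYn : forall n, measurable_fun setT (@Yn n)).
Hypothesis law : cvg_in_law Pn (fun n => pair_rv (@Xn n) (@Yn n)) P (pair_rv X Y).

Local Notation En n f := (\int[Pn n]_w f (pair_rv (@Xn n) (@Yn n) w)).
Local Notation E f := (\int[P]_w f (pair_rv X Y w)).

Lemma measurable_rv_comp d1 (U : measurableType d1) (X1 : U -> nat) (Y1 : U -> R)
    (f : nat * R -> R) : measurable_fun setT X1 -> measurable_fun setT Y1 ->
  measurable_fun setT f -> measurable_fun setT (fun w => f (pair_rv X1 Y1 w)).
Proof. by move=> mX1 mY1 mf; apply: (measurableT_comp mf); exact: measurable_pair_rv. Qed.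

Let mc n f (mf : measurable_fun setT f) := measurable_rv_comp (@mXn n) (@mYn n) mf.
Let m0 f (mf : measurable_fun setT f) := measurable_rv_comp mX mY mf.

Lemma bounded_Rintegral d1 (U : measurableType d1) (Q : probability U R)
    (f : U -> R) (M : R) : measurable_fun setT f -> (forall u, `|f u| <= M) ->
  (\int[Q]_w (f w)%:E = (\int[Q]_w f w)%:E)%E.
Proof.
move=> mf fM; rewrite /Rintegral fineK //; apply: integrable_fin_num => //.
have one : (\int[Q]_w ((cst 1 : U -> R) w)%:E <= 1%:E)%E.
  by rewrite (@integral_cst _ _ _ Q _ measurableT 1%:E) // mul1e; exact: probability_le1.
apply: (@dominated_integrable _ _ _ Q (cst 1) 1 (fun=> ler01) _ one) => //.
by split => //; exists M => w; rewrite mulr1.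
Qed.

Lemma cvg_law_bounded (f : nat * R -> R) (M : R) : continuous f -> measurable_fun setT f ->
  (forall u, `|f u| <= M) -> En n f @[n --> \oo] --> E f.
Proof.
move=> cf mf fM; have := law cf (ex_intro _ M fM).
rewrite unlock (bounded_Rintegral P (m0 mf) (fun w => fM _)).
under eq_fun => n do rewrite (bounded_Rintegral (Pn n) (mc mf) (fun w => fM _)).
exact: fine_cvg.
Qed.

Lemma ge0_Rintegral_le d1 (U : measurableType d1) (Q : probability U R)
    (f : U -> R) (c : R) : (forall w, 0 <= f w) ->
  (\int[Q]_w (f w)%:E <= c%:E)%E -> \int[Q]_w f w <= c.
Proof.
move=> f0; rewrite /Rintegral.
have : (0 <= \int[Q]_w (f w)%:E)%E by apply: integral_ge0 => w _; rewrite lee_fin.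
by case: (\int[Q]_w _)%E => [r||] // _; rewrite leey_eq.
Qed.

Variables (tau eta C : R).
Hypothesis eta0 : 0 < eta.

Definition expweight (tau eta : R) (u : nat * R) : R :=
  expR (tau * u.1%:R + eta * weight u).

Local Notation H := (expweight tau eta).
Hypothesis HCn : \forall n \near \oo, (\int[Pn n]_w (H (pair_rv (@Xn n) (@Yn n) w))%:E <= C%:E)%E.

Lemma expweight_ge0 t e u : 0 <= expweight t e u. Proof. exact: expR_ge0. Qed.

Lemma continuous_expweight t e : continuous (expweight t e).
Proof.
move=> u; apply: (@continuous_comp _ _ _ (fun v : nat * R => t * v.1%:R + e * weight v) expR);
  last exact: continuous_expR.
apply: (@continuousD _ _ _ (fun v : nat * R => t * v.1%:R : R) (fun v => e * weight v)).
  exact: (@continuous_nat_fst _ (fun k => t * k%:R) u).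
apply: (@continuousM _ _ (cst e) weight); [exact: cst_continuous|exact: continuous_weight].
Qed.

Lemma measurable_expweight t e : measurable_fun setT (expweight t e).
Proof.
apply: (measurableT_comp (@measurable_expR R)); apply: measurable_funD.
  exact: (measurable_nat_fst (fun k => t * k%:R : R)).
by apply: measurable_funM => //; exact: measurable_weight.
Qed.

Lemma cutoff_bound (f : nat * R -> R) (D M : R) : 0 < M -> 0 <= D ->
  (forall u, `|f u| <= D * H u) ->
  forall u, `|f u * cutoff M u| <= D * expR ((`|tau| + eta) * (2 * M)).
Proof.
move=> M0 D0 fH u; rewrite normrM (ger0_norm (cutoff_ge0 _ _)).
have [uM|uM] := leP (weight u) (2 * M); last first.
  by rewrite (cutoff_eq0 M0 (ltW uM)) mulr0 mulr_ge0 ?expR_ge0.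
apply: (@le_trans _ _ (`|f u|)); first by rewrite ler_piMr ?cutoff_le1.
apply: le_trans (fH u) _; apply: ler_wpM2l => //; rewrite ler_expR mulrDl.
apply: lerD; last by apply: ler_wpM2l => //; exact: ltW.
apply: (@le_trans _ _ (`|tau| * u.1%:R)); first by apply: ler_wpM2r => //; exact: ler_norm.
by apply: ler_wpM2l => //; apply: le_trans uM; rewrite lerDl.
Qed.

(** The bound passes to the limit law for each truncation of the envelope by convergence in law,
    then for the envelope itself by monotone convergence in the cutoff level. *)
Lemma expweight_limit_bound : (\int[P]_w (H (pair_rv X Y w))%:E <= C%:E)%E.
Proof.
pose f (k : nat) u := H u * cutoff k.+1%:R u.
have k0 (k : nat) : 0 < k.+1%:R :> R by rewrite ltr0n.
have mf k : measurable_fun setT (f k).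
  by apply: measurable_funM; [exact: measurable_expweight|exact: measurable_cutoff].
have f0 k u : 0 <= f k u by rewrite mulr_ge0 ?expweight_ge0 ?cutoff_ge0.
have fH k u : f k u <= H u by rewrite ler_piMr ?expweight_ge0 ?cutoff_le1.
have fB k u : `|f k u| <= 1 * expR ((`|tau| + eta) * (2 * k.+1%:R)).
  by apply: cutoff_bound => // v; rewrite mul1r ger0_norm ?expweight_ge0.
have cf k : continuous (f k).
  move=> u; apply: (@continuousM _ _ H (cutoff k.+1%:R)).
    exact: continuous_expweight.
  exact: continuous_cutoff.
have EC k : (\int[P]_w (f k (pair_rv X Y w))%:E <= C%:E)%E.
  rewrite (bounded_Rintegral P (m0 (mf k)) (fun w => fB k _)) lee_fin.
  apply: (cvgr_to_le (cvg_law_bounded (cf k) (mf k) (fB k))).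
  near=> n; apply: ge0_Rintegral_le => //.
  apply: (@le_trans _ _ (\int[Pn n]_w (H (pair_rv (@Xn n) (@Yn n) w))%:E)%E); last first.
    by near: n.
  apply: ge0_le_integral_real => //; first exact: mc.
  by apply: mc; exact: measurable_expweight.
rewrite (_ : (\int[P]_w _)%E =
    (\int[P]_w limn (fun k => (f k (pair_rv X Y w))%:E))%E); last first.
  apply: eq_integral => w _; apply/esym/cvg_lim => //.
  apply: cvg_near_cst; near=> k; rewrite /f cutoff_eq1 ?mulr1 //.
  apply: (@le_trans _ _ k%:R); last by rewrite ler_nat.
  by near: k; exact: nbhs_infty_ger.
rewrite (monotone_convergence P measurableT (g' := fun k w => (f k (pair_rv X Y w))%:E)).
- apply: lime_le; last by apply: nearW => k; exact: EC.
  apply: ereal_nondecreasing_is_cvgn => k l kl; apply: ge0_le_integral_real => //.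
  + exact: m0.
  + exact: m0.
  + by move=> w; rewrite ler_wpM2l ?expweight_ge0 // cutoff_mono // ler_nat.
- by move=> k; apply/measurable_EFinP; exact: m0.
- by move=> k w _; rewrite lee_fin.
- move=> w _ k l kl; rewrite lee_fin ler_wpM2l ?expweight_ge0 //.
  by rewrite cutoff_mono // ler_nat.
Unshelve. all: by end_near. Qed.

(** The gap between the exponents [eta / 2] and [eta] gives uniform integrability: where the weight
    exceeds [M], [|f|] is at most [D e^{- eta M / 2}] times the envelope, uniformly in [n]. *)
Lemma cvg_law_dominated (f : nat * R -> R) (D : R) : continuous f -> measurable_fun setT f ->
  (forall u, `|f u| <= D * expweight tau (eta / 2) u) -> En n f @[n --> \oo] --> E f.
Proof.
move=> cf mf fD.
have C0 : 0 <= C.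
  rewrite -lee_fin; apply: le_trans expweight_limit_bound.
  by apply: integral_ge0 => w _; rewrite lee_fin expweight_ge0.
have D0 : 0 <= D.
  have := fD (0%N, 0); rewrite -(pmulr_lge0 _ (expR_gt0 (tau * 0%:R + eta / 2 * weight (0%N, 0)))).
  by rewrite mulrC; exact/le_trans.
have HE u : expweight tau (eta / 2) u = expR (- (eta / 2 * weight u)) * H u.
  by rewrite -expRD; congr expR; field.
have fH u : `|f u| <= D * H u.
  apply: le_trans (fD u) _; apply: ler_wpM2l => //; rewrite HE ler_piMl ?expweight_ge0 //.
  by rewrite -[leRHS]expR0 ler_expR oppr_le0 mulr_ge0 ?weight_ge0 // ltW // divr_gt0.
have tail d1 (U : measurableType d1) (Q : probability U R) (X1 : U -> nat) (Y1 : U -> R) (M : R) :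
    measurable_fun setT X1 -> measurable_fun setT Y1 ->
    (\int[Q]_w (H (pair_rv X1 Y1 w))%:E <= C%:E)%E -> 0 < M ->
    `|\int[Q]_w f (pair_rv X1 Y1 w) - \int[Q]_w (f (pair_rv X1 Y1 w) * cutoff M (pair_rv X1 Y1 w))|
     <= D * expR (- (eta / 2 * M)) * C.
  move=> mX1 mY1 HC1 M0.
  have m1 := measurable_rv_comp mX1 mY1 mf.
  have m2 := measurable_rv_comp mX1 mY1 (measurable_cutoff M).
  apply: (norm_ExpB_le (fun w => expweight_ge0 tau eta (pair_rv X1 Y1 w)) _ HC1).
  - exact: measurable_rv_comp (measurable_expweight _ _).
  - by split => //; exists D => w.
  - split; first exact: measurable_funM.
    exists D => w; apply: le_trans (fH _); rewrite normrM (ger0_norm (cutoff_ge0 _ _)).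
    by rewrite ler_piMr ?cutoff_le1.
  - by rewrite mulr_ge0 ?expR_ge0.
  move=> w; set u := pair_rv _ _ _.
  have [uM|uM] := leP (weight u) M.
    by rewrite cutoff_eq1 // mulr1 subrr normr0 !mulr_ge0 ?expR_ge0.
  rewrite -[X in X - _]mulr1 -mulrBr normrM [`|1 - _|]ger0_norm ?subr_ge0 ?cutoff_le1 //.
  apply: (@le_trans _ _ (`|f u|)); first by rewrite ler_piMr // gerBl cutoff_ge0.
  apply: le_trans (fD u) _; rewrite -mulrA; apply: ler_wpM2l => //.
  rewrite HE ler_wpM2r ?expweight_ge0 // ler_expR lerN2; apply: ler_wpM2l; last exact: ltW.
  by rewrite divr_ge0 // ltW.
apply/cvgrPdist_le => /= e e0.
have e30 : 0 < e / 3 by rewrite divr_gt0.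
(* Chosen so that [expR t >= t >= D C / (e / 3)], which makes the tail [D C e^{-t}] at most
   [e / 3]. *)
pose t := D * C / (e / 3) + 1.
have t0 : 0 < t by rewrite ltr_wpDl // divr_ge0 ?mulr_ge0 // ltW.
pose M := 2 / eta * t.
have M0 : 0 < M by rewrite mulr_gt0 // divr_gt0.
have small : D * expR (- (eta / 2 * M)) * C <= e / 3.
  have -> : eta / 2 * M = t by rewrite /M; field; rewrite gt_eqF.
  rewrite mulrAC expRN ler_pdivrMr ?expR_gt0 //.
  apply: (@le_trans _ _ (e / 3 * t)).
    by rewrite /t mulrDr [e / 3 * (_ / _)]mulrC divfK ?gt_eqF // lerDl mulr1 ltW.
  by apply: ler_wpM2l; [exact: ltW|apply: le_trans (expR_ge1Dx t); rewrite lerDr].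
have tP := le_trans (tail _ _ P _ _ M mX mY expweight_limit_bound M0) small.
have cc : continuous (fun u => f u * cutoff M u).
  by move=> u; apply: (@continuousM _ _ f (cutoff M)); [exact: cf|exact: continuous_cutoff].
have mm : measurable_fun setT (fun u => f u * cutoff M u).
  by apply: measurable_funM => //; exact: measurable_cutoff.
have bc := cutoff_bound M0 D0 fH.
have /cvgrPdist_le/(_ _ e30) near3 := cvg_law_bounded cc mm bc.
near=> n.
have tn : `|En n f - En n (fun u => f u * cutoff M u)| <= e / 3.
  apply: le_trans small; apply: tail => //; by near: n.
have mid : `|E (fun u => f u * cutoff M u) - En n (fun u => f u * cutoff M u)| <= e / 3.
  by near: n.
move: tP tn mid.
set a1 := E f; set a2 := En n f; set b1 := \int[P]_w (_ * _); set b2 := \int[Pn n]_w (_ * _).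
have -> : a1 - a2 = (a1 - b1) + (b1 - b2) - (a2 - b2) by ring.
move=> h1 h2 h3; apply: le_trans (ler_normB _ _) _.
by have := ler_normD (a1 - b1) (b1 - b2); move: h1 h2 h3; lra.
Unshelve. all: by end_near. Qed.

(** Integrands that vary with [n] are allowed because the tilt parameter moves along the
    sequence. *)
Lemma cvg_law_perturbed (f : nat * R -> R) (fn : nat -> nat * R -> R) (D : R) (e : nat -> R) :
  continuous f -> measurable_fun setT f ->
  (forall u, `|f u| <= D * expweight tau (eta / 2) u) ->
  (forall n, measurable_fun setT (fn n)) ->
  (\forall n \near \oo, forall u, `|fn n u - f u| <= e n * H u) ->
  e n @[n --> \oo] --> 0 ->
  En n (fn n) @[n --> \oo] --> E f.
Proof.
move=> cf mf fD mfn fne ecvg.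
have C0 : 0 <= C.
  rewrite -lee_fin; apply: le_trans expweight_limit_bound.
  by apply: integral_ge0 => w _; rewrite lee_fin expweight_ge0.
rewrite -[X in _ --> X]add0r.
rewrite (_ : (fun n => En n (fn n)) = (fun n => (En n (fn n) - En n f) + En n f)); last first.
  by apply/funext => n; rewrite subrK.
apply: cvgD; last exact: cvg_law_dominated fD.
apply: norm_cvg0; apply: (@squeeze_cvgr _ _ _ _ (cst 0) (fun n => e n * C)).
- near=> n; rewrite normr_ge0 /=.
  have fe : forall u, `|fn n u - f u| <= e n * H u by near: n.
  have e0 : 0 <= e n.
    have := fe (0%N, 0); rewrite -(pmulr_lge0 _ (expR_gt0 (tau * 0%:R + eta * weight (0%N, 0)))).
    by rewrite mulrC; exact/le_trans.
  have D0 : 0 <= D.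
    have := fD (0%N, 0); rewrite -(pmulr_lge0 _ (expR_gt0 (tau * 0%:R + eta / 2 * weight (0%N, 0)))).
    by rewrite mulrC; exact/le_trans.
  have fH u : `|f u| <= D * H u.
    apply: le_trans (fD u) _; apply: ler_wpM2l => //; rewrite ler_expR lerD2l.
    by rewrite ler_wpM2r ?weight_ge0 // ler_pdivrMr // ler_peMr ?ler1n // ltW.
  apply: (norm_ExpB_le (fun w => expweight_ge0 tau eta (pair_rv (@Xn n) (@Yn n) w)) _ _ _ _ e0 (fun w => fe _)).
  + by apply: mc; exact: measurable_expweight.
  + by near: n.
  + split; first exact: mc.
    exists (e n + D) => w; rewrite mulrDl; set u := pair_rv _ _ _.
    have -> : fn n u = (fn n u - f u) + f u by rewrite subrK.
    by apply: le_trans (ler_normD _ _) (lerD _ _).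
  + by split; [exact: mc|exists D => w].
- exact: cvg_cst.
- by rewrite -[X in _ --> X](mul0r C); apply: cvgM => //; exact: cvg_cst.
Unshelve. all: by end_near. Qed.

End LawConvergence.

(** * Moment generating functions and tilting *)

Section MomentGeneratingFunction.
Context {R : realType} d (T : measurableType d) (P : probability T R).
Variable X : T -> nat.
Hypothesis mX : measurable_fun setT X.

Local Notation mgf t := (\int[P]_w expR (t * (X w)%:R)).

Let mXf (f : nat -> R) : measurable_fun setT (fun w => f (X w)).
Proof. exact: (measurableT_comp (measurable_fun_nat f)). Qed.

Lemma mmt_gen_funE t : ('M_P (toR X) t = \int[P]_w (expR (t * (X w)%:R))%:E)%E.
Proof.
by rewrite /mmt_gen_fun unlock; apply: eq_integral => w _; rewrite /= mulrC.
Qed.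

Lemma psiE t : psi P (toR X) t = ln (mgf t).
Proof. by rewrite /psi mmt_gen_funE. Qed.

Lemma psi_dom_integrable t : psi_dom P (toR X) t ->
  P.-integrable setT (EFin \o (fun w => expR (t * (X w)%:R))).
Proof.
rewrite /psi_dom /= mmt_gen_funE => h; apply/integrableP; split.
  by apply/measurable_EFinP; exact: (mXf (fun k => expR (t * k%:R))).
by under eq_integral do rewrite /= ger0_norm ?expR_ge0 //.
Qed.

Let interior_ball t : interior (psi_dom P (toR X)) t ->
  exists e : R, 0 < e /\ forall s, `|s - t| < e -> psi_dom P (toR X) s.
Proof.
move=> /nbhs_ballP[e /= e0 be]; exists e; split => // s st; apply: be.
by rewrite /ball /= distrC.
Qed.

Lemma natr_le_expR (c : R) (k : nat) : 0 < c -> k%:R <= c^-1 * expR (c * k%:R).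
Proof.
move=> c0; rewrite ler_pdivlMl //.
by apply: le_trans (expR_ge1Dx _); rewrite lerDr.
Qed.

Lemma derivable_mgf (t : R) : interior (psi_dom P (toR X)) t ->
  P.-integrable setT (EFin \o (fun w => (X w)%:R * expR (t * (X w)%:R))) /\
  is_derive t 1 (fun s => mgf s) (\int[P]_w ((X w)%:R * expR (t * (X w)%:R))).
Proof.
move=> /interior_ball[e [e0 he]].
pose u := t - e / 2; pose v := t + e / 2.
have dom (s : R) : `]u, v[%classic s -> psi_dom P (toR X) s.
  rewrite /= in_itv /= => /andP[h1 h2]; apply: he; rewrite ltr_norml.
  by move: h1 h2; rewrite /u /v => h1 h2; apply/andP; split; lra.
have e4 : 0 < e / 4 by rewrite divr_gt0.
(* Dominates the derivative for all parameters up to [t + e / 2]; the extra [e / 4] absorbs the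
   factor [X], and [t + 3 e / 4] is still in the domain. *)
pose G w : R := (e / 4)^-1 * expR ((t + 3 * e / 4) * (X w)%:R).
have dG : psi_dom P (toR X) (t + 3 * e / 4).
  by apply: he; rewrite ltr_norml; apply/andP; split; lra.
have iG : P.-integrable setT (EFin \o G).
  exact: integrableZl (psi_dom_integrable dG).
have XG (s : R) w : `]u, v[%classic s -> `|(X w)%:R * expR (s * (X w)%:R)| <= G w.
  rewrite /= in_itv /= => /andP[_ h2].
  rewrite ger0_norm ?mulr_ge0 ?expR_ge0 //.
  have -> : G w = ((e / 4)^-1 * expR (e / 4 * (X w)%:R)) * expR (v * (X w)%:R).
    by rewrite -mulrA -expRD; congr (_ * expR _); rewrite /v; field.
  apply: ler_pM; rewrite ?expR_ge0 //; first exact: natr_le_expR.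
  by rewrite ler_expR ler_wpM2r // ltW.
have ut : `]u, v[%classic t by rewrite /= in_itv /= /u /v; apply/andP; split; lra.
pose f (s : R) (w : T) : R := expR (s * (X w)%:R).
have d1f (s : R) w : is_derive s (1 : R) (f ^~ w : R -> R) ((X w)%:R * f s w).
  rewrite /f mulrC; apply: is_derive1_comp.
  by apply: is_derive_eq; rewrite scaler0 add0r scaler1.
have pf (s : R) w : partial1of2 f s w = (X w)%:R * f s w.
  by rewrite /partial1of2 derive1E; have [_ ->] := d1f s w.
split.
  apply: (@le_integrable _ _ _ P _ measurableT _ (EFin \o G)) => //.
    by apply/measurable_EFinP; exact: (mXf (fun k => k%:R * expR (t * k%:R))).
  move=> w _ /=; rewrite lee_fin; apply: le_trans (XG t w ut) _; exact: ler_norm.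
have G0 w : 0 <= G w by rewrite mulr_ge0 ?expR_ge0 // invr_ge0 ltW.
have int (s : R) : `]u, v[%classic s -> P.-integrable setT (EFin \o f s).
  by move=> us; exact/psi_dom_integrable/dom.
have der (s : R) w : `]u, v[%classic s -> [set: T] w -> derivable (f ^~ w) s 1.
  by move=> _ _; have [] := d1f s w.
have ub (s : R) w : `]u, v[%classic s -> [set: T] w -> `|partial1of2 f s w| <= G w.
  by move=> us _; rewrite pf; exact: XG.
split; first exact: (derivable_under_integral measurableT ut int der G0 iG ub).
rewrite -derive1E (differentiation_under_integral measurableT ut int der G0 iG ub).
by apply: eq_Rintegral => w _; rewrite pf.
Qed.

(** As [psi'] is the quotient of the derivative of the transform by the transform, [psi' t = x] says
    that the tilted mean is [x]. Without the denominator, the condition can be compared at different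
    parameters. *)
Lemma derive1_psi_centered (t x : R) : interior (psi_dom P (toR X)) t ->
  0 < mgf t -> derive1 (psi P (toR X)) t = x ->
  P.-integrable setT (EFin \o (fun w => ((X w)%:R - x) * expR (t * (X w)%:R))) /\
  \int[P]_w (((X w)%:R - x) * expR (t * (X w)%:R)) = 0.
Proof.
move=> it M0 dx; have [iX dM] := derivable_mgf it.
have iM := psi_dom_integrable (interior_subset it).
have dpsi : is_derive t (1 : R) (psi P (toR X))
    ((mgf t)^-1 * \int[P]_w ((X w)%:R * expR (t * (X w)%:R))).
  rewrite (_ : psi P (toR X) = (@ln R) \o (fun s => mgf s)); last first.
    by apply/funext => s; rewrite psiE.
  apply: is_derive1_comp; exact: is_derive1_ln.
have ex : \int[P]_w ((X w)%:R * expR (t * (X w)%:R)) = x * mgf t.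
  move: dx; rewrite derive1E; have [_ ->] := dpsi => <-.
  by rewrite mulrAC mulVf ?mul1r // gt_eqF.
have E w : ((X w)%:R - x) * expR (t * (X w)%:R) =
    (X w)%:R * expR (t * (X w)%:R) - x * expR (t * (X w)%:R) by rewrite mulrBl.
have iB := integrableZl measurableT x iM.
split.
  under [X in _.-integrable _ X]eq_fun => w do rewrite /= E EFinB EFinM.
  exact: integrableB.
under eq_Rintegral do rewrite E.
by rewrite RintegralB // RintegralZl // ex subrr.
Qed.

(** The difference is [e^{s k} (k - x) (e^{(t-s) k} - e^{(t-s) x})], and the last two factors have
    the same sign. Integrated, this stands in for the convexity of [psi]; the equality case gives
    strict convexity. *)
Lemma slope_expR_mono (s t x k : R) : s <= t ->
  expR ((t - s) * x) * ((k - x) * expR (s * k)) <= (k - x) * expR (t * k) ?= iff (s == t) || (k == x).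
Proof.
move=> st; rewrite mulrCA -expRD; split.
  have [x0|x0] := leP x k.
    apply: ler_wpM2l; first by rewrite subr_ge0.
    rewrite ler_expR -subr_ge0; have -> : t * k - ((t - s) * x + s * k) =
      (t - s) * (k - x) by ring.
    by rewrite mulr_ge0 // subr_ge0.
  apply: ler_wnM2l; first by rewrite subr_le0 ltW.
  rewrite ler_expR -subr_ge0; have -> : (t - s) * x + s * k - t * k =
    (t - s) * (x - k) by ring.
  by rewrite mulr_ge0 // subr_ge0 // ltW.
have [->|kx] := eqVneq k x; first by rewrite subrr !mul0r eqxx orbT.
have k0 : k - x != 0 by rewrite subr_eq0.
rewrite (inj_eq (mulfI k0)) (inj_eq (@expR_inj R)) orbF -subr_eq0.
have -> : (t - s) * x + s * k - t * k = (s - t) * (k - x) by ring.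
by rewrite mulf_eq0 (negbTE k0) orbF subr_eq0.
Qed.

Lemma tilted_mean_mono (s t x : R) : s <= t ->
  P.-integrable setT (EFin \o (fun w => ((X w)%:R - x) * expR (s * (X w)%:R))) ->
  P.-integrable setT (EFin \o (fun w => ((X w)%:R - x) * expR (t * (X w)%:R))) ->
  expR ((t - s) * x) * \int[P]_w (((X w)%:R - x) * expR (s * (X w)%:R)) <=
  \int[P]_w (((X w)%:R - x) * expR (t * (X w)%:R)).
Proof.
move=> st hs ht; rewrite -RintegralZl //.
apply: le_Rintegral => //; first exact: (integrableZl measurableT _ hs).
by move=> w _; rewrite slope_expR_mono.
Qed.

Lemma not_constant_support (x : R) : ~ (exists c : nat, P (X @^-1` [set c]) = 1%E) ->
  exists k : nat, (0 < P (X @^-1` [set k]))%E /\ k%:R != x.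
Proof.
move=> nc; apply: contrapT => h; apply: nc.
have mk (k : nat) : measurable (X @^-1` [set k]).
  by rewrite -[X in measurable X]setTI; apply: mX.
have h0 (k : nat) : k%:R != x -> P (X @^-1` [set k]) = 0%E.
  move=> kx; apply/eqP; rewrite eq_le measure_ge0 andbT leNgt; apply/negP => pk.
  by apply: h; exists k.
pose F (k : nat) := if k%:R != x then X @^-1` [set k] else set0.
have mF k : measurable (F k) by rewrite /F; case: ifP.
pose B := \bigcup_k F k.
have mB : measurable B by exact: bigcup_measurable.
have B0 : P B = 0%E.
  apply: measure_negligible => //; apply: negligible_bigcup => k; apply/negligibleP => //.
  by rewrite /F; case: ifP => [/h0|_]; rewrite ?measure0.
have PB : P (~` B) = 1%E by rewrite probability_setC // B0 sube0.
have [w Bw] : (~` B) !=set0.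
  by apply/set0P; apply/eqP => e; move: PB; rewrite e measure0 => /eqP; rewrite eqe eq_sym oner_eq0.
have Bx v : (~` B) v -> (X v)%:R = x.
  move=> Bv; apply/eqP; apply: contrapT => /negP vx; apply: Bv.
  by exists (X v) => //; rewrite /F vx.
exists (X w); apply/eqP; rewrite eq_le probability_le1 //= -PB; apply: le_measure.
- by rewrite inE; exact: measurableC.
- by rewrite inE.
- move=> v Bv /=; apply/eqP; rewrite -(eqr_nat R); apply/eqP.
  by rewrite (Bx _ Bv) (Bx _ Bw).
Qed.

Lemma Rintegral_gt0_fiber (g : nat -> R) (k : nat) : (forall j, 0 <= g j) ->
  P.-integrable setT (EFin \o (fun w => g (X w))) ->
  (0 < P (X @^-1` [set k]))%E -> 0 < g k -> 0 < \int[P]_w g (X w).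
Proof.
move=> g0 ig pk gk.
have mk : measurable (X @^-1` [set k]) by rewrite -[X in measurable X]setTI; apply: mX.
apply: (@lt_le_trans _ _ (g k * fine (P (X @^-1` [set k])))).
  by rewrite mulr_gt0 // fine_gt0 // pk /= ltey_eq fin_num_measure.
have -> : fine (P (X @^-1` [set k])) = \int[P]_w (\1_(X @^-1` [set k]) w : R).
  by rewrite /Rintegral integral_indic // setIT.
have iI : P.-integrable setT (EFin \o (\1_(X @^-1` [set k]) : T -> R)).
  by apply: integrable_indic.
rewrite -RintegralZl //; apply: le_Rintegral => //.
  exact: (integrableZl measurableT _ iI).
move=> w _; rewrite indicE; have [|_] := boolP (w \in _); last by rewrite mulr0.
by rewrite inE /= => ->; rewrite mulr1.
Qed.

Lemma tilted_mean_strict_mono (s t x : R) : s < t ->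
  ~ (exists c : nat, P (X @^-1` [set c]) = 1%E) ->
  P.-integrable setT (EFin \o (fun w => ((X w)%:R - x) * expR (s * (X w)%:R))) ->
  P.-integrable setT (EFin \o (fun w => ((X w)%:R - x) * expR (t * (X w)%:R))) ->
  expR ((t - s) * x) * \int[P]_w (((X w)%:R - x) * expR (s * (X w)%:R)) <
  \int[P]_w (((X w)%:R - x) * expR (t * (X w)%:R)).
Proof.
move=> st nc hs ht; have [k [pk kx]] := not_constant_support x nc.
have hs' := integrableZl measurableT (expR ((t - s) * x)) hs.
rewrite -RintegralZl // -subr_gt0 -RintegralB //.
have sm j := slope_expR_mono x j (ltW st).
apply: (@Rintegral_gt0_fiber (fun j : nat => (j%:R - x) * expR (t * j%:R) -
  expR ((t - s) * x) * ((j%:R - x) * expR (s * j%:R))) k) => //.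
- by move=> j; rewrite subr_ge0 sm.
- exact: (integrableB measurableT ht hs').
- by rewrite subr_gt0 (lt_leif (sm k%:R)) negb_or lt_eqF.
Qed.

End MomentGeneratingFunction.

Section Span.
Context {R : realType} d (T : measurableType d) (P : probability T R).

Lemma rv_span1 (X : T -> nat) : rv_span P X = 1%E ->
  forall m b : nat, supp_nat P X `<=` [set (m * j + b)%N | j in [set: nat]] -> (m <= 1)%N.
Proof.
move=> s1 m b h; have : ((m%:R)%:E <= rv_span P X)%E.
  by apply: ereal_sup_ubound; exists m => //; exists b.
by rewrite s1 lee_fin lern1.
Qed.

End Span.

(** * Expectations under the tilted law *)

Section TiltedExpectation.
Context {R : realType} d d' (T : measurableType d) (T' : measurableType d').
Variables (P : probability T R) (X : T -> nat) (Y : T -> R) (xi : R).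
Variables (P' : probability T' R) (X' : T' -> nat) (Y' : T' -> R).
Hypotheses (mX : measurable_fun setT X) (mY : measurable_fun setT Y).
Hypotheses (mX' : measurable_fun setT X') (mY' : measurable_fun setT Y').
Hypothesis tilt : tilted_vector P X Y xi P' X' Y'.

Let c := expR (- psi P (toR X) xi).

Let mpX (g : nat * R -> R) : measurable_fun setT g ->
  measurable_fun setT (fun w => g (pair_rv X Y w)).
Proof. exact: measurable_rv_comp. Qed.

Let mexpX : measurable_fun setT (fun w => expR (xi * (X w)%:R) : R).
Proof. exact: (measurableT_comp (measurable_fun_nat (fun k => expR (xi * k%:R)))). Qed.

Let tilted_integral_c (g : nat * R -> R) :
  measurable_fun setT g -> (forall v, 0 <= g v) ->
  (\int[P']_w (g (pair_rv X' Y' w))%:E =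
   \int[P]_w (c * (expR (xi * (X w)%:R) * g (pair_rv X Y w)))%:E)%E.
Proof.
move=> mg g0; have -> := tilted_integral mX mY mX' mY' tilt mg g0.
by apply: eq_integral => w _; rewrite mulrA -expRD [xi * _]mulrC.
Qed.

Lemma tilted_ge0_integral (g : nat * R -> R) :
  measurable_fun setT g -> (forall v, 0 <= g v) ->
  (\int[P']_w (g (pair_rv X' Y' w))%:E =
   c%:E * \int[P]_w (expR (xi * (X w)%:R) * g (pair_rv X Y w))%:E)%E.
Proof.
move=> mg g0; rewrite tilted_integral_c // ge0_integralZl_real //.
- by apply: measurable_funM => //; exact: mpX.
- by move=> w; rewrite mulr_ge0 ?expR_ge0.
- exact: expR_ge0.
Qed.

(** Read off from the total mass 1 of the tilted law. It also gives finiteness, since [c > 0] times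
    [+oo] is not 1. *)
Lemma tilt_normalization : c * \int[P]_w expR (xi * (X w)%:R) = 1 /\
  psi_dom P (toR X) xi.
Proof.
have e1 : (\int[P']_w (cst 1%E : T' -> \bar R) w = 1)%E.
  by rewrite integral_cst // mul1e; exact: probability_setT.
have := @tilted_ge0_integral (cst 1) (@measurable_cst _ _ _ _ _ _) (fun=> ler01).
move=> /(etrans (esym e1)).
under eq_integral do rewrite mulr1.
rewrite /psi_dom /= mmt_gen_funE /Rintegral; set I := (\int[P]_w _)%E => h.
have c0 : 0 < c by exact: expR_gt0.
have I0 : (0 <= I)%E by apply: integral_ge0 => w _; rewrite lee_fin expR_ge0.
case: I I0 h => [r||] //= _.
  by move=> [h]; split; [rewrite -h|exact: ltry].
by rewrite gt0_muley ?lte_fin.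
Qed.

Lemma tilted_mgf_gt0 : 0 < \int[P]_w expR (xi * (X w)%:R).
Proof.
have [h _] := tilt_normalization.
by rewrite -(pmulr_rgt0 _ (expR_gt0 (- psi P (toR X) xi))) h.
Qed.

Lemma tilted_Rintegral (g : nat * R -> R) : measurable_fun setT g ->
  P.-integrable setT (EFin \o (fun w => expR (xi * (X w)%:R) * g (pair_rv X Y w))) ->
  \int[P']_w g (pair_rv X' Y' w) =
  (\int[P]_w (expR (xi * (X w)%:R) * g (pair_rv X Y w))) / \int[P]_w expR (xi * (X w)%:R).
Proof.
move=> mg ig; have [h _] := tilt_normalization; have M0 := tilted_mgf_gt0.
have -> : (\int[P]_w expR (xi * (X w)%:R))^-1 = c.
  by rewrite -[RHS](mulfK (lt0r_neq0 M0)) h mul1r.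
rewrite mulrC -RintegralZl //; rewrite /Rintegral; congr fine.
rewrite integralE [RHS]integralE; congr (_ - _)%E.
- transitivity (\int[P']_w (Num.max (g (pair_rv X' Y' w)) 0)%:E)%E.
    by apply: eq_integral => w _; rewrite funeposE /= -EFin_max.
  rewrite (@tilted_integral_c (fun v => Num.max (g v) 0)).
  + apply: eq_integral => w _; rewrite funeposE /= -EFin_max; congr EFin.
    by rewrite !maxr_pMr ?expR_ge0 // !mulr0.
  + exact: measurable_maxr.
  + by move=> v; rewrite le_max lexx orbT.
- transitivity (\int[P']_w (Num.max (- g (pair_rv X' Y' w)) 0)%:E)%E.
    by apply: eq_integral => w _; rewrite funenegE /= -EFin_max.
  rewrite (@tilted_integral_c (fun v => Num.max (- g v) 0)).
  + apply: eq_integral => w _; rewrite funenegE /= -EFin_max; congr EFin.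
    by rewrite !maxr_pMr ?expR_ge0 // !mulr0 !mulrN.
  + by apply: measurable_maxr => //; exact: measurable_funN.
  + by move=> v; rewrite le_max lexx orbT.
Qed.

Lemma tilted_fiber (k : nat) :
  P' (X' @^-1` [set k]) = ((expR (- psi P (toR X) xi + k%:R * xi))%:E * P (X @^-1` [set k]))%E.
Proof.
by have := tilt k measurableT; rewrite !preimage_setT !setIT.
Qed.

End TiltedExpectation.

Section Subexponential.
Context {R : realType}.
Variable eta : R.
Hypothesis eta0 : 0 < eta.
Implicit Types (g : nat * R -> R) (u : nat * R).

(** The admissible moment functions. The exponent is shared out: [eta / 4] for the growth of [g] and
    [eta / 4] for the tilt beyond [tau], which together stay within the [eta / 2] of
    [cvg_law_dominated]. *)
Definition subexp g :=
  [/\ continuous g, measurable_fun setT g &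
      exists D : R, 0 <= D /\ forall u, `|g u| <= D * expR (eta / 4 * weight u)].

Let eta4 : 0 < eta / 4. Proof. by rewrite divr_gt0. Qed.

Lemma weight_le_expR u : weight u <= (eta / 4)^-1 * expR (eta / 4 * weight u).
Proof.
rewrite ler_pdivlMl //.
by apply: le_trans (expR_ge1Dx _); rewrite lerDr.
Qed.

Lemma sqr_weight_le_expR u :
  weight u ^+ 2 <= 2 * (eta / 4)^-1 ^+ 2 * expR (eta / 4 * weight u).
Proof.
have h : (eta / 4 * weight u) ^+ 2 / 2 <= expR (eta / 4 * weight u).
  have y0 : 0 <= eta / 4 * weight u by rewrite mulr_ge0 ?weight_ge0 // ltW.
  by apply: le_trans (expR_ge1Dxn 1 y0); rewrite lerDr.
have -> : weight u ^+ 2 = 2 * (eta / 4)^-1 ^+ 2 * ((eta / 4 * weight u) ^+ 2 / 2).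
  by field; rewrite gt_eqF.
by apply: ler_wpM2l => //; rewrite mulr_ge0 // exprn_ge0 // invr_ge0 ltW.
Qed.

Lemma subexp_weight g : continuous g -> measurable_fun setT g ->
  (forall u, `|g u| <= weight u) -> subexp g.
Proof.
move=> cg mg gw; split => //; exists (eta / 4)^-1; split; first by rewrite invr_ge0 ltW.
by move=> u; apply: le_trans (gw u) _; exact: weight_le_expR.
Qed.

Lemma subexp_sqr_weight g : continuous g -> measurable_fun setT g ->
  (forall u, `|g u| <= weight u ^+ 2) -> subexp g.
Proof.
move=> cg mg gw; split => //; exists (2 * (eta / 4)^-1 ^+ 2); split.
  by rewrite mulr_ge0 // exprn_ge0 // invr_ge0 ltW.
by move=> u; apply: le_trans (gw u) _; exact: sqr_weight_le_expR.
Qed.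

Lemma subexp_le1 g : continuous g -> measurable_fun setT g ->
  (forall u, `|g u| <= 1) -> subexp g.
Proof.
move=> cg mg gw; split => //; exists 1; split => // u; rewrite mul1r.
apply: le_trans (gw u) _; rewrite -[leLHS]expR0 ler_expR.
by rewrite mulr_ge0 ?weight_ge0 // ltW.
Qed.

Definition fst_fun u : R := u.1%:R.
Definition snd_fun u : R := u.2.

Let c1 : continuous fst_fun. Proof. by move=> u; exact: (@continuous_nat_fst R (fun k => k%:R) u). Qed.
Let m1 : measurable_fun setT fst_fun.
Proof. exact: (measurable_nat_fst (fun k => k%:R : R)). Qed.
Let c2 : continuous snd_fun. Proof. by move=> u; exact: cvg_snd. Qed.
Let m2 : measurable_fun setT snd_fun. Proof. exact: measurable_snd. Qed.
Let w1 u : `|fst_fun u| <= weight u. Proof. by rewrite ger0_norm ?ler0n // lerDl. Qed.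
Let w2 u : `|snd_fun u| <= weight u. Proof. by rewrite lerDr ler0n. Qed.

Lemma subexp_cst1 : subexp (cst 1).
Proof. by apply: subexp_le1 => // u; [exact: cst_continuous|rewrite normr1]. Qed.

Lemma subexp_fst : subexp fst_fun. Proof. exact: subexp_weight. Qed.
Lemma subexp_snd : subexp snd_fun. Proof. exact: subexp_weight. Qed.

Let subexp_mul g g' : continuous g -> measurable_fun setT g -> (forall u, `|g u| <= weight u) ->
  continuous g' -> measurable_fun setT g' -> (forall u, `|g' u| <= weight u) ->
  subexp (fun u => g u * g' u).
Proof.
move=> cg mg gw cg' mg' gw'; apply: subexp_sqr_weight.
- by move=> u; apply: (@continuousM _ _ g g'); [exact: cg|exact: cg'].
- exact: measurable_funM.
- by move=> u; rewrite normrM expr2; apply: ler_pM.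
Qed.

Lemma subexp_fst_fst : subexp (fun u => fst_fun u * fst_fun u). Proof. exact: subexp_mul. Qed.
Lemma subexp_fst_snd : subexp (fun u => fst_fun u * snd_fun u). Proof. exact: subexp_mul. Qed.
Lemma subexp_snd_snd : subexp (fun u => snd_fun u * snd_fun u). Proof. exact: subexp_mul. Qed.

Lemma subexp_fiber (k : nat) : subexp (fun u => (u.1 == k)%:R).
Proof.
apply: subexp_le1.
- by move=> u; exact: (@continuous_nat_fst R (fun j => (j == k)%:R) u).
- exact: (measurable_nat_fst (fun j => (j == k)%:R : R)).
- by move=> u; rewrite ger0_norm // lern1 leq_b1.
Qed.

End Subexponential.

Lemma dist_expR_le {R : realType} (a b c : R) : a <= c -> b <= c ->
  `|expR a - expR b| <= `|a - b| * expR c.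
Proof.
wlog ab : a b / b <= a.
  move=> h ac bc; have [ba|ab] := leP b a; first exact: h.
  by rewrite distrC [`|a - b|]distrC; apply: h => //; exact: ltW.
move=> ac bc; rewrite !ger0_norm ?subr_ge0 ?ler_expR //.
apply: (@le_trans _ _ ((a - b) * expR a)); last by apply: ler_wpM2l; rewrite ?subr_ge0 ?ler_expR.
have -> : expR b = expR (b - a) * expR a by rewrite -expRD subrK.
rewrite -{1}[expR a]mul1r -mulrBl; apply: ler_wpM2r; first exact: expR_ge0.
by have := expR_ge1Dx (b - a); lra.
Qed.

Section OneTilt.
Context {R : realType} d d' (T : measurableType d) (T' : measurableType d').
Variables (P : probability T R) (X : T -> nat) (Y : T -> R) (xi : R).
Variables (P' : probability T' R) (X' : T' -> nat) (Y' : T' -> R).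
Hypotheses (mX : measurable_fun setT X) (mY : measurable_fun setT Y).
Hypotheses (mX' : measurable_fun setT X') (mY' : measurable_fun setT Y').
Hypothesis tilt : tilted_vector P X Y xi P' X' Y'.
Variables (tau eta C : R).
Hypothesis eta0 : 0 < eta.
Hypothesis HC : (\int[P]_w (expweight tau eta (pair_rv X Y w))%:E <= C%:E)%E.
Hypothesis xi_le : xi <= tau + eta / 4.

Let mH : measurable_fun setT (fun w => expweight tau eta (pair_rv X Y w)).
Proof. exact: measurable_rv_comp (measurable_expweight _ _). Qed.
Let H0 w : 0 <= expweight tau eta (pair_rv X Y w).
Proof. exact: expweight_ge0. Qed.

Lemma dominated_tilt (g : nat * R -> R) : subexp eta g ->
  dominated (fun w => expweight tau eta (pair_rv X Y w))
            (fun w => expR (xi * (X w)%:R) * g (pair_rv X Y w)).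
Proof.
move=> [_ mg [D [D0 gD]]]; split.
  apply: measurable_funM; last exact: measurable_rv_comp.
  exact: (measurableT_comp (measurable_fun_nat (fun k => expR (xi * k%:R)))).
exists D => w; rewrite normrM ger0_norm ?expR_ge0 //.
apply: le_trans (ler_wpM2l (expR_ge0 _) (gD _)) _; rewrite mulrCA; apply: ler_wpM2l => //.
rewrite -expRD ler_expR; set u := pair_rv X Y w.
have h1 : xi * (X w)%:R <= (tau + eta / 4) * (X w)%:R by apply: ler_wpM2r.
have h2 : eta / 4 * (X w)%:R <= eta / 4 * weight u.
  by apply: ler_wpM2l; [rewrite divr_ge0 // ltW|rewrite lerDl].
have h3 : 0 <= eta / 2 * weight u by rewrite mulr_ge0 ?weight_ge0 // divr_ge0 // ltW.
rewrite /fst /=; move: h1 h2 h3; rewrite /u /=; lra.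
Qed.

Lemma tilted_subexp (g : nat * R -> R) : subexp eta g ->
  \int[P']_w g (pair_rv X' Y' w) =
  (\int[P]_w (expR (xi * (X w)%:R) * g (pair_rv X Y w))) / \int[P]_w expR (xi * (X w)%:R).
Proof.
move=> gs; apply: (tilted_Rintegral mX mY mX' mY' tilt); first by case: gs.
exact: (dominated_integrable H0 mH HC (dominated_tilt gs)).
Qed.

Lemma tilted_exp_moment :
  (\int[P']_w (expweight 0 (eta / 4) (pair_rv X' Y' w))%:E <=
   (C / \int[P]_w expR (xi * (X w)%:R))%:E)%E.
Proof.
have [h _] := tilt_normalization mX mY mX' mY' tilt.
have M0 := tilted_mgf_gt0 mX mY mX' mY' tilt.
rewrite (tilted_ge0_integral mX mY mX' mY' tilt (measurable_expweight _ _)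
  (fun v => expweight_ge0 _ _ v)).
have -> : C / \int[P]_w expR (xi * (X w)%:R) = expR (- psi P (toR X) xi) * C.
  by rewrite -[RHS](mulfK (lt0r_neq0 M0)) [_ * C * _]mulrAC h mul1r.
rewrite EFinM; apply: lee_wpmul2l; first by rewrite lee_fin expR_ge0.
apply: le_trans HC; apply: ge0_le_integral_real => //.
- apply: measurable_funM; last exact: measurable_rv_comp (measurable_expweight _ _).
  exact: (measurableT_comp (measurable_fun_nat (fun k => expR (xi * k%:R)))).
- by move=> w; rewrite mulr_ge0 ?expR_ge0.
move=> w; rewrite -expRD ler_expR mul0r add0r; set u := pair_rv X Y w.
have h1 : xi * (X w)%:R <= (tau + eta / 4) * (X w)%:R by apply: ler_wpM2r.
have h2 : eta / 4 * (X w)%:R <= eta / 4 * weight u.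
  by apply: ler_wpM2l; [rewrite divr_ge0 // ltW|rewrite lerDl].
have h3 : 0 <= eta / 2 * weight u by rewrite mulr_ge0 ?weight_ge0 // divr_ge0 // ltW.
move: h1 h2 h3; rewrite /u /=; lra.
Qed.

End OneTilt.

Section TiltedConvergence.
Context {R : realType} d (T : measurableType d) (P : probability T R).
Variables (X : T -> nat) (Y : T -> R).
Variables (dn : nat -> measure_display) (Tn : forall n, measurableType (dn n)).
Variables (Pn : forall n, probability (Tn n) R).
Variables (Xn : forall n, Tn n -> nat) (Yn : forall n, Tn n -> R).
Hypotheses (mX : measurable_fun setT X) (mY : measurable_fun setT Y).
Hypotheses (mXn : forall n, measurable_fun setT (@Xn n)).
Hypotheses (mYn : forall n, measurable_fun setT (@Yn n)).
Hypothesis law : cvg_in_law Pn (fun n => pair_rv (@Xn n) (@Yn n)) P (pair_rv X Y).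
Variables (tau eta C : R).
Hypothesis eta0 : 0 < eta.
Hypothesis HCn : \forall n \near \oo,
  (\int[Pn n]_w (expweight tau eta (pair_rv (@Xn n) (@Yn n) w))%:E <= C%:E)%E.

(** Replacing [s_ n] by [s] costs [|s_ n - s|] times [k e^{(tau + eta / 4) k}]; the factor [k] is
    absorbed by one more e^{eta k / 4}, still below the envelope. *)
Lemma cvg_tilted_weight (s_ : nat -> R) (s : R) (g : nat * R -> R) :
  subexp eta g -> s_ n @[n --> \oo] --> s -> s < tau + eta / 4 ->
  \int[Pn n]_w (expR (s_ n * (@Xn n w)%:R) * g (pair_rv (@Xn n) (@Yn n) w))
    @[n --> \oo] --> \int[P]_w (expR (s * (X w)%:R) * g (pair_rv X Y w)).
Proof.
move=> [cg mg [D [D0 gD]]] ss st.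
pose f (t : R) (u : nat * R) := expR (t * u.1%:R) * g u.
have mf t : measurable_fun setT (f t).
  apply: measurable_funM => //; exact: (measurable_nat_fst (fun k => expR (t * k%:R))).
have e4 : 0 < eta / 4 by rewrite divr_gt0.
apply: (cvg_law_perturbed mX mY mXn mYn law eta0 HCn (f := f s) (fn := fun n => f (s_ n))
  (D := D) (e := fun n => `|s_ n - s| * ((eta / 4)^-1 * D))) => //.
- move=> u; apply: (@continuousM _ _ (fun v => expR (s * v.1%:R)) g); last exact: cg.
  exact: (@continuous_nat_fst _ (fun k => expR (s * k%:R)) u).
- move=> u; rewrite normrM ger0_norm ?expR_ge0 //.
  apply: le_trans (ler_wpM2l (expR_ge0 _) (gD _)) _; rewrite mulrCA; apply: ler_wpM2l => //.
  rewrite -expRD ler_expR.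
  have h1 : s * u.1%:R <= (tau + eta / 4) * u.1%:R by apply: ler_wpM2r => //; exact: ltW.
  have h2 : eta / 4 * u.1%:R <= eta / 4 * weight u.
    by apply: ler_wpM2l; [exact: ltW|rewrite lerDl].
  move: h1 h2; lra.
- have nst : \forall n \near \oo, s_ n < tau + eta / 4.
    by have /cvgr_lt := ss; apply.
  near=> n => u.
  have sn : s_ n < tau + eta / 4 by near: n.
  rewrite -mulrBl normrM.
  have k0 : 0 <= u.1%:R :> R by [].
  apply: (@le_trans _ _ ((`|s_ n - s| * u.1%:R * expR ((tau + eta / 4) * u.1%:R)) *
      (D * expR (eta / 4 * weight u)))).
    apply: ler_pM => //; have := @dist_expR_le R (s_ n * u.1%:R) (s * u.1%:R)
      ((tau + eta / 4) * u.1%:R) (ler_wpM2r k0 (ltW sn)) (ler_wpM2r k0 (ltW st)).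
    by rewrite -mulrBl normrM (ger0_norm k0).
  have h : u.1%:R * (expR ((tau + eta / 4) * u.1%:R) * expR (eta / 4 * weight u)) <=
      (eta / 4)^-1 * expweight tau eta u.
    apply: (@le_trans _ _ ((eta / 4)^-1 * expR (eta / 4 * u.1%:R) *
        (expR ((tau + eta / 4) * u.1%:R) * expR (eta / 4 * weight u)))).
      by apply: ler_wpM2r; [rewrite mulr_ge0 ?expR_ge0|exact: natr_le_expR].
    rewrite -mulrA; apply: ler_wpM2l; first by rewrite invr_ge0 ltW.
    rewrite -!expRD ler_expR.
    have h2 : eta / 4 * u.1%:R <= eta / 4 * weight u.
      by apply: ler_wpM2l; [exact: ltW|rewrite lerDl].
    have h3 : 0 <= eta / 4 * weight u by rewrite mulr_ge0 ?weight_ge0 // ltW.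
    move: h2 h3; lra.
  have h' := ler_wpM2l (mulr_ge0 (normr_ge0 (s_ n - s)) D0) h.
  rewrite [leRHS](_ : _ = `|s_ n - s| * D * ((eta / 4)^-1 * expweight tau eta u)); last by ring.
  by apply: le_trans h'; rewrite le_eqVlt; apply/orP; left; apply/eqP; ring.
- rewrite -[X in _ --> X](mul0r ((eta / 4)^-1 * D)).
  apply: cvgM; last exact: cvg_cst.
  rewrite -[X in _ --> X](normr0 R) -(subrr s).
  by apply: cvg_norm; apply: cvgB => //; exact: cvg_cst.
Unshelve. all: by end_near. Qed.

End TiltedConvergence.

(** * Centred second moments and the residual variance *)

Section CenteredMoments.
Context {R : realType} d (T : measurableType d) (P : probability T R).
Variables (X : T -> nat) (Y : T -> R) (eta C x m : R).
Hypotheses (mX : measurable_fun setT X) (mY : measurable_fun setT Y).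
Hypothesis eta0 : 0 < eta.
Hypothesis HC : (\int[P]_w (expweight 0 (eta / 4) (pair_rv X Y w))%:E <= C%:E)%E.

Local Notation H := (fun w => expweight 0 (eta / 4) (pair_rv X Y w)).
Local Notation E f := (\int[P]_w f w).

Let mH : measurable_fun setT H.
Proof. exact: measurable_rv_comp (measurable_expweight _ _). Qed.
Let H0 w : 0 <= H w. Proof. exact: expweight_ge0. Qed.

Let dom g : subexp eta g -> dominated H (fun w => g (pair_rv X Y w)).
Proof.
move=> [_ mg [D [D0 gD]]]; split; first exact: measurable_rv_comp.
by exists D => w; rewrite /expweight mul0r add0r.
Qed.

Let dX : dominated H (fun w => (X w)%:R). Proof. exact: (dom (subexp_fst eta0)). Qed.
Let dY : dominated H Y. Proof. exact: (dom (subexp_snd eta0)). Qed.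
Let dXX : dominated H (fun w => (X w)%:R * (X w)%:R).
Proof. exact: (dom (subexp_fst_fst eta0)). Qed.
Let dXY : dominated H (fun w => (X w)%:R * Y w). Proof. exact: (dom (subexp_fst_snd eta0)). Qed.
Let dYY : dominated H (fun w => Y w * Y w). Proof. exact: (dom (subexp_snd_snd eta0)). Qed.
Let d1 (k : R) : dominated H (fun=> k).
Proof.
have := dominatedZ k (dom (subexp_cst1 eta0)).
by under [X in dominated _ X -> _]eq_fun do rewrite mulr1.
Qed.

Let Ecross (U V : T -> R) (a b : R) : dominated H U -> dominated H V ->
  dominated H (fun w => U w * V w) -> E U = a -> E V = b ->
  dominated H (fun w => (U w - a) * (V w - b)) /\
  \int[P]_w ((U w - a) * (V w - b)) = \int[P]_w (U w * V w) - a * b.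
Proof.
move=> dU dV dUV EU EV.
have D1 := dominatedZ b dU; have D2 := dominatedZ a dV; have D3 := d1 (a * b).
have e w : (U w - a) * (V w - b) = U w * V w - b * U w - a * V w + a * b by ring.
split.
  under [X in dominated _ X]eq_fun do rewrite e.
  by apply: dominatedD => //; apply: dominatedB => //; exact: dominatedB.
under eq_Rintegral do rewrite e.
rewrite (ExpD H0 mH HC (dominatedB (dominatedB dUV D1) D2) D3).
rewrite (ExpB H0 mH HC (dominatedB dUV D1) D2) (ExpB H0 mH HC dUV D1).
by rewrite !(ExpZ H0 mH HC) // Exp_cst EU EV; ring.
Qed.

Lemma Exp_centered (U : T -> R) (a : R) : dominated H U -> E U = a ->
  \int[P]_w (U w - a) = 0.
Proof.
by move=> dU EU; rewrite (ExpB H0 mH HC dU (d1 a)) Exp_cst EU subrr.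
Qed.

Lemma Exp_fst_of_centered : \int[P]_w ((X w)%:R - x) = 0 -> \int[P]_w (X w)%:R = x.
Proof.
by rewrite (ExpB H0 mH HC dX (d1 x)) Exp_cst => /eqP; rewrite subr_eq0 => /eqP.
Qed.

Lemma centered_sqr_integrable :
  P.-integrable setT (EFin \o (fun w => ((X w)%:R - x) * ((X w)%:R - x))).
Proof.
apply: (dominated_integrable H0 mH HC).
have e w : ((X w)%:R - x) * ((X w)%:R - x) =
  (X w)%:R * (X w)%:R - (2 * x) * (X w)%:R + x * x by ring.
under [X in dominated _ X]eq_fun do rewrite e.
by apply: dominatedD => //; apply: dominatedB => //; exact: dominatedZ.
Qed.

Hypotheses (EX : \int[P]_w (X w)%:R = x) (EY : E Y = m).

Let s2 := \int[P]_w (((X w)%:R - x) * ((X w)%:R - x)).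
Let gam := \int[P]_w (((X w)%:R - x) * (Y w - m)).
Let bet := \int[P]_w ((Y w - m) * (Y w - m)).

Lemma centered_moments : [/\ \int[P]_w ((X w)%:R - x) = 0, \int[P]_w (Y w - m) = 0,
  s2 = \int[P]_w ((X w)%:R * (X w)%:R) - x * x,
  gam = \int[P]_w ((X w)%:R * Y w) - x * m &
  bet = \int[P]_w (Y w * Y w) - m * m].
Proof.
split; [exact: Exp_centered|exact: Exp_centered|..].
- by have [] := Ecross dX dX dXX EX EX.
- by have [] := Ecross dX dY dXY EX EY.
- by have [] := Ecross dY dY dYY EY EY.
Qed.

(** Expansion of the second moment of [V - c U] with [c = gam / s2]. Nonnegativity comes for free,
    since the value is a variance. *)
Lemma residual_varianceE : 0 < s2 ->
  residual_variance P (toR X) Y = bet - gam ^+ 2 / s2 /\ 0 <= bet - gam ^+ 2 / s2.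
Proof.
move=> s20.
have [dUU _] := Ecross dX dX dXX EX EX.
have [dUV _] := Ecross dX dY dXY EX EY.
have [dVV _] := Ecross dY dY dYY EY EY.
have EE (f : T -> R) : fine 'E_P[f]%E = E f by rewrite unlock.
have cov (f g : T -> R) a b : E f = a -> E g = b ->
    fine (covariance P f g) = \int[P]_w ((f w - a) * (g w - b)).
  by move=> Ef Eg; rewrite covariance.unlock EE; apply: eq_Rintegral => w _; rewrite /= !EE Ef Eg.
pose c := gam / s2.
have resE : regression_residual P (toR X) Y = fun w => (Y w - m) - c * ((X w)%:R - x).
  apply/funext => w; rewrite /regression_residual /variance !EE.
  rewrite (cov _ _ _ _ EX EY) (cov _ _ _ _ EX EX) EY.
  by have -> : E (toR X) = x by exact: EX.
have E0 : \int[P]_w ((Y w - m) - c * ((X w)%:R - x)) = 0.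
  have DY : dominated H (fun w => Y w - m) by exact: dominatedB.
  have DX : dominated H (fun w => (X w)%:R - x) by exact: dominatedB.
  have [X0 Y0 _ _ _] := centered_moments.
  by rewrite (ExpB H0 mH HC DY (dominatedZ c DX)) (ExpZ H0 mH HC _ DX) X0 Y0 mulr0 subrr.
have val : fine (covariance P (regression_residual P (toR X) Y)
    (regression_residual P (toR X) Y)) = bet - gam ^+ 2 / s2.
  rewrite resE (cov _ _ _ _ E0 E0).
  have e w : (Y w - m - c * ((X w)%:R - x) - 0) * (Y w - m - c * ((X w)%:R - x) - 0) =
      (Y w - m) * (Y w - m) - (2 * c) * (((X w)%:R - x) * (Y w - m))
      + (c * c) * (((X w)%:R - x) * ((X w)%:R - x)) by ring.
  under eq_Rintegral do rewrite e.
  have D2 := dominatedZ (2 * c) dUV; have D3 := dominatedZ (c * c) dUU.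
  rewrite (ExpD H0 mH HC (dominatedB dVV D2) D3) (ExpB H0 mH HC dVV D2).
  rewrite !(ExpZ H0 mH HC) // -/s2 -/gam -/bet /c.
  by field; rewrite gt_eqF.
rewrite /residual_variance /variance val; split => //.
by rewrite -val fine_ge0 // -[covariance _ _ _]/(variance _ _) variance_ge0.
Qed.

End CenteredMoments.

Lemma Rintegral_gt0 {R : realType} d (T : measurableType d) (P : probability T R)
    (f : T -> R) : (forall w, 0 < f w) -> P.-integrable setT (EFin \o f) ->
  0 < \int[P]_w f w.
Proof.
move=> f0 intf; rewrite lt_neqAle eq_sym Rintegral_ge0 ?andbT; last by move=> w _; exact: ltW.
apply/eqP => I0.
have mf : measurable_fun setT (EFin \o f) by case/integrableP: intf.
have : (\int[P]_w `|(f w)%:E| = 0)%E.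
  under eq_integral do rewrite gee0_abs ?lee_fin 1?ltW //.
  by rewrite -[LHS]fineK ?integrable_fin_num //; congr EFin.
move=> /(ae_eq_integral_abs P measurableT mf) [N [mN PN Nsub]].
have NT : N = setT.
  apply/seteqP; split => // w _; apply: Nsub => /= /(_ I) [fw].
  by have := f0 w; rewrite fw ltxx.
have : P setT = 1%E := probability_setT P.
by rewrite -NT PN => /eqP; rewrite eqe eq_sym oner_eq0.
Qed.

Lemma centered_weight_split {R : realType} d (T : measurableType d) (P : probability T R)
    (X : T -> nat) (Y : T -> R) (tau eta C s x : R) :
  measurable_fun setT X -> measurable_fun setT Y -> 0 < eta ->
  (\int[P]_w (expweight tau eta (pair_rv X Y w))%:E <= C%:E)%E ->
  s <= tau + eta / 4 ->
  P.-integrable setT (EFin \o (fun w => ((X w)%:R - x) * expR (s * (X w)%:R))) /\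
  \int[P]_w (((X w)%:R - x) * expR (s * (X w)%:R)) =
    \int[P]_w (expR (s * (X w)%:R) * fst_fun (pair_rv X Y w)) -
    x * \int[P]_w (expR (s * (X w)%:R) * cst 1 (pair_rv X Y w)).
Proof.
move=> mX mY eta0 HC st.
have H0 w : 0 <= expweight tau eta (pair_rv X Y w) by exact: expweight_ge0.
have mH := measurable_rv_comp mX mY (measurable_expweight tau eta).
have d1 := dominated_tilt mX mY eta0 st (subexp_fst eta0).
have d2 := dominated_tilt mX mY eta0 st (subexp_cst1 eta0).
have e w : ((X w)%:R - x) * expR (s * (X w)%:R) =
    expR (s * (X w)%:R) * fst_fun (pair_rv X Y w) -
    x * (expR (s * (X w)%:R) * cst 1 (pair_rv X Y w)).
  by rewrite mulr1 mulrBl [_%:R * _]mulrC.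
split.
  under [X in _.-integrable _ (_ \o X)]eq_fun do rewrite e.
  by apply: (dominated_integrable H0 mH HC); apply: dominatedB => //; exact: dominatedZ.
under eq_Rintegral do rewrite e.
by rewrite (ExpB H0 mH HC d1 (dominatedZ x d2)) (ExpZ H0 mH HC x d2).
Qed.

(** * Convergence of the tilt parameters and of the tilted moments *)

Section TiltedMoments.
Context {R : realType} d (T : measurableType d) (P : probability T R).
Variables (X : T -> nat) (Y : T -> R).
Variables (dn : nat -> measure_display) (Tn : forall n, measurableType (dn n)).
Variables (Pn : forall n, probability (Tn n) R).
Variables (Xn : forall n, Tn n -> nat) (Yn : forall n, Tn n -> R).
Variables (dt : measure_display) (Tt : measurableType dt) (Pt : probability Tt R).
Variables (Xt : Tt -> nat) (Yt : Tt -> R).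
Variables (dtn : nat -> measure_display) (Ttn : forall n, measurableType (dtn n)).
Variables (Ptn : forall n, probability (Ttn n) R).
Variables (Xtn : forall n, Ttn n -> nat) (Ytn : forall n, Ttn n -> R).
Hypotheses (mX : measurable_fun setT X) (mY : measurable_fun setT Y).
Hypotheses (mXn : forall n, measurable_fun setT (@Xn n)).
Hypotheses (mYn : forall n, measurable_fun setT (@Yn n)).
Hypotheses (mXt : measurable_fun setT Xt) (mYt : measurable_fun setT Yt).
Hypotheses (mXtn : forall n, measurable_fun setT (@Xtn n)).
Hypotheses (mYtn : forall n, measurable_fun setT (@Ytn n)).
Variables (tau x r0 r C0 : R) (tau_ x_ : nat -> R).
Hypothesis law : cvg_in_law Pn (fun n => pair_rv (@Xn n) (@Yn n)) P (pair_rv X Y).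
Hypothesis nc : ~ (exists c : nat, P (X @^-1` [set c]) = 1%E).
Hypothesis itau : interior (psi_dom P (toR X)) tau.
Hypothesis dtau : derive1 (psi P (toR X)) tau = x.
Hypothesis itaun : forall n, (0 < n)%N ->
  interior (psi_dom (Pn n) (toR (@Xn n))) (tau_ n) /\
  derive1 (psi (Pn n) (toR (@Xn n))) (tau_ n) = x_ n.
Hypothesis xcvg : x_ n @[n --> \oo] --> x.
Hypothesis tilt : tilted_vector P X Y tau Pt Xt Yt.
Hypothesis tiltn : forall n, (0 < n)%N ->
  tilted_vector (Pn n) (@Xn n) (@Yn n) (tau_ n) (Ptn n) (@Xtn n) (@Ytn n).
Hypotheses (r00 : 0 < r0) (r_gt0 : 0 < r).

Let m n := \int[Ptn n]_w @Ytn n w.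
Hypothesis HC0 : forall n v, (0 < n)%N -> `|v| = r0 / 2 ->
  (\int[Pn n]_w (expR ((tau + r) * (@Xn n w)%:R + v * (@Yn n w - m n)))%:E <= C0%:E)%E.

(** At most 1 for [Kexp], at most [r] and [r0 / 2] so that the envelope is controlled by the assumed
    exponential moments. *)
Let eta := Num.min 1 (Num.min r (r0 / 2)).

Let eta0 : 0 < eta. Proof. by rewrite !lt_min ltr01 r_gt0 divr_gt0. Qed.
Let eta1 : eta <= 1. Proof. by rewrite ge_min lexx. Qed.
Let etar : eta <= r. Proof. by rewrite !ge_min lexx ?orbT. Qed.
Let etar0 : eta <= r0 / 2. Proof. by rewrite !ge_min lexx ?orbT. Qed.
Let r20 : 0 < r0 / 2. Proof. exact: divr_gt0. Qed.

Let HC2 n : (0 < n)%N ->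
  (\int[Pn n]_w (expR ((tau + r) * (@Xn n w)%:R + r0 / 2 * `|@Yn n w - m n|))%:E <=
   (C0 + C0)%:E)%E.
Proof.
move=> n0; have mXR : measurable_fun setT (fun w => (tau + r) * (@Xn n w)%:R : R).
  exact: (measurableT_comp (measurable_fun_nat (fun k => (tau + r) * k%:R : R)) (@mXn n)).
have mYm : measurable_fun setT (fun w => @Yn n w - m n) by exact: measurable_funB.
have me v : measurable_fun setT (fun w => expR ((tau + r) * (@Xn n w)%:R + v * (@Yn n w - m n)) : R).
  apply: (measurableT_comp (@measurable_expR R)).
  by apply: measurable_funD => //; exact: measurable_funM.
have h1 := @HC0 n (r0 / 2) n0 (gtr0_norm r20).
have h2 : `|- (r0 / 2)| = r0 / 2 by rewrite normrN gtr0_norm.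
have {}h2 := HC0 n0 h2.
rewrite EFinD; apply: le_trans (leeD h1 h2).
rewrite -(ge0_integralD_real (Pn n) (me _) (me _) (fun w => expR_ge0 _) (fun w => expR_ge0 _)).
apply: ge0_le_integral_real.
- apply: (measurableT_comp (@measurable_expR R)).
  by apply: measurable_funD => //; apply: measurable_funM => //; exact: measurableT_comp.
- by apply: measurable_funD.
- by move=> w; exact: expR_ge0.
move=> w; have [h|h] := leP 0 (@Yn n w - m n).
  by rewrite ger0_norm // lerDl expR_ge0.
by rewrite ltr0_norm // mulrN -mulNr lerDr expR_ge0.
Qed.

(** The moment assumption is centred at [m n] itself. A large [|m n|] would make [|Y - m n|] large
    wherever the vector is moderate: [e^{r0 |m n| / 2}] times the bounded function [f] is at most
    the controlled integrand, and the mean of [f] tends to a positive limit by convergence in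
    law. *)
Lemma tilted_mean_bounded : exists2 B : R, 0 <= B & \forall n \near \oo, `|m n| <= B.
Proof.
pose b := `|tau + r| + r0 / 2.
have b0 : 0 <= b by rewrite addr_ge0 // ltW.
pose f u : R := expR (- b * weight u).
have cf : continuous f.
  move=> u; apply: (@continuous_comp _ _ _ (fun v => - b * weight v) expR);
    last exact: continuous_expR.
  by apply: (@continuousM _ _ (cst (- b)) weight); [exact: cst_continuous|exact: continuous_weight].
have mf : measurable_fun setT f.
  apply: (measurableT_comp (@measurable_expR R)); apply: measurable_funM => //.
  exact: measurable_weight.
have f1 u : `|f u| <= 1.
  rewrite ger0_norm ?expR_ge0 // -[leRHS]expR0 ler_expR mulNr oppr_le0.
  by rewrite mulr_ge0 ?weight_ge0.
have mfV := measurable_rv_comp mX mY mf.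
have bint : P.-integrable setT (EFin \o (fun w => f (pair_rv X Y w))).
  apply/integrableP; split; first exact/measurable_EFinP.
  under eq_integral => w _ do rewrite /= ger0_norm ?expR_ge0 //.
  by rewrite (bounded_Rintegral P mfV (fun w => f1 _)) ltry.
have Ef0 : 0 < \int[P]_w f (pair_rv X Y w).
  by apply: Rintegral_gt0 => // w; exact: expR_gt0.
set Ef := \int[P]_w _ in Ef0.
have C00 : 0 <= C0 + C0.
  have h := HC2 (ltn0Sn 0); rewrite -lee_fin; apply: le_trans h.
  by apply: integral_ge0 => w _; rewrite lee_fin expR_ge0.
pose B := (C0 + C0) / (Ef / 2) / (r0 / 2).
exists B; first by rewrite !divr_ge0 // ltW // divr_gt0.
have fcv := cvg_law_bounded mX mY mXn mYn law cf mf f1.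
have half : Ef / 2 < Ef by lra.
have nEf : \forall n \near \oo, Ef / 2 < \int[Pn n]_w f (pair_rv (@Xn n) (@Yn n) w).
  by have /cvgr_gt := fcv; apply.
near=> n.
have n0 : (0 < n)%N by near: n; exact: nbhs_infty_gt.
have hEf : Ef / 2 < \int[Pn n]_w f (pair_rv (@Xn n) (@Yn n) w) by near: n.
have mfn := measurable_rv_comp (@mXn n) (@mYn n) mf.
have key : expR (r0 / 2 * `|m n|) * \int[Pn n]_w f (pair_rv (@Xn n) (@Yn n) w) <= C0 + C0.
  rewrite -lee_fin EFinM -(bounded_Rintegral (Pn n) mfn (fun w => f1 _)).
  rewrite -(ge0_integralZl_real (Pn n) mfn (fun w => expR_ge0 _) (expR_ge0 _)).
  apply: le_trans (HC2 n0); apply: ge0_le_integral_real.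
  - exact: measurable_funM.
  - apply: (measurableT_comp (@measurable_expR R)); apply: measurable_funD.
      exact: (measurableT_comp (measurable_fun_nat (fun k => (tau + r) * k%:R : R)) (@mXn n)).
    apply: measurable_funM => //; apply: measurableT_comp => //; exact: measurable_funB.
  - by move=> w; rewrite mulr_ge0 ?expR_ge0.
  move=> w; rewrite -expRD ler_expR /weight /= /b.
  set k : R := (@Xn n w)%:R; set y := @Yn n w.
  have k0 : 0 <= k by [].
  have h1 : - `|tau + r| * k <= (tau + r) * k.
    by apply: ler_wpM2r => //; rewrite lerNl -normrN; exact: ler_norm.
  have h2 : r0 / 2 * `|m n| <= r0 / 2 * `|y| + r0 / 2 * `|y - m n|.
    rewrite -mulrDr; apply: ler_wpM2l; first exact: ltW.
    by have := ler_normB y (y - m n); rewrite opprB addrCA subrr addr0.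
  have h3 : 0 <= `|tau + r| * `|y| by rewrite mulr_ge0.
  have h4 : 0 <= r0 / 2 * k by rewrite mulr_ge0 // ltW.
  by move: h1 h2 h3 h4; lra.
rewrite /B ler_pdivlMr // ler_pdivlMr ?divr_gt0 // mulrC.
apply: le_trans key; rewrite mulrC.
apply: ler_pM.
- by rewrite mulr_ge0 // ltW.
- by rewrite divr_ge0 // ltW.
- rewrite mulrC; apply: le_trans (expR_ge1Dx _); by rewrite lerDr.
- exact: ltW.
Unshelve. all: by end_near. Qed.

Lemma expweight_bounded : exists2 C : R, 0 < C & \forall n \near \oo,
  (\int[Pn n]_w (expweight tau eta (pair_rv (@Xn n) (@Yn n) w))%:E <= C%:E)%E.
Proof.
have [B B0 nB] := tilted_mean_bounded.
have C00 : 0 <= C0 + C0.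
  have h := HC2 (ltn0Sn 0); rewrite -lee_fin; apply: le_trans h.
  by apply: integral_ge0 => w _; rewrite lee_fin expR_ge0.
exists (expR (r0 / 2 * B) * (C0 + C0) + 1).
  by rewrite ltr_wpDl // mulr_ge0 ?expR_ge0.
near=> n.
have n0 : (0 < n)%N by near: n; exact: nbhs_infty_gt.
have mB : `|m n| <= B by near: n.
apply: (@le_trans _ _ (expR (r0 / 2 * B) * (C0 + C0))%:E); last by rewrite lee_fin lerDl.
have mh : measurable_fun setT
    (fun w => expR ((tau + r) * (@Xn n w)%:R + r0 / 2 * `|@Yn n w - m n|) : R).
  apply: (measurableT_comp (@measurable_expR R)); apply: measurable_funD.
    exact: (measurableT_comp (measurable_fun_nat (fun k => (tau + r) * k%:R : R)) (@mXn n)).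
  by apply: measurable_funM => //; apply: measurableT_comp => //; exact: measurable_funB.
rewrite EFinM; apply: le_trans (lee_wpmul2l _ (HC2 n0)); last by rewrite lee_fin expR_ge0.
rewrite -(ge0_integralZl_real (Pn n) mh (fun w => expR_ge0 _) (expR_ge0 _)).
apply: ge0_le_integral_real.
- exact: measurable_rv_comp (measurable_expweight _ _).
- exact: measurable_funM.
- by move=> w; exact: expweight_ge0.
move=> w; rewrite -expRD ler_expR /weight /=.
set k : R := (@Xn n w)%:R; set y := @Yn n w.
have k0 : 0 <= k by [].
have h1 : eta * k <= r * k by apply: ler_wpM2r.
have h2 : eta * `|y| <= r0 / 2 * `|y| by apply: ler_wpM2r.
have h3 : r0 / 2 * `|y| <= r0 / 2 * B + r0 / 2 * `|y - m n|.
  rewrite -mulrDr; apply: ler_wpM2l; first exact: ltW.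
  have := ler_normD (m n) (y - m n); rewrite addrCA subrr addr0 => /le_trans; apply.
  by rewrite lerD2r.
by move: h1 h2 h3; lra.
Unshelve. all: by end_near. Qed.

(** A root of a function with monotone sign. As [X] is not constant, the centred mean of the limit
    is strictly negative at [tau - del] and strictly positive at [tau + del]. These signs pass to
    stage [n], and monotonicity in the parameter traps [tau_ n] between the two points. *)
Lemma tilt_parameter_cvg : tau_ n @[n --> \oo] --> tau.
Proof.
have [C _ nC] := expweight_bounded.
have HCl := expweight_limit_bound mX mY mXn mYn law eta0 nC.
have M0 := tilted_mgf_gt0 mX mY mXt mYt tilt.
have [iN0 N0] := derive1_psi_centered mX itau M0 dtau.
pose N s := \int[P]_w (((X w)%:R - x) * expR (s * (X w)%:R)).
pose Nn n s := \int[Pn n]_w (((@Xn n w)%:R - x_ n) * expR (s * (@Xn n w)%:R)).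
have NnN s : s < tau + eta / 4 -> Nn n s @[n --> \oo] --> N s.
  move=> st; have [_ NE] := centered_weight_split x mX mY eta0 HCl (ltW st).
  rewrite /N NE.
  have cs : (fun _ : nat => s) n @[n --> \oo] --> s by exact: cvg_cst.
  have c1 := cvg_tilted_weight mX mY mXn mYn law eta0 nC (subexp_fst eta0) cs st.
  have c2 := cvg_tilted_weight mX mY mXn mYn law eta0 nC (subexp_cst1 eta0) cs st.
  apply: cvg_trans (cvgB c1 (cvgM xcvg c2)).
  apply: near_eq_cvg; near=> n.
  have hC : (\int[Pn n]_w (expweight tau eta (pair_rv (@Xn n) (@Yn n) w))%:E <= C%:E)%E.
    by near: n.
  have [_ NnE] := centered_weight_split (x_ n) (@mXn n) (@mYn n) eta0 hC (ltW st).
  by rewrite /Nn NnE.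
apply/pseudometric_normed_Zmodule.cvgrPdist_lt => e e0.
pose del := Num.min (e / 2) (eta / 8).
have del0 : 0 < del by rewrite lt_min !divr_gt0.
have dele : del < e.
  by apply: (@le_lt_trans _ _ (e / 2)); [rewrite ge_min lexx|rewrite ltr_pdivrMr // ltr_pMr // ltr1n].
have del8 : del <= eta / 8 by rewrite ge_min lexx orbT.
have e0' := eta0.
have tp : tau + del < tau + eta / 4 by lra.
have tm : tau - del < tau + eta / 4 by lra.
have ltp : tau < tau + del by rewrite ltrDl.
have ltm : tau - del < tau by rewrite gtrBl.
have [ip _] := centered_weight_split x mX mY eta0 HCl (ltW tp).
have [im _] := centered_weight_split x mX mY eta0 HCl (ltW tm).
have Np : 0 < N (tau + del).
  by have := tilted_mean_strict_mono mX ltp nc iN0 ip; rewrite N0 mulr0.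
have Nm : N (tau - del) < 0.
  have := tilted_mean_strict_mono mX ltm nc im iN0.
  by rewrite N0 pmulr_rlt0 // expR_gt0.
have nNp : \forall n \near \oo, 0 < Nn n (tau + del) by have /cvgr_gt := NnN _ tp; apply.
have nNm : \forall n \near \oo, Nn n (tau - del) < 0 by have /cvgr_lt := NnN _ tm; apply.
near=> n.
have n0 : (0 < n)%N by near: n; exact: nbhs_infty_gt.
have hC : (\int[Pn n]_w (expweight tau eta (pair_rv (@Xn n) (@Yn n) w))%:E <= C%:E)%E.
  by near: n.
have hp : 0 < Nn n (tau + del) by near: n.
have hm : Nn n (tau - del) < 0 by near: n.
have [inp _] := centered_weight_split (x_ n) (@mXn n) (@mYn n) eta0 hC (ltW tp).
have [inm _] := centered_weight_split (x_ n) (@mXn n) (@mYn n) eta0 hC (ltW tm).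
have Mn0 := tilted_mgf_gt0 (@mXn n) (@mYn n) (@mXtn n) (@mYtn n) (tiltn n0).
have [itn dtn0] := itaun n0.
have [in0 Nn0] := derive1_psi_centered (@mXn n) itn Mn0 dtn0.
have up : tau_ n < tau + del.
  rewrite ltNge; apply/negP => h; have := tilted_mean_mono h inp in0.
  by rewrite Nn0 leNgt mulr_gt0 // expR_gt0.
have lo : tau - del < tau_ n.
  rewrite ltNge; apply/negP => h; have := tilted_mean_mono h in0 inm.
  by rewrite Nn0 mulr0 leNgt hm.
by rewrite ltr_distlC; apply/andP; split; [apply: lt_trans lo|apply: lt_trans up _];
  rewrite ltrD2l ?ltrN2.
Unshelve. all: by end_near. Qed.

Lemma cvg_tilted_mgf : \int[Pn n]_w expR (tau_ n * (@Xn n w)%:R) @[n --> \oo] -->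
  \int[P]_w expR (tau * (X w)%:R).
Proof.
have [C _ nC] := expweight_bounded.
have e0 := eta0; have tt : tau < tau + eta / 4 by lra.
have := cvg_tilted_weight mX mY mXn mYn law eta0 nC (subexp_cst1 eta0) tilt_parameter_cvg tt.
have e1 d1 (U : measurableType d1) (Q : probability U R) (X1 : U -> nat) (Y1 : U -> R) t :
    \int[Q]_w (expR (t * (X1 w)%:R) * cst 1 (pair_rv X1 Y1 w)) = \int[Q]_w expR (t * (X1 w)%:R).
  by apply: eq_Rintegral => w _; rewrite mulr1.
by rewrite e1; under eq_fun do rewrite e1.
Qed.

Lemma cvg_tilted (g : nat * R -> R) : subexp eta g ->
  \int[Ptn n]_w g (pair_rv (@Xtn n) (@Ytn n) w) @[n --> \oo] -->
  \int[Pt]_w g (pair_rv Xt Yt w).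
Proof.
move=> sg; have [C _ nC] := expweight_bounded.
have HCl := expweight_limit_bound mX mY mXn mYn law eta0 nC.
have e0 := eta0; have tt : tau < tau + eta / 4 by lra.
have M0 := tilted_mgf_gt0 mX mY mXt mYt tilt.
have c1 := cvg_tilted_weight mX mY mXn mYn law eta0 nC sg tilt_parameter_cvg tt.
have c2 := cvg_tilted_mgf.
rewrite (tilted_subexp mX mY mXt mYt tilt eta0 HCl (ltW tt) sg).
have Mn0 : \int[P]_w expR (tau * (X w)%:R) != 0 by rewrite gt_eqF.
apply: cvg_trans (cvgM c1 (cvgV Mn0 c2)).
have nt : \forall n \near \oo, tau_ n < tau + eta / 4.
  by have /cvgr_lt := tilt_parameter_cvg; apply.
apply: near_eq_cvg; near=> n.
have n0 : (0 < n)%N by near: n; exact: nbhs_infty_gt.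
have hC : (\int[Pn n]_w (expweight tau eta (pair_rv (@Xn n) (@Yn n) w))%:E <= C%:E)%E.
  by near: n.
have ht : tau_ n < tau + eta / 4 by near: n.
by rewrite (tilted_subexp (@mXn n) (@mYn n) (@mXtn n) (@mYtn n) (tiltn n0) eta0 hC (ltW ht) sg).
Unshelve. all: by end_near. Qed.

Lemma cvg_tilted_fiber (k : nat) :
  fine (Ptn n (@Xtn n @^-1` [set k])) @[n --> \oo] --> fine (Pt (Xt @^-1` [set k])).
Proof.
have E d1 (U : measurableType d1) (Q : probability U R) (X1 : U -> nat) (Y1 : U -> R) :
    measurable_fun setT X1 ->
    fine (Q (X1 @^-1` [set k])) = \int[Q]_w (((pair_rv X1 Y1 w).1 == k)%:R : R).
  move=> mX1; rewrite /Rintegral -[in LHS](setIT (X1 @^-1` _)) -integral_indic //.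
    congr fine; apply: eq_integral => w _; rewrite indicE /=; congr (nat_of_bool _)%:R%:E.
    by apply/idP/eqP => [/set_mem|h]; [|apply/mem_set].
  by rewrite -[X in measurable X]setTI; apply: mX1.
rewrite (E _ _ Pt _ Yt mXt).
rewrite (_ : (fun n => _) = (fun n => \int[Ptn n]_w (((pair_rv (@Xtn n) (@Ytn n) w).1 == k)%:R : R))).
  exact: (cvg_tilted (subexp_fiber eta0 k)).
by apply/funext => n; exact: (E _ _ (Ptn n) _ (@Ytn n) (@mXtn n)).
Qed.

Lemma tilted_exp_moment_bounded : exists2 C : R, 1 <= C & \forall n \near \oo,
  (\int[Ptn n]_w (expweight 0 (eta / 4) (pair_rv (@Xtn n) (@Ytn n) w))%:E <= C%:E)%E.
Proof.
have [C C_gt0 nC] := expweight_bounded.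
have e0 := eta0; have tt : tau < tau + eta / 4 by lra.
have M0 := tilted_mgf_gt0 mX mY mXt mYt tilt.
have c2 := cvg_tilted_mgf.
set M := \int[P]_w (expR (tau * (X w)%:R)) in M0.
have nt : \forall n \near \oo, tau_ n < tau + eta / 4.
  by have /cvgr_lt := tilt_parameter_cvg; apply.
have half : M / 2 < M by lra.
have nM : \forall n \near \oo, M / 2 < \int[Pn n]_w expR (tau_ n * (@Xn n w)%:R).
  by have /cvgr_gt := c2; apply.
exists (C / (M / 2) + 1); first by rewrite lerDr divr_ge0 // ltW // divr_gt0.
near=> n.
have n0 : (0 < n)%N by near: n; exact: nbhs_infty_gt.
have hC : (\int[Pn n]_w (expweight tau eta (pair_rv (@Xn n) (@Yn n) w))%:E <= C%:E)%E.
  by near: n.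
have ht : tau_ n < tau + eta / 4 by near: n.
have hM : M / 2 < \int[Pn n]_w expR (tau_ n * (@Xn n w)%:R) by near: n.
apply: le_trans (tilted_exp_moment (@mXn n) (@mYn n) (@mXtn n) (@mYtn n) (tiltn n0) eta0 hC (ltW ht)) _.
rewrite lee_fin; apply: (@le_trans _ _ (C / (M / 2))); last by rewrite lerDl.
apply: ler_wpM2l; first exact: ltW.
rewrite lef_pV2 ?posrE; [exact: ltW|apply: lt_trans hM|]; by rewrite divr_gt0.
Unshelve. all: by end_near. Qed.

Let s2n n := \int[Ptn n]_w (((@Xtn n w)%:R - x_ n) * ((@Xtn n w)%:R - x_ n)).
Let gamn n := \int[Ptn n]_w (((@Xtn n w)%:R - x_ n) * (@Ytn n w - m n)).
Let betn n := \int[Ptn n]_w ((@Ytn n w - m n) * (@Ytn n w - m n)).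

Lemma tilted_mean_fst n : (0 < n)%N -> \int[Ptn n]_w ((@Xtn n w)%:R - x_ n) = 0.
Proof.
move=> n0; have [itn dtn0] := itaun n0.
have Mn0 := tilted_mgf_gt0 (@mXn n) (@mYn n) (@mXtn n) (@mYtn n) (tiltn n0).
have [in0 Nn0] := derive1_psi_centered (@mXn n) itn Mn0 dtn0.
pose g (u : nat * R) : R := u.1%:R - x_ n.
have mg : measurable_fun setT g by exact: (measurable_nat_fst (fun k => k%:R - x_ n)).
transitivity (\int[Ptn n]_w g (pair_rv (@Xtn n) (@Ytn n) w)) => //.
have e w : expR (tau_ n * (@Xn n w)%:R) * g (pair_rv (@Xn n) (@Yn n) w) =
  ((@Xn n w)%:R - x_ n) * expR (tau_ n * (@Xn n w)%:R) by rewrite mulrC.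
rewrite (tilted_Rintegral (@mXn n) (@mYn n) (@mXtn n) (@mYtn n) (tiltn n0) mg).
  by under eq_Rintegral do rewrite e; rewrite Nn0 mul0r.
by under [X in _.-integrable _ (_ \o X)]eq_fun do rewrite e.
Qed.

(** Supplies the uniform inputs of [conv_coef_asymptotics]. The exponent drops to [eta / 4] because
    the tilt uses part of it, and recentring at [x_ n] and [m n] costs the factor e^{eta (|x| + 1 +
    B) / 4}. *)
Lemma tilted_moment_facts : exists C s0 X0 eta' : R,
  [/\ [/\ 1 <= C, 0 < s0, 0 < eta' & eta' <= 1],
    \forall n \near \oo,
      [/\ (\int[Ptn n]_w (expR (eta' * (`|(@Xtn n w)%:R - x_ n| + `|@Ytn n w - m n|)))%:E
            <= C%:E)%E,
        \int[Ptn n]_w ((@Xtn n w)%:R - x_ n) = 0, \int[Ptn n]_w (@Ytn n w - m n) = 0,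
        s0 <= s2n n & `|x_ n| <= X0],
    betn n - gamn n ^+ 2 / s2n n @[n --> \oo] --> residual_variance Pt (toR Xt) Yt &
    0 <= residual_variance Pt (toR Xt) Yt].
Proof.
have [B B0 nB] := tilted_mean_bounded.
have [C C1 nC] := tilted_exp_moment_bounded.
have [C' C'0 nC'] := expweight_bounded.
have HCl := expweight_limit_bound mX mY mXn mYn law eta0 nC'.
have e0 := eta0; have tt : tau <= tau + eta / 4 by lra.
have Ct := tilted_exp_moment mX mY mXt mYt tilt eta0 HCl tt.
have M0 := tilted_mgf_gt0 mX mY mXt mYt tilt.
(* The tilted means at stage [n] are the [x_ n] and converge to the tilted mean of the limit;
   uniqueness of limits identifies it. *)
have xm : \int[Pt]_w (Xt w)%:R = x.
  have c := cvg_tilted (subexp_fst eta0).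
  have {}c : x_ n @[n --> \oo] --> \int[Pt]_w fst_fun (pair_rv Xt Yt w).
    apply: cvg_trans c; apply: near_eq_cvg; near=> n.
    have n0 : (0 < n)%N by near: n; exact: nbhs_infty_gt.
    have hC : (\int[Ptn n]_w (expweight 0 (eta / 4) (pair_rv (@Xtn n) (@Ytn n) w))%:E <= C%:E)%E.
      by near: n.
    exact: (Exp_fst_of_centered (@mXtn n) (@mYtn n) eta0 hC (tilted_mean_fst n0)).
  exact: (cvg_unique _ c xcvg).
set mt := \int[Pt]_w Yt w.
have [_ _ s2E gamE betE] := centered_moments mXt mYt eta0 Ct xm (erefl mt).
have s2_gt0 : 0 < \int[Pt]_w (((Xt w)%:R - x) * ((Xt w)%:R - x)).
  have [k [pk kx]] := not_constant_support mX x nc.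
  apply: (@Rintegral_gt0_fiber _ _ _ _ _ mXt (fun j => (j%:R - x) * (j%:R - x)) k).
  - by move=> j; exact: sqr_ge0.
  - exact: (centered_sqr_integrable x mXt mYt eta0 Ct).
  - by rewrite (tilted_fiber tilt) mule_gt0 // lte_fin expR_gt0.
  - by rewrite -expr2 exprn_even_gt0 //= subr_eq0.
have [rvE rv0] := residual_varianceE mXt mYt eta0 Ct xm (erefl mt) s2_gt0.
pose facts n := [/\ \int[Ptn n]_w ((@Xtn n w)%:R - x_ n) = 0, \int[Ptn n]_w (@Ytn n w - m n) = 0,
     s2n n = \int[Ptn n]_w ((@Xtn n w)%:R * (@Xtn n w)%:R) - x_ n * x_ n,
     gamn n = \int[Ptn n]_w ((@Xtn n w)%:R * @Ytn n w) - x_ n * m n &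
     betn n = \int[Ptn n]_w (@Ytn n w * @Ytn n w) - m n * m n].
have nfacts : \forall n \near \oo, facts n.
  near=> n.
  have n0 : (0 < n)%N by near: n; exact: nbhs_infty_gt.
  have hC : (\int[Ptn n]_w (expweight 0 (eta / 4) (pair_rv (@Xtn n) (@Ytn n) w))%:E <= C%:E)%E.
    by near: n.
  have xn := Exp_fst_of_centered (@mXtn n) (@mYtn n) eta0 hC (tilted_mean_fst n0).
  exact: (centered_moments (@mXtn n) (@mYtn n) eta0 hC xn (erefl (m n))).
have mcvg : m n @[n --> \oo] --> mt := cvg_tilted (subexp_snd eta0).
have s2cvg : s2n n @[n --> \oo] --> \int[Pt]_w (((Xt w)%:R - x) * ((Xt w)%:R - x)).
  rewrite s2E; apply: cvg_trans (cvgB (cvg_tilted (subexp_fst_fst eta0)) (cvgM xcvg xcvg)).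
  by apply: near_eq_cvg; apply: filterS nfacts => n [_ _ -> _ _].
have gamcvg : gamn n @[n --> \oo] --> \int[Pt]_w (((Xt w)%:R - x) * (Yt w - mt)).
  rewrite gamE; apply: cvg_trans (cvgB (cvg_tilted (subexp_fst_snd eta0)) (cvgM xcvg mcvg)).
  by apply: near_eq_cvg; apply: filterS nfacts => n [_ _ _ -> _].
have betcvg : betn n @[n --> \oo] --> \int[Pt]_w ((Yt w - mt) * (Yt w - mt)).
  rewrite betE; apply: cvg_trans (cvgB (cvg_tilted (subexp_snd_snd eta0)) (cvgM mcvg mcvg)).
  by apply: near_eq_cvg; apply: filterS nfacts => n [_ _ _ _ ->].
set s2 := \int[Pt]_w (((Xt w)%:R - x) * ((Xt w)%:R - x)) in s2_gt0 s2cvg rvE rv0.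
have s2h : s2 / 2 < s2 by lra.
have ns2 : \forall n \near \oo, s2 / 2 < s2n n by have /cvgr_gt := s2cvg; apply.
have nx : \forall n \near \oo, `|x_ n| < `|x| + 1.
  have /cvgr_lt h : `|x_ n| @[n --> \oo] --> `|x| by exact: cvg_norm.
  by apply: h; rewrite ltrDl.
have e4 : 0 < eta / 4 by rewrite divr_gt0.
exists (expR (eta / 4 * (`|x| + 1 + B)) * C), (s2 / 2), (`|x| + 1), (eta / 4); split.
- split => //; last by have := eta1; lra.
    rewrite -[leLHS]mulr1; apply: ler_pM => //.
    by rewrite -[leLHS]expR0 ler_expR mulr_ge0 ?addr_ge0 // ltW.
  by rewrite divr_gt0.
- near=> n.
  have hC : (\int[Ptn n]_w (expweight 0 (eta / 4) (pair_rv (@Xtn n) (@Ytn n) w))%:E <= C%:E)%E.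
    by near: n.
  have hB : `|m n| <= B by near: n.
  have hx : `|x_ n| < `|x| + 1 by near: n.
  have hs : s2 / 2 < s2n n by near: n.
  have [h1 h2 _ _ _] : facts n by near: n.
  split => //; [|exact: ltW|exact: ltW].
  have mw : measurable_fun setT (fun w => expweight 0 (eta / 4) (pair_rv (@Xtn n) (@Ytn n) w)).
    exact: measurable_rv_comp (measurable_expweight _ _).
  apply: (@le_trans _ _ ((expR (eta / 4 * (`|x| + 1 + B)))%:E *
     \int[Ptn n]_w (expweight 0 (eta / 4) (pair_rv (@Xtn n) (@Ytn n) w))%:E)%E); last first.
    by rewrite EFinM; apply: lee_wpmul2l => //; rewrite lee_fin expR_ge0.
  rewrite -(ge0_integralZl_real (Ptn n) mw (fun w => expR_ge0 _) (expR_ge0 _)).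
  apply: ge0_le_integral_real.
  + apply: (measurableT_comp (@measurable_expR R)); apply: measurable_funM => //.
    apply: measurable_funD; apply: measurableT_comp => //; last exact: measurable_funB.
    exact: (measurableT_comp (measurable_fun_nat (fun k => k%:R - x_ n : R)) (@mXtn n)).
  + exact: measurable_funM.
  + by move=> w; exact: expR_ge0.
  move=> w; rewrite /expweight mul0r add0r -expRD ler_expR -mulrDr; apply: ler_wpM2l.
    exact: ltW.
  rewrite /weight /=; have k0 : 0 <= (@Xtn n w)%:R :> R by [].
  have := ler_normB (@Xtn n w)%:R (x_ n); rewrite (ger0_norm k0).
  have := ler_normB (@Ytn n w) (m n).
  by move: hB (ltW hx); lra.
- rewrite rvE; apply: cvgB => //; apply: cvgM; first by rewrite expr2; apply: cvgM.
  by apply: cvgV => //; rewrite gt_eqF.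
- by rewrite rvE.
Unshelve. all: by end_near. Qed.


End TiltedMoments.

(** * Proof of the theorem *)

(** Finitely many atoms share one [delta] and one rank; this is why aperiodicity was reduced to a
    finite prefix of the support. *)
Lemma near_finite_lower_bound {R : realType} (f : nat -> nat -> R) (c : nat -> R) (A : set nat) :
  (forall k, f n k @[n --> \oo] --> c k) -> (forall k, A k -> 0 < c k) ->
  forall n0 : nat, exists2 delta : R, 0 < delta &
    \forall n \near \oo, forall k, (k < n0)%N -> A k -> delta <= f n k.
Proof.
move=> fc c0; elim=> [|n0 [delta d0 nd]]; first by exists 1 => //; near=> n.
have [An0|An0] := pselect (A n0); last first.
  exists delta => //; apply: filterS nd => n nd k; rewrite ltnS leq_eqVlt.
  by move=> /orP[/eqP ->|]; [|exact: nd].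
have half : c n0 / 2 < c n0 by have := c0 _ An0; lra.
have nc : \forall n \near \oo, c n0 / 2 < f n n0 by have /cvgr_gt := fc n0; apply.
exists (Num.min delta (c n0 / 2)); first by rewrite lt_min d0 divr_gt0 ?c0.
apply: filterS2 nd nc => n nd nc k; rewrite ltnS leq_eqVlt => /orP[/eqP ->|kn] Ak.
  by rewrite ge_min (ltW nc) orbT.
by rewrite ge_min nd.
Unshelve. all: by end_near. Qed.

(** The change of measure at the level of coefficients. The prefactor does not depend on [u], so it
    cancels in the conditional transform. *)
Lemma laplace_tilted_conv_coef {R : realType} d d' dt (T : measurableType d)
    (T' : measurableType d') (Tt : measurableType dt) (P : probability T R)
    (P' : probability T' R) (Pt : probability Tt R) (N K L : nat)
    (Xs : 'I_N -> T -> nat) (Ys : 'I_N -> T -> R) (X : T' -> nat) (Y : T' -> R)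
    (Xt : Tt -> nat) (Yt : Tt -> R) (m u x xi : R) :
  (forall i, measurable_fun setT (Xs i)) -> (forall i, measurable_fun setT (Ys i)) ->
  measurable_fun setT X -> measurable_fun setT Y ->
  measurable_fun setT Xt -> measurable_fun setT Yt ->
  mutually_independent P (fun i => pair_rv (Xs i) (Ys i)) ->
  (forall i, same_law P (pair_rv (Xs i) (Ys i)) P' (pair_rv X Y)) ->
  tilted_vector P' X Y xi Pt Xt Yt ->
  (\int[P']_w (expR (u * (Y w - m)))%:E < +oo)%E -> (K < L)%N -> N%:R * x = K%:R ->
  (\int[P]_w (expR (u * (\sum_i Ys i w - N%:R * m)) * ((\sum_i Xs i w)%N == K)%:R)%:E =
   (expR (psi P' (toR X) xi - xi * x) ^+ N * conv_coef L (wgt Pt Xt Yt m u) N K)%:E)%E.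
Proof.
move=> mXs mYs mX mY mXt mYt ind law tilt fin KL NxK.
rewrite (laplace_conv_coef mXs mYs mX mY ind law fin KL); congr EFin.
set Zc := expR _; have Zc0 : 0 < Zc by exact: expR_gt0.
have -> : wgt Pt Xt Yt m u = fun k => wgt P' X Y m u k * expR (xi * (k%:R - x)) / Zc.
  apply/funext => k; rewrite (wgt_tilted mX mY mXt mYt tilt k fin) mulrC -mulrA -expRN -expRD.
  by congr (_ * expR _); ring.
rewrite (conv_coef_tilt _ _ _ _ NxK) mulrC divfK //.
by rewrite expf_neq0 // gt_eqF.
Qed.

(** Subtracting the estimate at 0 removes [ln (sqrt N)]. The normalisation [a N rho^2 = 1] turns the
    main term into [l^2 v / 2] and the error [a (1 + N rho^3)] into [a + rho]. *)
Lemma log_ratio_le {R : realType} (N : nat) (c c' v l rho a C C' : R) :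
  (0 < N)%N -> 0 < c -> 0 < c' -> 0 < a -> 0 < rho -> a * N%:R * rho ^+ 2 = 1 ->
  `|ln (Num.sqrt N%:R * c) - N%:R * ((l * rho) ^+ 2 * v / 2)| <= C * (1 + N%:R * rho ^+ 3) ->
  `|ln (Num.sqrt N%:R * c') - N%:R * ((0 * rho) ^+ 2 * v / 2)| <= C' * (1 + N%:R * rho ^+ 3) ->
  `|a * ln (c / c') - l ^+ 2 * v / 2| <= (C + C') * (a + rho).
Proof.
move=> N0 c0 c'0 a0 rho0 aN h h'.
have sN : 0 < Num.sqrt N%:R :> R by rewrite sqrtr_gt0 ltr0n.
rewrite !lnM ?posrE // in h h'.
rewrite mul0r expr0n /= !mul0r mulr0 subr0 in h'.
rewrite ln_div ?posrE //.
have -> : a * (ln c - ln c') - l ^+ 2 * v / 2 =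
    a * ((ln (Num.sqrt N%:R) + ln c - N%:R * ((l * rho) ^+ 2 * v / 2)) -
         (ln (Num.sqrt N%:R) + ln c')).
  have -> : l ^+ 2 * v / 2 = (a * N%:R * rho ^+ 2) * (l ^+ 2 * v / 2) by rewrite aN mul1r.
  by ring.
rewrite normrM gtr0_norm //.
have -> : (C + C') * (a + rho) = a * (C * (1 + N%:R * rho ^+ 3) + C' * (1 + N%:R * rho ^+ 3)).
  have e : rho = a * N%:R * rho ^+ 2 * rho by rewrite aN mul1r.
  by rewrite [in LHS]e; ring.
apply: ler_wpM2l; first exact: ltW.
by apply: le_trans (ler_normB _ _) _; exact: lerD.
Qed.

Lemma sqrt_ratioE {R : realType} (a N rho : R) : 0 < a -> 0 < N -> 0 < rho ->
  a * N * rho ^+ 2 = 1 -> Num.sqrt (a / N) = a * rho.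
Proof.
move=> a0 N0 rho0 h; rewrite -[RHS]ger0_norm; last by rewrite mulr_ge0 // ltW.
rewrite -sqrtr_sqr; congr Num.sqrt.
rewrite -[LHS]mulr1 -h; field.
by rewrite gt_eqF.
Qed.

Theorem theorem2p4 (R : realType)
  (* the limit vector (X, Y) *)
  (d : measure_display) (T : measurableType d) (P : probability T R)
  (X : {RV P >-> nat}) (Y : {RV P >-> R})
  (* the vectors (X^(n), Y^(n)), n >= 1 *)
  (dn : nat -> measure_display) (Tn : forall n, measurableType (dn n))
  (Pn : forall n, probability (Tn n) R)
  (Xn : forall n, {RV (Pn n) >-> nat}) (Yn : forall n, {RV (Pn n) >-> R})
  (p_ q_ : nat -> nat)
  (* the samples (X_i^(n), Y_i^(n)), 1 <= i <= n q_n *)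
  (ds : nat -> measure_display) (Ts : forall n, measurableType (ds n))
  (Ps : forall n, probability (Ts n) R)
  (Xs : forall n, 'I_(n * q_ n) -> {RV (Ps n) >-> nat})
  (Ys : forall n, 'I_(n * q_ n) -> {RV (Ps n) >-> R})
  (a : nat -> R) (p q : nat) (tau : R) (tau_ : nat -> R)
  (* the tilted vectors at tau and at tau_n *)
  (dt : measure_display) (Tt : measurableType dt) (Pt : probability Tt R)
  (Xt : {RV Pt >-> nat}) (Yt : {RV Pt >-> R})
  (dtn : nat -> measure_display) (Ttn : forall n, measurableType (dtn n))
  (Ptn : forall n, probability (Ttn n) R)
  (Xtn : forall n, {RV (Ptn n) >-> nat}) (Ytn : forall n, {RV (Ptn n) >-> R})
  (r0 r : R) :
  let S n (w : Ts n) := (\sum_(i < n * q_ n) Xs n i w)%N in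
  let Sum n (w : Ts n) := \sum_(i < n * q_ n) Ys n i w in
  let m n := fine 'E_(Ptn n)[Ytn n]%E in
  let B0 : set R := [set` `]- r0, r0[] in
  let Itau : set R := [set` `[tau - r, tau + r]] in
  (* standing setting *)
  (forall n, (0 < n)%N -> rv_span (Pn n) (Xn n) = 1%E) ->
  rv_span P X = 1%E ->
  ~ (exists c : nat, P (X @^-1` [set c]) = 1%E) ->
  cvg_in_law Pn (fun n => pair_rv (Xn n) (Yn n)) P (pair_rv X Y) ->
  (forall n, (0 < n)%N -> (0 < p_ n)%N /\ (0 < q_ n)%N) ->
  (forall n, (0 < n)%N ->
    mutually_independent (Ps n) (fun i => pair_rv (Xs n i) (Ys n i))) ->
  (forall n, (0 < n)%N -> forall i,
    same_law (Ps n) (pair_rv (Xs n i) (Ys n i)) (Pn n) (pair_rv (Xn n) (Yn n))) ->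
  (forall n, (0 < n)%N -> (0 < Ps n (S n @^-1` [set (n * p_ n)%N]))%E) ->
  (* the sequence a *)
  (forall n, (0 < n)%N -> 0 < a n) ->
  (forall n k, (0 < n)%N -> (n <= k)%N -> a k <= a n) ->
  a n @[n --> \oo] --> 0 ->
  (* p / q and its approximations *)
  (0 < p)%N -> (0 < q)%N ->
  psi'_range_int P (toR X) (p%:R / q%:R) ->
  (forall n, (0 < n)%N ->
    psi'_range_int (Pn n) (toR (Xn n)) ((p_ n)%:R / (q_ n)%:R)) ->
  ((p_ n)%:R / (q_ n)%:R : R) @[n --> \oo] --> (p%:R / q%:R : R) ->
  (* tau and tau_n *)
  interior (psi_dom P (toR X)) tau ->
  derive1 (psi P (toR X)) tau = p%:R / q%:R ->
  (forall n, (0 < n)%N ->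
    interior (psi_dom (Pn n) (toR (Xn n))) (tau_ n) /\
    derive1 (psi (Pn n) (toR (Xn n))) (tau_ n) = (p_ n)%:R / (q_ n)%:R) ->
  tilted_vector P X Y tau Pt Xt Yt ->
  (forall n, (0 < n)%N ->
    tilted_vector (Pn n) (Xn n) (Yn n) (tau_ n) (Ptn n) (Xtn n) (Ytn n)) ->
  (* 1 *)
  0 < r0 ->
  B0 `<=` psi_dom P Y `&`
          \bigcap_(n in [set n | (0 < n)%N]) psi_dom (Pn n) (Yn n) ->
  (* 2 *)
  0 < r ->
  Itau `<=` psi_dom P (toR X) `&`
            \bigcap_(n in [set n | (0 < n)%N]) psi_dom (Pn n) (toR (Xn n)) ->
  (forall s, Itau s ->
    ereal_sup [set (Normc.normc (cmgf (Pn n) (toR (Xn n)) (Complex s t)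
                                 - cmgf P (toR X) (Complex s t)))%:E
              | t in [set: R]] @[n --> \oo] --> 0%E) ->
  (ereal_sup [set ereal_sup [set
       'E_(Pn n)[fun w => expR (sv.1 * (Xn n w)%:R + sv.2 * (Yn n w - m n))]
       | sv in Itau `*` B0] | n in [set n | (0 < n)%N]] < +oo)%E ->
  (* 3 *)
  n%:R * a n * (q_ n)%:R @[n --> \oo] --> +oo ->
  let J := quadratic_rate (residual_variance Pt (toR Xt) Yt) in
  LDP (fun n => cond_law (Ps n) (S n @^-1` [set (n * p_ n)%N])
        (fun w => Num.sqrt (a n / (n * q_ n)%:R)
                  * (Sum n w - (n * q_ n)%:R * m n)))
      J a
  /\ good_rate J.
Proof.
move=> S Sum m B0 Itau spann span1 nc law pq0 ind slaw Spos a0 adec acvg p0 q0 xR xnR xcvg.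
move=> itau dtau itaun tilt tiltn r00 HB0 r_gt0 HItau _ Hsup aninf J.
have mE : m = (fun n => \int[Ptn n]_w Ytn n w) by apply/funext => n; rewrite /m unlock.
clearbody m.
pose x_ n : R := (p_ n)%:R / (q_ n)%:R.
pose N n := (n * q_ n)%N; pose K n := (n * p_ n)%N.
pose rho n := (Num.sqrt (a n * (N n)%:R))^-1.
have mX : measurable_fun setT X by exact: measurable_funPT.
have mY : measurable_fun setT Y by exact: measurable_funPT.
have mXn n : measurable_fun setT (Xn n) by exact: measurable_funPT.
have mYn n : measurable_fun setT (Yn n) by exact: measurable_funPT.
have mXt : measurable_fun setT Xt by exact: measurable_funPT.
have mYt : measurable_fun setT Yt by exact: measurable_funPT.
have mXtn n : measurable_fun setT (Xtn n) by exact: measurable_funPT.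
have mYtn n : measurable_fun setT (Ytn n) by exact: measurable_funPT.
have mXs n i : measurable_fun setT (Xs n i) by exact: measurable_funPT.
have mYs n i : measurable_fun setT (Ys n i) by exact: measurable_funPT.
have N0 n : (0 < n)%N -> (0 < N n)%N by move=> n0; rewrite muln_gt0 n0; case: (pq0 n n0).
have NxK n : (0 < n)%N -> (N n)%:R * x_ n = (K n)%:R.
  move=> n0; have [_ qn0] := pq0 n n0; rewrite /x_ /N /K !natrM.
  by field; rewrite pnatr_eq0 -lt0n.
(* The supremum is evaluated at the right endpoint of [Itau], the largest tilt since [X >= 0], and
   at both signs of [v]; half of [r0] keeps [v] in the open interval [B0]. *)
have [C0 HC0] : exists C0 : R, forall n v, (0 < n)%N -> `|v| = r0 / 2 ->
    (\int[Pn n]_w (expR ((tau + r) * (Xn n w)%:R + v * (Yn n w - m n)))%:E <= C0%:E)%E.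
  set M := ereal_sup _ in Hsup.
  have HM n v : (0 < n)%N -> `|v| = r0 / 2 ->
      (\int[Pn n]_w (expR ((tau + r) * (Xn n w)%:R + v * (Yn n w - m n)))%:E <= M)%E.
    move=> n0 vr; apply: (@le_trans _ _ (ereal_sup [set
       'E_(Pn n)[fun w => expR (sv.1 * (Xn n w)%:R + sv.2 * (Yn n w - m n))]%E
       | sv in Itau `*` B0])); last by apply: ereal_sup_ubound; exists n.
    apply: ereal_sup_ubound; exists (tau + r, v); last by rewrite unlock.
    split; rewrite /= /Itau /B0 /= in_itv /=.
      by have h := r_gt0; apply/andP; split; lra.
    by rewrite -ltr_norml vr ltr_pdivrMr // ltr_pMr // ltr1n.
  have r20 : `|r0 / 2| = r0 / 2 by rewrite ger0_norm // divr_ge0 // ltW.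
  have M0 : (0 <= M)%E.
    apply: le_trans (HM 1%N (r0 / 2) isT r20).
    by apply: integral_ge0 => w _; rewrite lee_fin expR_ge0.
  by exists (fine M) => n v n0 vr; rewrite fineK ?ge0_fin_numE //; exact: HM.
rewrite mE in HC0.
have facts := tilted_moment_facts mX mY mXn mYn mXt mYt mXtn mYtn law nc itau dtau itaun
  xcvg tilt tiltn r00 r_gt0 HC0.
have fibers := cvg_tilted_fiber mX mY mXn mYn mXt mYt mXtn mYtn law nc itau dtau itaun
  xcvg tilt tiltn r00 r_gt0 HC0.
have {}mE n : m n = \int[Ptn n]_w Ytn n w by rewrite mE.
have [C [s0 [X0 [eta [[C1 s00 eta0 eta1] nf vcvg al0]]]]] := facts.
move: nf; set F := (fun n : nat => [/\ _, _, _, _ & _]) => nf.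
rewrite {}/J; set alpha2 := residual_variance Pt (toR Xt) Yt in vcvg al0 *.
set v := (fun n => _ - _ / _) in vcvg.
have aNE n : a n * (N n)%:R = n%:R * a n * (q_ n)%:R by rewrite natrM; ring.
have aNbig c : \forall n \near \oo, c < a n * (N n)%:R.
  have /cvgryPgt/(_ c) := aninf; apply: filterS => n; by rewrite aNE.
have rho_gt0 n : (0 < n)%N -> 0 < rho n.
  by move=> n0; rewrite invr_gt0 sqrtr_gt0 mulr_gt0 ?a0 // ltr0n N0.
have rho_small e : 0 < e -> \forall n \near \oo, rho n < e.
  move=> e0; near=> n.
  have n0 : (0 < n)%N by near: n; exact: nbhs_infty_gt.
  have h : e^-1 ^+ 2 < a n * (N n)%:R by near: n; exact: aNbig.
  rewrite -[e]invrK ltf_pV2 ?posrE ?invr_gt0 //; last first.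
    by rewrite sqrtr_gt0 mulr_gt0 ?a0 // ltr0n N0.
  rewrite -[e^-1]ger0_norm ?invr_ge0 1?ltW // -sqrtr_sqr ltr_sqrt //.
  exact: le_lt_trans (sqr_ge0 _) h.
have aNrho n : (0 < n)%N -> a n * (N n)%:R * rho n ^+ 2 = 1.
  move=> n0; have h : 0 < a n * (N n)%:R by rewrite mulr_gt0 ?a0 // ltr0n N0.
  by rewrite exprVn sqr_sqrtr ?mulfV ?gt_eqF // ltW.
have aper := rv_span1 span1.
have supp k : supp_nat P X k -> 0 < fine (Pt (Xt @^-1` [set k])).
  move=> pk; have mk : measurable (Xt @^-1` [set k]) by rewrite -[X in measurable X]setTI; exact: mXt.
  rewrite fine_gt0 // (tilted_fiber tilt) mule_gt0 ?lte_fin ?expR_gt0 //=.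
  by rewrite -(tilted_fiber tilt) ltey_eq fin_num_measure.
pose lap l C' n := exists L, (K n < L)%N /\
    0 < conv_coef L (wgt (Ptn n) (Xtn n) (Ytn n) (m n) (l * rho n)) (N n) (K n) /\
    `|ln (Num.sqrt (N n)%:R * conv_coef L (wgt (Ptn n) (Xtn n) (Ytn n) (m n) (l * rho n)) (N n) (K n))
      - (N n)%:R * ((l * rho n) ^+ 2 * v n / 2)| <= C' * (1 + (N n)%:R * rho n ^+ 3).
have key l : exists C' : R, \forall n \near \oo, lap l C' n.
  (* [n0] comes from the support of [X], then [delta] from the convergence of the tilted atoms below
     [n0], then the constants, and the rank in [n] last. *)
  have [n0 Hn0] := conv_coef_asymptotics X0 l aper eta0 eta1 C1 s00.
  have [delta d0 nd] := near_finite_lower_bound fibers supp n0.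
  have [C' [rho0 [N1 [rho00 HN1]]]] := Hn0 delta d0.
  exists C'; near=> n.
  have n_gt0 : (0 < n)%N by near: n; exact: nbhs_infty_gt.
  have hd : forall k, (k < n0)%N -> supp_nat P X k -> delta <= fine (Ptn n (Xtn n @^-1` [set k])).
    by near: n.
  have hr : rho n < rho0 by near: n; exact: rho_small.
  have hN : (N1 <= N n)%N.
    have [_ qn0] := pq0 n n_gt0; apply: (@leq_trans n); last by rewrite leq_pmulr.
    by near: n; exact: nbhs_infty_ge.
  have : F n by near: n.
  rewrite /F -mE => -[f1 f2 f3 f4 f5].
  rewrite /lap /v -mE.
  exact: (HN1 _ _ (Ptn n) _ _ (x_ n) (m n) (rho n) (N n) (K n) (mXtn n) (mYtn n)
    f1 f2 f3 f4 f5 hd (rho_gt0 n n_gt0) (ltW hr) (N0 n n_gt0) hN (NxK n n_gt0)).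
pose D n := S n @^-1` [set K n].
pose Z n w := Num.sqrt (a n / (N n)%:R) * (Sum n w - (N n)%:R * m n).
pose I n l := (\int[Ps n]_w (expR (l * Z n w / a n) * \1_(D n) w)%:E)%E.
pose Lam n l := fine (I n l).
have mSum n : measurable_fun setT (Sum n).
  by apply: measurable_sum => i; exact: mYs.
have mD n : measurable (D n).
  have -> : D n = (fun w => \sum_(i < N n) ((Xs n i w)%:R : R)) @^-1` [set (K n)%:R].
    apply/seteqP; split => w; rewrite /D /S /= -natr_sum => /eqP; rewrite ?eqr_nat => /eqP //.
    by move=> ->.
  have mSX : measurable_fun setT (fun w => \sum_(i < N n) ((Xs n i w)%:R : R)).
    apply: measurable_sum => i.
    exact: (measurableT_comp (measurable_fun_nat (fun k => k%:R : R)) (mXs n i)).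
  by rewrite -[X in measurable X]setTI; apply: mSX.
have mZ n : measurable_fun setT (Z n).
  by apply: measurable_funM => //; exact: measurable_funB.
(* Since [sqrt (a / N) = a rho], dividing the scaled variable by the speed leaves exactly the tilt
   [l rho]. *)
have IE n l : (0 < n)%N -> I n l = (\int[Ps n]_w (expR (l * rho n *
    (\sum_i Ys n i w - (N n)%:R * m n)) * ((\sum_i Xs n i w)%N == K n)%:R)%:E)%E.
  move=> n0; apply: eq_integral => w _; rewrite indicE; congr (_ * _)%:E; last first.
    congr (nat_of_bool _)%:R; apply/idP/eqP => [/set_mem|h]; first by [].
    by apply/mem_set.
  have an0 := a0 n n0; have Nn0 : 0 < (N n)%:R :> R by rewrite ltr0n N0.
  have -> : Z n w = a n * rho n * (Sum n w - (N n)%:R * m n).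
    by congr (_ * _); exact: sqrt_ratioE an0 Nn0 (rho_gt0 n n0) (aNrho n n0).
  by congr expR; rewrite /Sum; field; rewrite gt_eqF.
have Lam0 n : (0 < n)%N -> I n 0 = (Lam n 0)%:E /\ 0 < Lam n 0.
  move=> n0; have E0 : I n 0 = Ps n (D n).
    rewrite -(setIT (D n)) -integral_indic //; apply: eq_integral => w _.
    by rewrite !mul0r expR0 mul1r.
  have Df : Ps n (D n) \is a fin_num by exact: fin_num_measure.
  rewrite /Lam E0 fineK //; split => //.
  by rewrite fine_gt0 // ltey_eq Df; have := Spos n n0 => ->.
(* Stated for every level above [K n], because the levels supplied for [l] and for 0 may differ. *)
pose lamc l n := I n l = (Lam n l)%:E /\ forall L, (K n < L)%N ->
    Lam n l = expR (psi (Pn n) (toR (Xn n)) (tau_ n) - tau_ n * x_ n) ^+ N n *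
      conv_coef L (wgt (Ptn n) (Xtn n) (Ytn n) (m n) (l * rho n)) (N n) (K n).
(* Finiteness is assumed for tilts in [B0] only, so [n] must be large enough, depending on [l], for
   [|l rho n| < r0]. *)
have LamE l : \forall n \near \oo, lamc l n.
  have small : 0 < r0 / (`|l| + 1) by rewrite divr_gt0 // ltr_wpDl.
  near=> n.
  have n0 : (0 < n)%N by near: n; exact: nbhs_infty_gt.
  have hr : rho n < r0 / (`|l| + 1) by near: n; exact: rho_small.
  have lr : `|l * rho n| < r0.
    rewrite normrM (gtr0_norm (rho_gt0 n n0)); move: hr.
    rewrite ltr_pdivlMr ?ltr_wpDl // mulrDr mulr1 mulrC; apply: le_lt_trans.
    by rewrite lerDl ltW // rho_gt0.
  have fin : (\int[Pn n]_w (expR (l * rho n * (Yn n w - m n)))%:E < +oo)%E.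
    have [_ /(_ n n0)] := HB0 (l * rho n) ltac:(by rewrite /B0 /= in_itv /= -ltr_norml).
    rewrite /psi_dom /= /mmt_gen_fun unlock => h.
    have -> : (\int[Pn n]_w (expR (l * rho n * (Yn n w - m n)))%:E =
        (expR (- (l * rho n * m n)))%:E * \int[Pn n]_w (expR (l * rho n * Yn n w))%:E)%E.
      rewrite -ge0_integralZl_real //.
      - by apply: eq_integral => w _; rewrite -expRD; congr (expR _)%:E; ring.
      - by apply: (measurableT_comp (@measurable_expR R)); exact: measurable_funM.
    rewrite lte_mul_pinfty ?lee_fin ?expR_ge0 //; apply: le_lt_trans h.
    by rewrite le_eqVlt; apply/orP; left; apply/eqP; apply: eq_integral => w _; rewrite /= mulrC.
  have LE L (KL : (K n < L)%N) := laplace_tilted_conv_coef (mXs n) (mYs n) (mXn n) (mYn n)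
    (mXtn n) (mYtn n) (ind n n0) (slaw n n0) (tiltn n n0) fin KL (NxK n n0).
  rewrite /lamc /Lam (IE n l n0); split; first by rewrite (LE _ (ltnSn (K n))).
  by move=> L KL; rewrite (LE _ KL).
clearbody Lam.
apply: (@gaertner_ellis_quadratic R ds Ts Ps D Z a alpha2 Lam) => //.
- by move=> n n0; have [] := Lam0 n n0.
- by move=> l; apply: filterS (LamE l) => n [].
- by move=> n n0; have [] := Lam0 n n0.
- move=> l; have [Cl nl] := key l; apply: filterS2 nl (LamE l) => n [L [KL [c0 _]]] [_ /(_ L KL) ->].
  by rewrite mulr_gt0 // exprn_gt0 ?expR_gt0.
move=> l; have [Cl nl] := key l; have [Cz nz] := key 0.
have nl0 : \forall n \near \oo, lamc l n /\ lamc 0 n.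
  by apply: filterS2 (LamE l) (LamE 0) => n; split.
have rcvg : rho n @[n --> \oo] --> (0 : R).
  apply/pseudometric_normed_Zmodule.cvgrPdist_lt => e e0; near=> n.
  have n0 : (0 < n)%N by near: n; exact: nbhs_infty_gt.
  rewrite sub0r normrN gtr0_norm ?rho_gt0 //; near: n; exact: rho_small.
(* Two errors are separated: the logarithmic estimate with the variance [v n] of stage [n], of order
   [a n + rho n], and the convergence of [v n] to [alpha2]. *)
rewrite (_ : (fun n => a n * ln (Lam n l / Lam n 0)) =
  (fun n => (a n * ln (Lam n l / Lam n 0) - l ^+ 2 * v n / 2) + l ^+ 2 * v n / 2)); last first.
  by apply/funext => n; rewrite subrK.
rewrite -[X in _ --> X]add0r; apply: cvgD; last first.
  apply: cvgM; last exact: cvg_cst.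
  by apply: cvgM => //; exact: cvg_cst.
apply: norm_cvg0; apply: (@squeeze_cvgr _ _ _ _ (cst 0) (fun n => (Cl + Cz) * (a n + rho n))).
- near=> n; rewrite normr_ge0 /=.
  have n0 : (0 < n)%N by near: n; exact: nbhs_infty_gt.
  have [[_ El] [_ E0]] : lamc l n /\ lamc 0 n by near: n.
  have [L [KL [c0 h]]] : lap l Cl n by near: n.
  have [L' [KL' [c0' h']]] : lap 0 Cz n by near: n.
  rewrite (El L KL) (E0 L' KL').
  rewrite -mulf_div mulfV ?mul1r; last by rewrite expf_neq0 // gt_eqF // expR_gt0.
  exact: (log_ratio_le (N0 n n0) c0 c0' (a0 n n0) (rho_gt0 n n0) (aNrho n n0) h h').
- exact: cvg_cst.
- rewrite -[X in _ --> X](mulr0 (Cl + Cz)) -[X in _ * X](addr0 0).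
  by apply: cvgM; [exact: cvg_cst|exact: cvgD].
Unshelve. all: by end_near. Qed.
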